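(* Let $p>1$ and let $u,v$ be weights on $\mathbb{R}_+$. The following conditions are equivalent: 1. $\Lambda_2^p(uv)$ is normable. 2. $u$ and $v\in B_p$. 3. $\Lambda^p(u)[\Lambda^p(v)]$ is normable. 4. If $\|f\|^{*}_{\Lambda_2^p(uv)}:=\left(\int_0^\infty\int_0^\infty (f^{**}_{yx}(s,t))^p\,u(s)v(t)\,ds\,dt\right)^{1/p}$, then $\|\cdot\|^{*}_{\Lambda_2^p(uv)}$ is a norm equivalent to $\|\cdot\|_{\Lambda_2^p(uv)}$. 5. $S^2:L^p_{\rm dec}(\mathbb{R}^2_+,uv)\to L^p(\mathbb{R}^2_+,uv)$ is bounded. 6. $f\mapsto f^{**}_{yx}$ is bounded from $L^p_{\rm dec}(\mathbb{R}^2_+,uv)$ to $L^p(\mathbb{R}^2_+,uv)$. 7. The norm $\|f\|^{(2)}_{\Lambda_2^p(uv)}:=\left(\iint_{\mathbb{R}^2_+}(S^2 f^*_{yx}(s,t))^p\,u(s)v(t)\,ds\,dt\right)^{1/p}=\|f^{**}\|_{L^p(\mathbb{R}^2_+,uv)}$ is equivalent to $\|f\|_{\Lambda_2^p(uv)}$.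
   Context: $\mathbb{R}_+=(0,\infty)$ and $\mathbb{R}^2_+=(0,\infty)^2$. A weight is a non-negative locally integrable function. ''Decreasing'' means non-increasing. Rearrangements. For a measurable $f$ on $\mathbb{R}^n$, $\lambda_f(\sigma)=|\{x:|f(x)|>\sigma\}|$ and $f^*(t)=\inf\{\sigma:\lambda_f(\sigma)\le t\}$, $t>0$. For measurable $f:\mathbb{R}^2\to\mathbb{R}$, written $f(x,y)$, $f_y^*(x,t)$ is the decreasing rearrangement of $f(x,\cdot)$ evaluated at $t$ (with $x$ fixed), and a subscript $x$ on a star denotes the decreasing rearrangement with respect to the first variable. The two-dimensional decreasing rearrangement is $f^*_{yx}(s,t)=(f_y^*(\cdot,t))^*_x(s)$, $s,t>0$. Functions on $\mathbb{R}^2_+$ are regarded as functions on $\mathbb{R}^2$ by extending them by zero. Operators. For $f$ on $\mathbb{R}^2_+$, $S^2f(s,t)=\frac1{st}\int_0^s\int_0^t f(\sigma,\tau)\,d\tau\,d\sigma$. For $f$ on $\mathbb{R}^2$, $f^{**}(s,t)=S^2f^*_{yx}(s,t)$ and $f^{**}_{yx}(s,t)=\frac1s\int_0^s\left(\frac1t\int_0^t f_y^*(\cdot,\tau)\,d\tau\right)^*_x(\sigma)\,d\sigma$. Spaces. For a weight $w$ on $\mathbb{R}^2_+$ and $0<p<\infty$, $\Lambda_2^p(w)$ is the set of measurable $f:\mathbb{R}^2\to\mathbb{R}$ with $\|f\|_{\Lambda_2^p(w)}=\left(\int_{\mathbb{R}^2_+}(f^*_{yx}(s,t))^pw(s,t)\,ds\,dt\right)^{1/p}<\infty$;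 when $w(s,t)=u(s)v(t)$ it is denoted $\Lambda_2^p(uv)$. $\Lambda^p(u)[\Lambda^p(v)]$ is the set of measurable $f:\mathbb{R}^2\to\mathbb{R}$ with $$\|f\|_{\Lambda^p(u)[\Lambda^p(v)]}=\left(\int_0^\infty\left(\int_0^\infty (f_y^*(\cdot,t))^pv(t)\,dt\right)^*_x(s)\,u(s)\,ds\right)^{1/p}<\infty.$$ $L^p(\mathbb{R}^2_+,uv)$ is the $L^p$ space with respect to the measure $u(s)v(t)\,ds\,dt$, and $L^p_{\rm dec}(\mathbb{R}^2_+,uv)$ is the cone of (non-negative) functions in it that are decreasing in each variable separately; boundedness of a map $T$ on this cone means $\|Tf\|\le C\|f\|$ for all $f$ in the cone, with $C$ independent of $f$. A space defined by a functional $\|\cdot\|$ is normable if there is a norm on it equivalent to $\|\cdot\|$. Two functionals are equivalent if each is bounded by a constant multiple of the other. A weight $v$ on $\mathbb{R}_+$ belongs to $B_p$ if there is $C>0$ such that $r^p\int_r^\infty \frac{v(x)}{x^p}\,dx\le C\int_0^r v(x)\,dx$ for all $r>0$.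
   Formalization: Weights are assumed not a.e. zero (u=0, v∉B_p satisfies 5 but not 2) and integrable up to the origin (u=s^-2, v=x^{p-1} satisfies 1 but not 2); in 7 only the equivalence is claimed, as that functional need not be a norm. *)

(* Defs.v *)
From HB Require Import structures.
From mathcomp Require Import all_boot all_order all_algebra.
From mathcomp Require Import all_classical all_reals all_analysis.
Import Order.TTheory GRing.Theory Num.Theory.
Import numFieldNormedType.Exports.

Set Implicit Arguments.
Unset Strict Implicit.
Unset Printing Implicit Defensive.

Local Open Scope classical_set_scope.
Local Open Scope ring_scope.
Local Open Scope ereal_scope.

Section Defs.
Context {R : realType}.

Definition leb : {measure set (measurableTypeR R) -> \bar R} :=
  @lebesgue_measure R.

Definition leb2 :
    {measure set (measurableTypeR R * measurableTypeR R)%type -> \bar R} :=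
  (@lebesgue_measure R \x @lebesgue_measure R)%E.

Definition Rp : set R := `]0%R, +oo[%classic.
Definition Rp2 : set (R * R) := Rp `*` Rp.

(* Local integrability is understood up to the origin, so that the primitives
   \int_0^r u are finite: with integrability on compact subsets of (0, oo)
   only, u(s) = s^-2 would give Lambda^p_2(uv) = {0} for every v > 0. *)
Definition weight (u : R -> R) : Prop :=
  [/\ measurable_fun Rp (u : measurableTypeR R -> measurableTypeR R),
      forall x, Rp x -> (0 <= u x)%R &
      forall r, (0 < r)%R -> \int[leb]_(x in `]0%R, r[) (u x)%:E < +oo].

Definition prodw (u v : R -> R) : R * R -> R := fun z => (u z.1 * v z.2)%R.

Definition Bp (p : R) (v : R -> R) : Prop :=
  exists2 C : R, (0 < C)%R & forall r : R, (0 < r)%R ->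
    (r `^ p)%:E * \int[leb]_(x in `]r, +oo[) (v x / x `^ p)%:E
      <= C%:E * \int[leb]_(x in `]0%R, r[) (v x)%:E.

(* Functions are extended-real valued because the rearrangement of an
   unbounded function may be infinite and is rearranged again in x below. *)
Definition distr_fun (g : R -> \bar R) (a : R) : \bar R :=
  leb [set x | a%:E < `|g x|].

Definition rearr (g : R -> \bar R) (t : R) : \bar R :=
  ereal_inf [set a%:E | a in [set a : R | (0 <= a)%R /\ distr_fun g a <= t%:E]].

Definition rearr_y (f : R * R -> R) (x t : R) : \bar R :=
  rearr (fun y => (f (x, y))%:E) t.

Definition rearr_yx (f : R * R -> R) (z : R * R) : \bar R :=
  rearr (fun x => rearr_y f x z.2) z.1.

Definition S2 (h : R * R -> \bar R) (z : R * R) : \bar R :=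
  ((z.1 * z.2)^-1)%:E *
  \int[leb]_(a in `]0%R, z.1[) \int[leb]_(b in `]0%R, z.2[) h (a, b).

(* f^{**} *)
Definition maximal (f : R * R -> R) : R * R -> \bar R := S2 (rearr_yx f).

(* f^{**}_{yx} *)
Definition maximal_yx (f : R * R -> R) (z : R * R) : \bar R :=
  (z.1^-1)%:E * \int[leb]_(a in `]0%R, z.1[)
    rearr (fun x => (z.2^-1)%:E * \int[leb]_(b in `]0%R, z.2[) rearr_y f x b) a.

(* Since 0 * +oo = 0 in \bar R, this is the L^p functional on the quadrant for
   the measure w(s,t) ds dt. *)
Definition Lp_norm (p : R) (w : R * R -> R) (h : R * R -> \bar R) : \bar R :=
  (\int[leb2]_(z in Rp2) (`|h z| `^ p * (w z)%:E)) `^ (p^-1).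

Definition meas2 (D : set (R * R)) (f : R * R -> R) : Prop :=
  measurable_fun D
    (f : measurableTypeR R * measurableTypeR R -> measurableTypeR R).

Definition Lambda2_norm (p : R) (w : R * R -> R) (f : R * R -> R) : \bar R :=
  Lp_norm p w (rearr_yx f).

Definition Lambda2 (p : R) (w : R * R -> R) : set (R * R -> R) :=
  [set f | meas2 setT f /\ Lambda2_norm p w f < +oo].

Definition mixed_norm (p : R) (u v : R -> R) (f : R * R -> R) : \bar R :=
  (\int[leb]_(s in Rp)
     (rearr (fun x => \int[leb]_(t in Rp) ((rearr_y f x t) `^ p * (v t)%:E)) s
      * (u s)%:E)) `^ (p^-1).

Definition mixed_Lambda (p : R) (u v : R -> R) : set (R * R -> R) :=
  [set f | meas2 setT f /\ mixed_norm p u v f < +oo].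

(* X is a linear space of functions and N a (finite) norm on it, functions
   that agree almost everywhere being identified. *)
Record is_norm_on (X : set (R * R -> R)) (N : (R * R -> R) -> \bar R) : Prop := {
  space_add : forall f g, X f -> X g -> X (fun z => (f z + g z)%R) ;
  space_scale : forall (c : R) f, X f -> X (fun z => (c * f z)%R) ;
  norm_finite : forall f, X f -> 0 <= N f < +oo ;
  norm_eq0 : forall f, X f ->
    (N f = 0 <-> {ae leb2, forall z, f z = 0%R}) ;
  norm_scale : forall (c : R) f, X f ->
    N (fun z => (c * f z)%R) = `|c|%:E * N f ;
  norm_triangle : forall f g, X f -> X g ->
    N (fun z => (f z + g z)%R) <= N f + N g }.

Definition equiv_on (X : set (R * R -> R))
    (N M : (R * R -> R) -> \bar R) : Prop :=
  exists2 C : R, (0 < C)%R &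
    forall f, X f -> N f <= C%:E * M f /\ M f <= C%:E * N f.

Definition normable (X : set (R * R -> R)) (M : (R * R -> R) -> \bar R) : Prop :=
  exists2 N, is_norm_on X N & equiv_on X N M.

(* A function on the quadrant is represented by a function on R * R whose
   values outside Rp2 are irrelevant. *)
Definition Lp_dec (p : R) (w : R * R -> R) : set (R * R -> R) :=
  [set f | [/\ meas2 Rp2 f,
     forall z, Rp2 z -> (0 <= f z)%R,
     forall s s' t, Rp s -> Rp t -> (s <= s')%R -> (f (s', t) <= f (s, t))%R,
     forall s t t', Rp s -> Rp t -> (t <= t')%R -> (f (s, t') <= f (s, t))%R &
     Lp_norm p w (EFin \o f) < +oo]].

Definition bounded_on_cone (p : R) (w : R * R -> R)
    (T : (R * R -> R) -> (R * R -> \bar R)) : Prop :=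
  exists2 C : R, (0 < C)%R & forall f, Lp_dec p w f ->
    Lp_norm p w (T f) <= C%:E * Lp_norm p w (EFin \o f).

Definition extend0 (f : R * R -> R) : R * R -> R :=
  patch (fun=> 0%R) Rp2 f.

End Defs.

(* Main.v *)
Require Import Defs.
From mathcomp Require Import all_boot all_order all_algebra.
From mathcomp Require Import all_classical all_reals all_analysis.
From mathcomp Require Import measurable_realfun.
From mathcomp Require Import ring lra.
Import Order.TTheory GRing.Theory Num.Theory.
Import numFieldNormedType.Exports.
Local Open Scope classical_set_scope.
Local Open Scope ring_scope.
Set Implicit Arguments.
Unset Strict Implicit.
Unset Printing Implicit Defensive.

(** All seven conditions are compared with the second one, that both weights
    are in B_p.

    Sufficiency of B_p.  The B_p condition improves the growth of the
    primitive of the weight: for every [e > 0] there is a dyadic [m] such that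
    the integral over ]0, m r[ is at most [e m^p] times the integral over
    ]0, r[ ([Bp_dyadic_decay]).  Such a dilation estimate holds for all
    nonincreasing functions in place of indicators of intervals
    ([le_dilation]), and it lets one absorb the main term of the average, so
    that averaging is bounded on the nonincreasing functions of L^p(w)
    ([hardy]); iterating over the two variables gives the boundedness of S^2
    on the cone ([hardy2]).  On the other hand the maximal function of a
    rearrangement is a K-functional ([avg_rearr_le], [le_avg_rearr]); it is
    therefore subadditive ([avg_rearr_subadd]) and obeys Minkowski's integral
    inequality ([avg_rearr_integral]).  Hence
      f^*_yx <= f^**_yx <= f^** = S^2 f^*_yx
    pointwise, f^**_yx is subadditive in f, and the two-dimensional Hardy
    inequality makes the three L^p functionals equivalent.  For the mixed
    space the same is done one variable at a time: the norm is obtained by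
    averaging the rearrangement before each of the two integrations ([mixN]).

    Necessity, from an operator.  On the indicator of the rectangle
    ]0, r[ x ]0, q[ each of the three operators is at least
    min(1, r/s) min(1, q/t) at (s, t).  Integrating over t < q leaves a
    positive finite factor [prim v q] on both sides; what remains is the B_p
    inequality for u at r ([Bp_of_test]).

    Necessity, from normability.  Tensoring with the indicator of an interval
    embeds the one-dimensional Lambda space of either weight, so that if the
    space of functions of two variables is normable, the functional
    [Lam g], the norm of g^* in L^p(w), satisfies
      Lam (sum of phi_k) <= C * sum of Lam phi_k
    ([sum_of_normable]).  Take phi_k to be the translate by k r of the
    truncated hyperbola r / max(r, |x|), cut off at |x| = m r, for k < 2 m.
    Their sum is at least of the order of log m on ]0, m r[, while the p-th
    power of each [Lam phi_k] is at most of the order of log m times the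
    integral of w over ]0, r[.  Therefore the integral over ]0, m r[ is at
    most K m^p (log m)^(1 - p) times that over ]0, r[.  Since p > 1, the factor
    is m^p / 2 or less for a suitable m, and a geometric series gives B_p
    ([Bp_of_half]). *)

(** * Extended reals, the quadrant and the layer-cake formula *)

Section quadrant.
Context {R : realType}.
Local Notation mR := (measurableTypeR R).
Local Open Scope ereal_scope.

Lemma ge0_addye (x : \bar R) : 0 <= x -> +oo + x = +oo.
Proof. by case: x. Qed.

Lemma ge0_addey (x : \bar R) : 0 <= x -> x + +oo = +oo.
Proof. by case: x. Qed.

Lemma measurable_fun_gt d (T : measurableType d) (D : set T) (f : T -> \bar R) :
  measurable D -> (forall a : R, measurable (D `&` [set x | a%:E < f x])) ->
  measurable_fun D f.
Proof.
move=> mD h _; apply: (measurability _ (ErealGenOInfty.measurableE R)) => //.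
by move=> /= _ [_ [a ->] <-]; rewrite preimage_itvoy; exact: h.
Qed.

(** Nonnegative extended reals are compared through the nonnegative real
    numbers below them. *)
Lemma ge0_le_lt (x y : \bar R) : 0 <= y ->
  (forall a : R, (0 <= a)%R -> a%:E < x -> a%:E < y) -> x <= y.
Proof.
move=> y0 h; rewrite leNgt; apply/negP => yx.
case: y y0 h yx => [y| |]//= y0 h yx; last by move: yx; rewrite ltNge leey.
by have := h _ y0 yx; rewrite ltxx.
Qed.

Lemma ge0_eq_lt (x y : \bar R) : 0 <= x -> 0 <= y ->
  (forall a : R, (0 <= a)%R -> (a%:E < x) = (a%:E < y)) -> x = y.
Proof.
move=> x0 y0 h; apply/eqP; rewrite eq_le; apply/andP; split.
  by apply: ge0_le_lt => // a a0; rewrite h.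
by apply: ge0_le_lt => // a a0; rewrite h.
Qed.

Lemma measurable_Rp : measurable (@Rp R : set mR).
Proof. exact: measurable_itv. Qed.

Lemma measurable_Rp2 :
  measurable (@Rp2 R : set (mR * mR)).
Proof. by apply: measurableX; exact: measurable_Rp. Qed.

Lemma RpE (x : R) : Rp x = (0 < x)%R :> Prop.
Proof. by rewrite /Rp /= in_itv/= andbT. Qed.

Lemma Rp2E (z : R * R) : Rp2 z = ((0 < z.1)%R /\ (0 < z.2)%R) :> Prop.
Proof. by rewrite /Rp2 /setX /=; rewrite !RpE. Qed.

Lemma leb_itv (i : interval R) :
  leb [set` i] = (if i.1 < i.2 then i.2 - i.1 else 0).
Proof. exact: lebesgue_measure_itv. Qed.

(** A value is the measure of the set of positive levels below it. *)
Lemma leb_below (y : \bar R) : 0 <= y ->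
  leb [set a : R | Rp a /\ a%:E < y] = y.
Proof.
move=> y0; have -> : [set a : R | Rp a /\ a%:E < y] =
    if y is r%:E then `]0%R, r[%classic else if y is +oo then Rp else set0.
  apply/seteqP; split=> a /=; case: y y0 => [r| |]//= r0; rewrite ?RpE ?in_itv/=.
  - by rewrite lte_fin => -[-> ->].
  - by case.
  - by rewrite lte_fin => /andP[-> ->].
  - by rewrite ltry.
case: y y0 => [r| |]//= r0; rewrite /leb /Rp ?measure0// lebesgue_measure_itv//=.
rewrite lte_fin; case: ltP => r1; first by rewrite sube0.
by congr EFin; apply/eqP; rewrite eq_le r1 andbT.
by rewrite ltry oppr0 adde0.
Qed.

(** Tonelli's theorem on the quadrant. *)
Lemma integral_Rp2 (h : R * R -> \bar R) :
  measurable_fun Rp2 (h : mR * mR -> _) ->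
  (forall z, Rp2 z -> 0 <= h z) ->
  \int[leb2]_(z in Rp2) h z =
    \int[leb]_(s in Rp) \int[leb]_(t in Rp) h (s, t).
Proof.
move=> mh h0; rewrite integral_mkcond fubini_tonelli1; last 2 first.
- by apply/(measurable_restrictT _ _).1 => //; exact: measurable_Rp2.
- by move=> z; rewrite patchE; case: ifPn => // /set_mem; exact: h0.
rewrite [RHS]integral_mkcond; apply: eq_integral => x _.
rewrite /fubini_F patchE; case: ifPn => [/set_mem xp|xp].
  rewrite [RHS]integral_mkcond; apply: eq_integral => y _ /=.
  rewrite !patchE; congr (if _ then _ else _).
  by apply/idP/idP => /set_mem; rewrite ?Rp2E/= => H; apply/mem_set;
    rewrite ?Rp2E/=; move: xp H; rewrite !RpE; tauto.
rewrite integral0_eq// => y _; rewrite patchE ifN//.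
by apply: contra xp => /set_mem []/= ? _; exact/mem_set.
Qed.

Lemma integral_Rp2_swap (h : R * R -> \bar R) :
  measurable_fun Rp2 (h : mR * mR -> _) ->
  (forall z, Rp2 z -> 0 <= h z) ->
  \int[leb2]_(z in Rp2) h z =
    \int[leb]_(t in Rp) \int[leb]_(s in Rp) h (s, t).
Proof.
move=> mh h0; rewrite integral_mkcond fubini_tonelli2; last 2 first.
- by apply/(measurable_restrictT _ _).1 => //; exact: measurable_Rp2.
- by move=> z; rewrite patchE; case: ifPn => // /set_mem; exact: h0.
rewrite [RHS]integral_mkcond; apply: eq_integral => y _.
rewrite /fubini_G patchE; case: ifPn => [/set_mem yp|yp].
  rewrite [RHS]integral_mkcond; apply: eq_integral => x _ /=.
  rewrite !patchE; congr (if _ then _ else _).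
  by apply/idP/idP => /set_mem; rewrite ?Rp2E/= => H; apply/mem_set;
    rewrite ?Rp2E/=; move: yp H; rewrite !RpE; tauto.
rewrite integral0_eq// => x _; rewrite patchE ifN//.
by apply: contra yp => /set_mem []/= _ ?; exact/mem_set.
Qed.

(** Both sides integrate [phi] over the region under the graph of [f], in the
    two orders. *)
Lemma layer_cake_tonelli (D : set R) (f phi : R -> \bar R) :
  measurable (D : set mR) ->
  measurable_fun D (f : mR -> _) ->
  measurable_fun D (phi : mR -> _) ->
  (forall x, D x -> 0 <= f x) -> (forall x, D x -> 0 <= phi x) ->
  measurable_fun Rp
    ((fun a => \int[leb]_(x in D `&` [set x | a%:E < f x]) phi x) :
      mR -> _) /\
  \int[leb]_(x in D) (f x * phi x) =
  \int[leb]_(a in Rp) \int[leb]_(x in D `&` [set x | a%:E < f x]) phi x.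
Proof.
move=> mD mf mphi f0 phi0.
pose E : set (mR * mR) :=
  (Rp `*` D) `&` [set z | z.1%:E < f z.2].
have mRD : measurable (Rp `*` D : set (mR * mR)).
  by apply: measurableX => //; exact: measurable_Rp.
have sndD (g : R -> \bar R) : measurable_fun D (g : mR -> _) ->
    measurable_fun (Rp `*` D)
      ((fun z => g z.2) : mR * mR -> _).
  move=> mg; apply: (measurable_comp mD _ mg).
    by move=> _ [z [_ ?] <-].
  exact: measurable_funTS measurable_snd.
have mE : measurable E.
  apply: measurable_lte => //; last exact: sndD.
  apply/measurable_EFinP; exact: measurable_funTS measurable_fst.
pose H := (fun z : mR * mR => phi z.2) \_ E.
have mH : measurable_fun setT H.
  apply/(measurable_restrictT _ _).1 => //.
  by apply: measurable_funS (sndD _ mphi) => //; exact: subIsetl.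
have H0 z : 0 <= H z.
  by rewrite /H patchE; case: ifPn => // /set_mem[[_ /phi0]].
have HE a : \int[leb]_x H (a, x) =
    ((fun a => \int[leb]_(x in D `&` [set x | a%:E < f x]) phi x) \_ Rp) a.
  rewrite patchE; case: ifPn => [/set_mem ap|ap].
    rewrite [RHS]integral_mkcond; apply: eq_integral => x _ /=.
    rewrite /H !patchE; congr (if _ then _ else _).
    apply/idP/idP => /set_mem.
      by case=> -[_ Dx] fx; exact/mem_set.
    by case=> Dx fx; exact/mem_set.
  apply: integral0_eq => x _; rewrite /H patchE ifN//.
  by apply: contra ap => /set_mem [[? _] _]; exact/mem_set.
split.
  apply: (measurable_restrictT _ measurable_Rp).2.
  have := @measurable_fun_fubini_tonelli_F _ _ _ _ _ leb H mH H0.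
  by congr measurable_fun; apply/funext => a; rewrite -HE.
transitivity (\int[leb]_x \int[leb]_a H (a, x)); last first.
  rewrite -(@fubini_tonelli _ _ _ _ _ leb leb H)// [RHS]integral_mkcond.
  by apply: eq_integral => a _.
rewrite integral_mkcond; apply: eq_integral => x _.
rewrite patchE; case: ifPn => [/set_mem xD|xD]; last first.
  rewrite integral0_eq// => a _; rewrite /H patchE ifN//.
  by apply: contra xD => /set_mem [[_ ?] _]; exact/mem_set.
rewrite -[in LHS](leb_below (f0 _ xD)).
pose S := [set a : mR | Rp a /\ a%:E < f x].
have mS : measurable S.
  have -> : S = Rp `&` [set a | a%:E < cst (f x) a] by [].
  apply: measurable_lte => //; first exact: measurable_Rp.
transitivity (\int[leb]_(a in S) cst (phi x) a).
  by rewrite integral_cst// muleC.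
rewrite [LHS]integral_mkcond; apply: eq_integral => a _.
rewrite /H !patchE; congr (if _ then _ else _).
apply/idP/idP => /set_mem.
  by case=> aR fx; exact/mem_set.
by case=> -[aR _] fx; exact/mem_set.
Qed.

(** The layer-cake formula. *)
Lemma layer_cake (D : set R) (f phi : R -> \bar R) :
  measurable (D : set mR) ->
  measurable_fun D (f : mR -> _) ->
  measurable_fun D (phi : mR -> _) ->
  (forall x, D x -> 0 <= f x) -> (forall x, D x -> 0 <= phi x) ->
  \int[leb]_(x in D) (f x * phi x) =
  \int[leb]_(a in Rp) \int[leb]_(x in D `&` [set x | a%:E < f x]) phi x.
Proof. by move=> mD mf mp f0 p0; case: (layer_cake_tonelli mD mf mp f0 p0). Qed.

Lemma measurable_layer (D : set R) (f phi : R -> \bar R) :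
  measurable (D : set mR) ->
  measurable_fun D (f : mR -> _) ->
  measurable_fun D (phi : mR -> _) ->
  (forall x, D x -> 0 <= f x) -> (forall x, D x -> 0 <= phi x) ->
  measurable_fun Rp
    ((fun a => \int[leb]_(x in D `&` [set x | a%:E < f x]) phi x) :
      mR -> _).
Proof. by move=> mD mf mp f0 p0; case: (layer_cake_tonelli mD mf mp f0 p0). Qed.

End quadrant.

(** * The decreasing rearrangement *)

Section rearrangement.
Context {R : realType}.
Local Notation mR := (measurableTypeR R).
Local Open Scope ereal_scope.

Lemma measurable_superlevel d (T : measurableType d) (g : T -> \bar R) (a : R) :
  measurable_fun setT g -> measurable [set x | a%:E < `|g x|].
Proof.
move=> mg; rewrite -[X in measurable X]setTI.
have -> : [set x | a%:E < `|g x|] = [set x | cst a%:E x < (abse \o g) x] by [].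
by apply: measurable_lte => //; exact: measurableT_comp.
Qed.

Lemma distr_fun_ge0 (g : R -> \bar R) a : 0 <= distr_fun g a.
Proof. exact: measure_ge0. Qed.

Lemma le_distr_fun (f g : mR -> \bar R) a b :
  measurable_fun setT f -> measurable_fun setT g ->
  (forall x, b%:E < `|f x| -> a%:E < `|g x|) -> distr_fun f b <= distr_fun g a.
Proof.
move=> mf mg h; rewrite /distr_fun; apply: le_measure => /=.
- by rewrite inE; exact: measurable_superlevel.
- by rewrite inE; exact: measurable_superlevel.
- by move=> x /=; exact: h.
Qed.

(** The distribution function is continuous from the right. *)
Lemma distr_fun_right (g : mR -> \bar R) (a t : R) :
  measurable_fun setT g -> t%:E < distr_fun g a ->
  exists2 b : R, (a < b)%R & t%:E < distr_fun g b.
Proof.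
move=> mg ht; apply: contrapT => hn.
pose F n := [set x : mR | (a + n.+1%:R^-1)%:E < `|g x|].
have mF n : measurable (F n) by exact: measurable_superlevel.
have UF : \bigcup_n F n = [set x | a%:E < `|g x|].
  apply/seteqP; split=> x /=.
    case=> n _; rewrite /F/=; apply: le_lt_trans.
    by rewrite lee_fin lerDl invr_ge0.
  case E : (`|g x|) => [r| |] h; last by [].
    move: h; rewrite lte_fin -subr_gt0 => /ltr_add_invr[n].
    by rewrite add0r => hr; exists n; rewrite // /F/= E lte_fin -ltrBrDl.
  by exists 0%N; rewrite // /F/= E ltry.
have hcv : (leb \o F) x @[x --> \oo] --> leb (\bigcup_n F n).
  apply: nondecreasing_cvg_mu => //; first by rewrite UF; exact: measurable_superlevel.
  move=> n m nm; apply/subsetPset => x; rewrite /F/=; apply: le_lt_trans.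
  by rewrite lee_fin lerD2l lef_pV2 ?posrE// ler_nat.
have : leb (\bigcup_n F n) <= t%:E.
  rewrite -(cvg_lim _ hcv)//; apply: lime_le; first by apply/cvg_ex; eexists; exact: hcv.
  apply: nearW => n /=; rewrite leNgt; apply/negP => h; apply: hn.
  by exists (a + n.+1%:R^-1)%R => //; rewrite ltrDl invr_gt0.
by rewrite UF leNgt => /negP; exact.
Qed.

Lemma rearr_ge0 (g : R -> \bar R) t : 0 <= rearr g t.
Proof. by apply: le_ereal_inf_tmp => _ [a [a0 _] <-]; rewrite lee_fin. Qed.

Lemma rearr_le (g : R -> \bar R) (t a : R) :
  (0 <= a)%R -> distr_fun g a <= t%:E -> rearr g t <= a%:E.
Proof. by move=> a0 h; apply: ereal_inf_lbound; exists a. Qed.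

(** The level sets of the rearrangement of [g] are the intervals
    [{t | t < distr_fun g a}]. *)
Lemma rearr_gt (g : mR -> \bar R) (t a : R) : measurable_fun setT g ->
  (0 <= a)%R -> (a%:E < rearr g t) = (t%:E < distr_fun g a).
Proof.
move=> mg a0; apply/idP/idP.
  by apply: contraTT; rewrite -!leNgt => /rearr_le; exact.
move=> /(distr_fun_right mg)[b ab tb].
apply: (@lt_le_trans _ _ b%:E); first by rewrite lte_fin.
apply: le_ereal_inf_tmp => _ [c [c0 hc] <-]; rewrite lee_fin leNgt; apply/negP => cb.
have : distr_fun g b <= t%:E.
  apply: le_trans hc; apply: le_distr_fun => // x; apply: le_lt_trans.
  by rewrite lee_fin ltW.
by rewrite leNgt tb.
Qed.

Lemma rearr_nonincreasing (g : R -> \bar R) t t' :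
  (t <= t')%R -> rearr g t' <= rearr g t.
Proof.
move=> tt; apply: ereal_inf_le_tmp => _ [a [a0 h] <-]; exists a => //; split => //.
by apply: le_trans h _; rewrite lee_fin.
Qed.

Lemma le_rearr (f g : mR -> \bar R) t :
  measurable_fun setT f -> measurable_fun setT g ->
  (forall x, `|f x| <= `|g x|) -> rearr f t <= rearr g t.
Proof.
move=> mf mg h; apply: ge0_le_lt; first exact: rearr_ge0.
move=> a a0; rewrite !rearr_gt// => /lt_le_trans; apply.
by apply: le_distr_fun => // x /lt_le_trans; exact.
Qed.

(** Joint measurability in a parameter and in the argument of the
    rearrangement; it gives a meaning to the iterated rearrangement. *)
Lemma measurable_rearr_param d (T : measurableType d) (F : T * mR -> \bar R) :
  measurable_fun setT F ->
  measurable_fun setT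
    ((fun z => rearr (fun y => F (z.1, y)) z.2) : T * mR -> \bar R).
Proof.
move=> mF; have mF2 x : measurable_fun setT (fun y => F (x, y)).
  exact: measurableT_comp.
apply: measurable_fun_gt => // a; rewrite setTI.
have [a0|a0] := leP 0%R a; last first.
  rewrite (_ : [set _ | _] = setT)//; apply/seteqP; split => // z _ /=.
  by apply: lt_le_trans (rearr_ge0 _ _); rewrite lte_fin.
pose A := [set z : T * mR | a%:E < `|F z|].
have -> : [set z : T * mR | a%:E < rearr (fun y => F (z.1, y)) z.2] =
    setT `&` [set z | (EFin \o snd) z < ((leb \o xsection A) \o fst) z].
  apply/seteqP; split => -[x t] /=; rewrite rearr_gt//.
    by move=> h; split => //; congr (_ < leb _) : h; apply/seteqP; split => y /=;
      rewrite /xsection/= inE.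
  by case=> _; congr (_ < leb _); apply/seteqP; split => y /=;
      rewrite /xsection/= inE.
apply: measurable_lte => //.
  by apply/measurable_EFinP; exact: measurable_snd.
apply: measurableT_comp; last exact: measurable_fst.
apply: measurable_fun_xsection; exact: measurable_superlevel.
Qed.

Lemma measurable_rearr (g : mR -> \bar R) : measurable_fun setT g ->
  measurable_fun setT (rearr g : mR -> \bar R).
Proof.
move=> mg.
have m1 : measurable_fun setT ((fun z => g z.2) : mR * mR -> \bar R).
  by apply: measurableT_comp => //; exact: measurable_snd.
have := measurable_rearr_param m1.
by move=> /(measurableT_comp) /(_ (pair1_measurable (0%R : mR))).
Qed.

Lemma rearr0 (g : mR -> \bar R) t : (0 <= t)%R -> distr_fun g 0 = 0 -> rearr g t = 0.
Proof.
move=> t0 h; apply/eqP; rewrite eq_le rearr_ge0 andbT.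
by apply: rearr_le => //; rewrite h lee_fin.
Qed.

(** Rearrangement commutes with increasing maps of the values; [psi] is the
    inverse of [phi] on the levels. *)
Lemma rearr_comp (f g : mR -> \bar R) (phi : \bar R -> \bar R) (psi : R -> R) t :
  measurable_fun setT f -> measurable_fun setT g ->
  (forall y, 0 <= y -> 0 <= phi y) ->
  (forall a, 0 <= a -> 0 <= psi a)%R ->
  (forall a y, (0 <= a)%R -> 0 <= y -> (a%:E < phi y) = ((psi a)%:E < y)) ->
  (forall x, `|f x| = phi `|g x|) -> rearr f t = phi (rearr g t).
Proof.
move=> mf mg phi0 psi0 h fg; apply: ge0_eq_lt => //; first exact: rearr_ge0.
  by apply: phi0; exact: rearr_ge0.
move=> a a0; rewrite rearr_gt// h// ?rearr_ge0// rearr_gt//; last exact: psi0.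
congr (_ < leb _); apply/seteqP; split => x /=; rewrite fg h//.
Qed.

Lemma rearrZ (g : mR -> \bar R) (c t : R) : measurable_fun setT g -> (0 <= t)%R ->
  rearr (fun x => c%:E * g x) t = `|c|%:E * rearr g t.
Proof.
move=> mg t0; have [->|c0] := eqVneq c 0%R.
  rewrite normr0 mul0e; apply: rearr0 => //.
  rewrite /distr_fun (_ : [set _ | _] = set0) ?measure0// -subset0 => x /=.
  by rewrite mul0e abse0 ltxx.
have c1 : (0 < `|c|)%R by rewrite normr_gt0.
apply: (@rearr_comp _ g (fun y => `|c|%:E * y) (fun a => a / `|c|)%R) => //.
- exact: measurable_funeM.
- by move=> y y0; exact: mule_ge0.
- by move=> a a0; exact: divr_ge0.
- move=> a [y| |] a0 y0 //.
    by rewrite -EFinM !lte_fin ltr_pdivrMr// mulrC.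
  by rewrite gt0_muley ?lte_fin// !ltry.
- by move=> x; rewrite abseM.
Qed.

Lemma rearr_poweR (g : mR -> \bar R) (r t : R) : measurable_fun setT g ->
  (0 < r)%R -> rearr (fun x => `|g x| `^ r) t = (rearr g t) `^ r.
Proof.
move=> mg r0; apply: (@rearr_comp _ g (fun y => y `^ r) (fun a => a `^ r^-1)%R) => //.
- apply: (measurableT_comp (measurable_poweR r)); exact: measurableT_comp.
- by move=> y _; exact: poweR_ge0.
- by move=> a a0; exact: powR_ge0.
- move=> a [y| |] a0 y0 //.
    rewrite poweR_EFin !lte_fin; rewrite lee_fin in y0.
    apply/idP/idP => h.
      rewrite -[ltRHS](@powRr1 _ y)// -(mulfV (lt0r_neq0 r0)) powRrM.
      by apply: gt0_ltr_powR => //; rewrite ?invr_gt0// nnegrE powR_ge0.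
    rewrite -[ltLHS](@powRr1 _ a)// -(mulVf (lt0r_neq0 r0)) powRrM.
    by apply: gt0_ltr_powR => //; rewrite nnegrE ?powR_ge0.
  by rewrite poweRyr ?gt_eqF// !ltry.
- by move=> x; rewrite gee0_abs// poweR_ge0.
Qed.

End rearrangement.

(** * Averages and primitives of weights *)

Section averages.
Context {R : realType}.
Local Notation mR := (measurableTypeR R).
Local Open Scope ereal_scope.

Lemma measurable_inv : measurable_fun setT ((fun x => x^-1)%R : mR -> mR).
Proof.
have -> : ((fun x => x^-1)%R : mR -> mR) =
    (fun x : mR => if (0 < x)%R then (x `^ (-1))%R else (- ((- x) `^ (-1)))%R : mR).
  apply/funext => x; case: ltP => x0; first by rewrite powR_inv1// ltW.
  by rewrite powR_inv1 ?oppr_ge0// invrN opprK.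
apply: measurable_fun_ifT.
- by apply: measurable_fun_ltr.
- exact: measurable_powR.
- apply: measurableT_comp => //; apply: (measurableT_comp (measurable_powR (-1)%R)).
  exact: oppr_measurable.
Qed.

Lemma measurable_integral_param d (T : measurableType d) (F : T * mR -> \bar R) :
  measurable_fun setT F -> (forall z, 0 <= F z) ->
  measurable_fun setT
    ((fun z => \int[leb]_(b in `]0%R, z.2[) F (z.1, b)) : T * mR -> \bar R).
Proof.
move=> mF F0.
pose E := [set w : (T * mR) * mR | (0 < w.2)%R] `&`
          [set w : (T * mR) * mR | (w.2 < w.1.2)%R].
have m2 : measurable_fun setT (fun w : (T * mR) * mR => w.2) by exact: measurable_snd.
have m12 : measurable_fun setT (fun w : (T * mR) * mR => w.1.2).
  by apply: measurableT_comp; [exact: measurable_snd|exact: measurable_fst].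
have mE : measurable E.
  have mlt (f g : (T * mR) * mR -> mR) : measurable_fun setT f -> measurable_fun setT g ->
      measurable [set w | (f w < g w)%R].
    move=> mf mg; rewrite -[X in measurable X]setTI.
    by apply: (@measurable_lte _ _ _ _ _ (EFin \o f) (EFin \o g)) => //;
      exact/measurable_EFinP.
  by apply: measurableI; apply: mlt.
pose G : (T * mR) * mR -> \bar R := (fun w => F (w.1.1, w.2)) \_ E.
have mG : measurable_fun setT G.
  apply: (measurable_restrictT (fun w : (T * mR) * mR => F (w.1.1, w.2)) mE).1.
  apply: measurable_funTS.
  apply: (measurableT_comp mF); apply: measurable_fun_pair => //.
  by apply: measurableT_comp; [exact: measurable_fst|exact: measurable_fst].
have G0 w : 0 <= G w by rewrite /G patchE; case: ifP.
have := @measurable_fun_fubini_tonelli_F _ _ _ _ _ leb G mG G0.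
congr measurable_fun; apply/funext => z; rewrite /fubini_F [RHS]integral_mkcond.
apply: eq_integral => b _; rewrite /G !patchE; congr (if _ then _ else _).
by apply/idP/idP => /set_mem; rewrite /E/= ?in_itv/= => h; apply/mem_set;
  rewrite /= ?in_itv/=; [apply/andP|apply/andP].
Qed.

(** The average of [g] over ]0, t[; it is the maximal function g^** when [g]
    is a rearrangement. *)
Definition avg (g : R -> \bar R) (t : R) : \bar R :=
  (t^-1)%:E * \int[leb]_(b in `]0%R, t[) g b.

Lemma measurable_avg_param d (T : measurableType d) (F : T * mR -> \bar R) :
  measurable_fun setT F -> (forall z, 0 <= F z) ->
  measurable_fun setT ((fun z => avg (fun b => F (z.1, b)) z.2) : T * mR -> \bar R).
Proof.
move=> mF F0; apply: emeasurable_funM; last exact: measurable_integral_param.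
apply/measurable_EFinP; apply: measurableT_comp; first exact: measurable_inv.
exact: measurable_snd.
Qed.

Lemma measurable_avg (g : mR -> \bar R) : measurable_fun setT g ->
  (forall x, 0 <= g x) -> measurable_fun setT (avg g : mR -> \bar R).
Proof.
move=> mg g0.
have m1 : measurable_fun setT ((fun z => g z.2) : mR * mR -> \bar R).
  by apply: measurableT_comp => //; exact: measurable_snd.
have := measurable_avg_param m1 (fun z => g0 z.2).
by move=> /(measurableT_comp) /(_ (pair1_measurable (0%R : mR))).
Qed.

Lemma avg_ge0 (g : R -> \bar R) t : (forall x, 0 <= g x) -> 0 <= avg g t.
Proof.
move=> g0; have [t0|t0] := ltP 0%R t; last first.
  by rewrite /avg set_itv_ge ?integral_set0 ?mule0// bnd_simp -leNgt.
apply: mule_ge0; first by rewrite lee_fin invr_ge0 ltW.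
by apply: integral_ge0 => x _.
Qed.

(** The primitive of a weight that vanishes at the origin. *)
Definition prim (w : R -> R) (r : R) : \bar R :=
  \int[leb]_(x in `]0%R, r[) (w x)%:E.

Lemma sub_itv_Rp (a b : itv_bound R) : (BRight 0%R <= a)%O ->
  [set` Interval a b] `<=` @Rp R.
Proof.
move=> ha x /=; rewrite RpE itv_boundlr => /andP[h1 _].
by have := le_trans ha h1; rewrite bnd_simp.
Qed.

Section weight_facts.
Variables (w : R -> R).
Hypothesis hw : weight w.

Lemma weightM (D : set mR) : D `<=` Rp ->
  measurable_fun D ((fun x => (w x)%:E) : mR -> \bar R).
Proof.
case: hw => mw _ _ hD; apply/measurable_EFinP; apply: measurable_funS mw => //.
exact: measurable_Rp.
Qed.

Lemma weight_ge0 x : Rp x -> 0 <= (w x)%:E.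
Proof. by case: hw => _ h _ /h; rewrite lee_fin. Qed.

Lemma prim_ge0 r : 0 <= prim w r.
Proof.
by apply: integral_ge0 => x xr; apply: weight_ge0; move: x xr; exact: sub_itv_Rp.
Qed.

Lemma prim_le0 r : (r <= 0)%R -> prim w r = 0.
Proof. by move=> r0; rewrite /prim set_itv_ge ?integral_set0// bnd_simp -leNgt. Qed.

Lemma prim_fin r : prim w r \is a fin_num.
Proof.
have [r0|r0] := leP r 0%R; first by rewrite prim_le0.
by rewrite ge0_fin_numE ?prim_ge0//; case: hw => _ _; apply.
Qed.

Lemma le_prim r s : (r <= s)%R -> prim w r <= prim w s.
Proof.
move=> rs; apply: ge0_subset_integral => //.
- by apply: weightM; exact: sub_itv_Rp.
- by move=> x xs; apply: weight_ge0; move: x xs; exact: sub_itv_Rp.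
- by apply: subset_itvl; rewrite bnd_simp.
Qed.

End weight_facts.

(** A nonnegative function on the half-line is integrated by exhaustion. *)
Lemma integral_Rp_le (f : mR -> \bar R) (c : \bar R) :
  measurable_fun Rp f -> (forall x, Rp x -> 0 <= f x) ->
  (forall n : nat, \int[leb]_(x in `]0%R, n%:R[) f x <= c) ->
  \int[leb]_(x in Rp) f x <= c.
Proof.
move=> mf f0 h.
have UR : \bigcup_n (`]0%R, n%:R[%classic : set mR) = Rp.
  apply/seteqP; split=> x /=.
    by case=> n _; rewrite /= RpE in_itv/= => /andP[].
  rewrite RpE => x0; exists (Num.truncn x).+1 => //=.
  by rewrite in_itv/= x0 truncnS_gt.
have sR n : (`]0%R, n%:R[%classic : set mR) `<=` Rp by exact: sub_itv_Rp.
have hcv : \int[leb]_(x in `]0%R, n%:R[) f x @[n --> \oo] -->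
    \int[leb]_(x in \bigcup_n (`]0%R, n%:R[%classic : set mR)) f x.
  apply: ge0_nondecreasing_set_cvg_integral => //.
  - move=> n m nm; apply/subsetPset; apply: subset_itvl.
    by rewrite bnd_simp ler_nat.
  - by move=> n; apply: measurable_funS mf => //; exact: measurable_Rp.
  - by move=> n x /sR/f0.
rewrite UR in hcv; rewrite -(cvg_lim _ hcv)//; apply: lime_le.
  by apply/cvg_ex; eexists; exact: hcv.
exact: nearW.
Qed.

End averages.

(** * Dilations of nonincreasing functions *)

Section dilation.
Context {R : realType}.
Local Notation mR := (measurableTypeR R).
Local Open Scope ereal_scope.

(** Nonincreasing on the positive half-line; the values elsewhere are
    irrelevant. *)
Definition nonincr_Rp (g : R -> \bar R) :=
  forall s t : R, (0 < s)%R -> (s <= t)%R -> g t <= g s.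

(** A bound on the growth of the primitive of a weight under a dilation passes
    to all nonincreasing functions, because their superlevel sets are
    intervals that start at the origin. *)
Lemma le_dilation (w : R -> R) (m K : R) (g : mR -> \bar R) :
  weight w -> (0 < m)%R -> (0 <= K)%R ->
  (forall r, (0 < r)%R -> prim w (m * r) <= K%:E * prim w r) ->
  measurable_fun setT g -> (forall x, 0 <= g x) -> nonincr_Rp g ->
  \int[leb]_(t in Rp) (g (t / m)%R * (w t)%:E) <=
  K%:E * \int[leb]_(t in Rp) (g t * (w t)%:E).
Proof.
move=> hw m0 K0 hK mg g0 dg.
have mgm : measurable_fun setT ((fun t => g (t / m)%R) : mR -> \bar R).
  by apply: (measurableT_comp mg); exact: mulrr_measurable.
have mw : measurable_fun Rp ((fun x => (w x)%:E) : mR -> \bar R) by exact: weightM.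
have w0 x : Rp x -> 0 <= (w x)%:E by exact: weight_ge0.
have mRp := @measurable_Rp R.
rewrite !(@layer_cake _ Rp)//; try exact: measurable_funTS.
pose D (h : R -> \bar R) a := Rp `&` [set x : mR | a%:E < h x].
have mD h a : measurable_fun setT (h : mR -> \bar R) -> measurable (D h a).
  move=> mh; apply: (@measurable_lte _ _ _ _ _ (cst a%:E) h) => //.
  exact: measurable_funTS.
have mint (h : mR -> \bar R) : measurable_fun setT h ->
    (forall x, 0 <= h x) ->
    measurable_fun Rp ((fun a => \int[leb]_(x in D h a) (w x)%:E) : mR -> \bar R).
  by move=> mh h0; apply: measurable_layer => //; exact: measurable_funTS.
rewrite -ge0_integralZl//; last 2 first.
- exact: (mint g mg g0).
- by move=> a _; apply: integral_ge0 => x [/w0].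
apply: ge0_le_integral => //.
- by move=> a _; apply: integral_ge0 => x [/w0].
- exact: (mint _ mgm (fun t => g0 _)).
- by apply: measurable_funeM; exact: (mint g mg g0).
move=> a _; rewrite -/(D g a) -/(D (fun t => g (t / m)%R) a).
have sD h : D h a `<=` Rp by move=> x [].
have mL : measurable [set x : mR | a%:E < g (x / m)%R].
  rewrite -[X in measurable X]setTI.
  by apply: (@measurable_lte _ _ _ _ _ (cst a%:E) ((fun x => g (x / m)%R) : mR -> \bar R)).
rewrite integral_mkcondr; apply: integral_Rp_le.
- have [+ _] := measurable_restrict (fun x : mR => (w x)%:E) mL mRp.
  by apply; apply: weightM => // x [].
- by move=> x x0; rewrite patchE; case: ifP => // _; exact: w0.
move=> n; rewrite -integral_mkcondr.
set E := (X in \int[_]_(_ in X) _ <= _).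
have mE : measurable (E : set mR) by exact: measurableI.
have En x : E x -> (x < n%:R)%R by case=> /=; rewrite in_itv/= => /andP[].
have E0 x : E x -> (0 < x)%R by case=> /=; rewrite in_itv/= => /andP[].
have [[x0 Ex0]|nE] := pselect (exists x, E x); last first.
  rewrite (_ : E = set0); last by rewrite -subset0 => x Ex; apply: nE; exists x.
  by rewrite integral_set0 mule_ge0 ?lee_fin//; apply: integral_ge0 => x [/w0].
(* a superlevel set cut at [n] lies in ]0, sup E], and the undilated one
   contains ]0, sup E / m[ *)
have supE : has_sup E.
  by split; [exists x0|exists n%:R => x /En/ltW].
have s0 : (0 < sup E)%R by apply: lt_le_trans (E0 _ Ex0) _; exact: sup_upper_bound.
apply: (@le_trans _ _ (prim w (sup E))).
  rewrite /prim integral_itv_bndo_bndc; last first.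
    by apply: weightM => // x /=; rewrite RpE in_itv/= => /andP[].
  apply: ge0_subset_integral => //.
  - by apply: weightM => // x /=; rewrite RpE in_itv/= => /andP[].
  - by move=> x /=; rewrite in_itv/= => /andP[x0' _]; apply: w0; rewrite RpE.
  - move=> x Ex /=; rewrite in_itv/= E0//=; exact: sup_upper_bound.
have -> : sup E = (m * (sup E / m))%R by rewrite mulrC divfK// gt_eqF.
apply: le_trans (hK _ (divr_gt0 s0 m0)) _.
rewrite lee_wpmul2l//; apply: ge0_subset_integral => //.
- exact: mD.
- by apply: weightM => // x [].
- by move=> x [/w0].
move=> y /=; rewrite in_itv/= => /andP[y0 ys].
have : (m * y < sup E)%R by rewrite mulrC -ltr_pdivlMr.
move=> /(sup_gt (ex_intro _ x0 Ex0))[x Ex yx].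
split; first by rewrite RpE.
rewrite /=; case: (Ex) => _ /= /lt_le_trans; apply; apply: dg => //.
by rewrite ler_pdivlMr// mulrC ltW.
Qed.

End dilation.

(** * The B_p condition and the growth of the primitive *)

Section Bp_growth.
Context {R : realType}.
Local Notation mR := (measurableTypeR R).
Local Open Scope ereal_scope.

Lemma expr_small (x c e : R) : (0 <= x < 1)%R -> (0 < e)%R ->
  exists n : nat, (x ^+ n * c <= e)%R.
Proof.
move=> /andP[x0 x1] e0.
have : (x ^+ n * c)%R @[n --> \oo] --> (0 * c)%R.
  by apply: cvgMl; apply: cvg_expr; rewrite ger0_norm.
rewrite mul0r => /cvgrPdist_le /(_ _ e0) [n _ /(_ n (leqnn n))] /=.
by rewrite sub0r normrN => h; exists n; apply: le_trans h; exact: ler_norm.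
Qed.

Section Bp_facts.
Variables (p : R) (w : R -> R).
Hypotheses (p0 : (0 < p)%R) (hw : weight w).

(** The integral of the B_p condition. *)
Definition tail (r : R) : \bar R := \int[leb]_(x in `]r, +oo[) (w x / x `^ p)%:E.

Lemma measurable_tail (D : set mR) : D `<=` @Rp R ->
  measurable_fun D ((fun x => (w x / x `^ p)%:E) : mR -> \bar R).
Proof.
move=> DR; apply/measurable_EFinP; apply: measurable_funM.
  by apply/measurable_EFinP; exact: weightM.
apply: measurable_funTS; apply: (measurableT_comp measurable_inv).
exact: measurable_powR.
Qed.

Lemma tail_integrand_ge0 x : Rp x -> 0 <= (w x / x `^ p)%:E.
Proof.
move=> /(weight_ge0 hw); rewrite !lee_fin => wx.
by rewrite divr_ge0// powR_ge0.
Qed.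

Lemma sub_itvy_Rp (r : R) : (0 <= r)%R -> `]r, +oo[ `<=` @Rp R.
Proof. by move=> r0 x /=; rewrite in_itv/= andbT RpE; exact: le_lt_trans. Qed.

Lemma sub_itvoc_Rp (r s : R) : (0 <= r)%R -> `]r, s] `<=` @Rp R.
Proof.
by move=> r0 x /=; rewrite in_itv/= RpE => /andP[+ _]; exact: le_lt_trans.
Qed.

Lemma tail_ge0 r : (0 <= r)%R -> 0 <= tail r.
Proof.
move=> r0; apply: integral_ge0 => x xr; apply: tail_integrand_ge0.
by move: x xr; exact: sub_itvy_Rp.
Qed.

Lemma tailD r s : (0 < r)%R -> (r <= s)%R ->
  tail r = \int[leb]_(x in `]r, s]) (w x / x `^ p)%:E + tail s.
Proof.
move=> r0 rs; rewrite /tail.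
have -> : `]r, +oo[%classic = `]r, s]%classic `|` `]s, +oo[%classic :> set mR.
  by rewrite -itv_bndbnd_setU// bnd_simp.
rewrite ge0_integral_setU//.
- by apply: measurable_tail => x [|]; [apply: sub_itvoc_Rp|apply: sub_itvy_Rp];
    rewrite ?ltW//; apply: lt_le_trans rs.
- move=> x h; apply: tail_integrand_ge0.
  by case: h; [apply: sub_itvoc_Rp|apply: sub_itvy_Rp];
    rewrite ?ltW//; apply: lt_le_trans rs.
- apply/disj_setPS => x [] /=; rewrite !in_itv/= andbT => /andP[_].
  by move=> /le_lt_trans h /h; rewrite ltxx.
Qed.

Lemma primD r s : (0 < r)%R -> (r <= s)%R ->
  prim w s = prim w r + \int[leb]_(x in `]r, s]) (w x)%:E.
Proof.
move=> r0 rs.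
have sR : `]0%R, s] `<=` @Rp R by exact: sub_itvoc_Rp.
have sR2 : `]r, s] `<=` @Rp R by apply: sub_itvoc_Rp; exact: ltW.
have sR3 : `]0%R, r] `<=` @Rp R by exact: sub_itvoc_Rp.
have sR4 t : (`]0%R, t[%classic : set mR) `<=` @Rp R by exact: sub_itv_Rp.
have primE t : prim w t = \int[leb]_(x in `]0%R, t]) (w x)%:E.
  by rewrite /prim integral_itv_bndo_bndc//; exact: weightM.
rewrite !primE.
have -> : `]0%R, s]%classic = `]0%R, r]%classic `|` `]r, s]%classic :> set mR.
  by rewrite -itv_bndbnd_setU// bnd_simp// ltW.
rewrite ge0_integral_setU//.
- by apply: weightM => // x [/sR3|/sR2].
- by move=> x h; apply: weight_ge0 => //; case: h => [/sR3|/sR2].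
- apply/disj_setPS => x [] /=; rewrite !in_itv/= => /andP[_].
  by move=> /le_lt_trans h /andP[/h]; rewrite ltxx.
Qed.

Lemma tail_block_ge r s : (0 < r)%R -> (r <= s)%R ->
  ((s `^ p)^-1)%:E * \int[leb]_(x in `]r, s]) (w x)%:E <=
  \int[leb]_(x in `]r, s]) (w x / x `^ p)%:E.
Proof.
move=> r0 rs; have sR : `]r, s] `<=` @Rp R by apply: sub_itvoc_Rp; exact: ltW.
rewrite -ge0_integralZl//; last 3 first.
- exact: weightM.
- by move=> x /sR; exact: weight_ge0.
- by rewrite lee_fin invr_ge0 powR_ge0.
apply: ge0_le_integral => //.
- move=> x /sR xR; apply: mule_ge0; last exact: weight_ge0.
  by rewrite lee_fin invr_ge0 powR_ge0.
- by apply: measurable_funeM; exact: weightM.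
- exact: measurable_tail.
move=> x xI; have := weight_ge0 hw (sR _ xI); rewrite lee_fin => wx.
rewrite -EFinM lee_fin mulrC ler_wpM2l//.
move: xI; rewrite /= in_itv/= => /andP[rx xs].
have x0 := lt_trans r0 rx.
rewrite lef_pV2 ?posrE ?powR_gt0//; last exact: lt_le_trans xs.
by rewrite ge0_ler_powR// ?nnegrE ltW// (lt_le_trans x0).
Qed.

Lemma tail_block_le r s : (0 < r)%R -> (r <= s)%R ->
  \int[leb]_(x in `]r, s]) (w x / x `^ p)%:E <=
  ((r `^ p)^-1)%:E * prim w s.
Proof.
move=> r0 rs; have sR : `]r, s] `<=` @Rp R by apply: sub_itvoc_Rp; exact: ltW.
apply: (@le_trans _ _ (((r `^ p)^-1)%:E * \int[leb]_(x in `]r, s]) (w x)%:E)).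
  rewrite -ge0_integralZl//; last 3 first.
  - exact: weightM.
  - by move=> x /sR; exact: weight_ge0.
  - by rewrite lee_fin invr_ge0 powR_ge0.
  apply: ge0_le_integral => //.
  - by move=> x /sR; exact: tail_integrand_ge0.
  - exact: measurable_tail.
  - by apply: measurable_funeM; exact: weightM.
  move=> x xI; have := weight_ge0 hw (sR _ xI); rewrite lee_fin => wx.
  rewrite -EFinM lee_fin mulrC ler_wpM2r//.
  move: xI; rewrite /= in_itv/= => /andP[rx xs].
  have x0 := lt_trans r0 rx.
  rewrite lef_pV2 ?posrE ?powR_gt0//.
  by rewrite ge0_ler_powR// ?nnegrE ltW.
rewrite lee_wpmul2l// ?lee_fin ?invr_ge0 ?powR_ge0// (primD r0 rs).
by rewrite leeDr// prim_ge0.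
Qed.

(** The B_p condition makes the primitive grow, along large dyadic dilations,
    by much less than the homogeneity [r ^ p]: with
    [T r = r ^ (- p) * prim w r + tail r], one has [T (2 * r) <= theta * T r]
    for some [theta < 1]. *)
Lemma Bp_dyadic_decay (e : R) : (0 < e)%R -> Bp p w ->
  exists n : nat, forall r : R, (0 < r)%R ->
    prim w (2 ^+ n * r) <= (e * (2 ^+ n) `^ p)%:E * prim w r.
Proof.
move=> e0 [C C0 hC].
pose v r := fine (prim w r); pose q r := fine (tail r).
have vE r : prim w r = (v r)%:E by rewrite fineK// prim_fin.
have v0 r : (0 <= v r)%R by rewrite -lee_fin -vE prim_ge0.
have X0 r : (0 < r)%R -> (0 < r `^ p)%R by move=> ?; exact: powR_gt0.
have qfin r : (0 < r)%R -> tail r \is a fin_num.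
  move=> r0; rewrite ge0_fin_numE ?tail_ge0 ?ltW//.
  have : (r `^ p)%:E * tail r < +oo.
    by apply: le_lt_trans (hC _ r0) _; rewrite -/(prim w r) vE -EFinM ltry.
  case: (tail r) => [t||]//; first by move=> _; rewrite ltry.
  by rewrite gt0_muley ?lte_fin ?X0.
have qE r : (0 < r)%R -> tail r = (q r)%:E by move=> r0; rewrite fineK// qfin.
have q0 r : (0 < r)%R -> (0 <= q r)%R.
  by move=> r0; rewrite -lee_fin -qE// tail_ge0// ltW.
have ha r : (0 < r)%R -> (r `^ p * q r <= C * v r)%R.
  by move=> r0; rewrite -lee_fin !EFinM -qE// -vE; exact: hC.
have hb r : (0 < r)%R -> ((v (2 * r) - v r) / (2 * r) `^ p <= q r - q (2 * r))%R.
  move=> r0; have r2 : (0 < 2 * r)%R by rewrite mulr_gt0.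
  have rr : (r <= 2 * r)%R by lra.
  have := tail_block_ge r0 rr.
  have := primD r0 rr; rewrite !vE; have := tailD r0 rr; rewrite !qE//.
  set I1 := integral _ _ _; set I2 := integral _ _ _.
  case: I1 => [i1| |]//; case: I2 => [i2| |]//; rewrite -?EFinM -?EFinD => -[->] -[->].
  by rewrite lee_fin => h; rewrite addrAC subrr add0r addrK mulrC.
pose T r := (v r / r `^ p + q r)%R.
have Z1 : (1 < 2 `^ p :> R)%R.
  by rewrite -[ltLHS]((congr1 (@^~ p) (@powR1 R))); apply: gt0_ltr_powR; rewrite ?nnegrE//; lra.
(* [T] loses a fixed part of [v r / r ^ p] at each doubling, and that quantity
   dominates [T r] by B_p *)
pose theta : R := (1 - (1 - (2 `^ p)^-1) / (1 + C))%R.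
have Zi : (0 < 1 - (2 `^ p : R)^-1 < 1)%R.
  have Z0 : (0 < 2 `^ p :> R)%R by exact: X0.
  by rewrite subr_gt0 invf_lt1// Z1/= ltrBlDr ltrDl invr_gt0.
have th : (0 <= theta < 1)%R.
  move: Zi; rewrite /theta; set z := (1 - _)%R => /andP[z0 z1].
  apply/andP; split; last by rewrite ltrBlDr ltrDl divr_gt0//; lra.
  by rewrite subr_ge0 ler_pdivrMr; lra.
have T0 r : (0 < r)%R -> (0 <= T r)%R.
  by move=> r0; rewrite addr_ge0 ?q0// divr_ge0// ltW// X0.
have TV r : (0 < r)%R -> (T r <= (1 + C) * (v r / r `^ p))%R.
  move=> r0; rewrite mulrDl mul1r lerD2l mulrA ler_pdivlMr ?X0// mulrC.
  exact: ha.
have T2 r : (0 < r)%R -> (T (2 * r) <= theta * T r)%R.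
  move=> r0; have := hb _ r0; have := TV _ r0; have := X0 _ r0.
  rewrite /theta /T powRM//; last exact: ltW.
  set X := (r `^ p)%R; set Z := (2 `^ p)%R in Zi *.
  move=> hX h1.
  have -> : ((v (2 * r) - v r) / (Z * X) = v (2 * r) / (Z * X) - Z^-1 * (v r / X))%R.
    by rewrite invfM; ring.
  move: h1; set A := (v r / X)%R; set B := (v (2 * r) / _)%R => h1 h2.
  have h3 : ((1 - Z^-1) / (1 + C) * (A + q r) <= (1 - Z^-1) * A)%R.
    rewrite -mulrA ler_pM2l; last by case/andP: Zi.
    by rewrite mulrC ler_pdivrMr; lra.
  move: h3; set K := ((1 - Z^-1) / (1 + C))%R; lra.
have Tn n r : (0 < r)%R -> (T (2 ^+ n * r) <= theta ^+ n * T r)%R.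
  move=> r0; elim: n => [|n IH]; first by rewrite !expr0 !mul1r.
  rewrite !exprS -!mulrA; apply: le_trans (T2 _ _) _.
    by rewrite mulr_gt0// exprn_gt0.
  by rewrite ler_wpM2l//; case/andP: th.
have [n hn] := expr_small (1 + C)%R th e0.
exists n => r r0; rewrite !vE -EFinM lee_fin.
have r20 : (0 < 2 ^+ n * r)%R by rewrite mulr_gt0// exprn_gt0.
apply: (@le_trans _ _ ((2 ^+ n * r) `^ p * T (2 ^+ n * r)))%R.
  by rewrite /T mulrDr [X in (X + _)%R]mulrC divfK ?gt_eqF ?X0// lerDl mulr_ge0 ?q0// ltW// X0.
apply: (@le_trans _ _ ((2 ^+ n * r) `^ p * (theta ^+ n * ((1 + C) * (v r / r `^ p)))))%R.
  rewrite ler_wpM2l ?powR_ge0//; apply: le_trans (Tn n r r0) _.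
  by rewrite ler_wpM2l ?TV// exprn_ge0//; case/andP: th.
rewrite powRM ?exprn_ge0//; last exact: ltW.
have -> : ((2 ^+ n) `^ p * r `^ p * (theta ^+ n * ((1 + C) * (v r / r `^ p))) =
  theta ^+ n * (1 + C) * (2 ^+ n) `^ p * v r)%R.
  by have := X0 _ r0; move: (r `^ p)%R => X hX; field; rewrite gt_eqF.
by rewrite ler_wpM2r// ler_wpM2r// powR_ge0.
Qed.

End Bp_facts.

End Bp_growth.

(** * Averages of nonincreasing functions *)

Section nonincreasing_averages.
Context {R : realType}.
Local Notation mR := (measurableTypeR R).
Local Open Scope ereal_scope.

Lemma poweR_addr_le (p : R) (x y : \bar R) : (0 < p)%R -> 0 <= x -> 0 <= y ->
  (x + y) `^ p <= (2 `^ p)%:E * (x `^ p + y `^ p).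
Proof.
move=> p0; wlog xy : x y / x <= y => [th x0 y0|x0 y0].
  have [xy|/ltW yx] := leP x y; first exact: th.
  by rewrite addeC [X in _ * X]addeC; exact: th.
apply: (@le_trans _ _ ((2%:E * y) `^ p)).
  have xy2 : x + y <= 2%:E * y by rewrite mule_natl mule2n leeD2r.
  apply: gt0_ler_poweR => //; first exact: ltW.
  - by rewrite in_itv/= leey adde_ge0.
  - by rewrite in_itv/= leey andbT (le_trans _ xy2)// adde_ge0.
rewrite poweRM// poweR_EFin lee_wpmul2l ?lee_fin ?powR_ge0//.
by rewrite leeDr// poweR_ge0.
Qed.

Lemma le_poweR (p : R) (x y : \bar R) : (0 < p)%R -> 0 <= x -> x <= y ->
  x `^ p <= y `^ p.
Proof.
move=> p0 x0 xy; apply: gt0_ler_poweR => //; first exact: ltW.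
- by rewrite in_itv/= leey x0.
- by rewrite in_itv/= leey andbT (le_trans x0).
Qed.

Lemma measurable_poweR_comp d (T : measurableType d) (D : set T) (p : R)
    (f : T -> \bar R) : measurable_fun D f -> measurable_fun D (fun x => f x `^ p).
Proof. by move=> mf; apply: (measurableT_comp (measurable_poweR p)). Qed.

(** A function lying below every upper bound of a nondecreasing sequence has
    an integral lying below every upper bound of the integrals. *)
Lemma ge0_integral_sup_le d (T : measurableType d)
    (mu : {measure set T -> \bar R}) (D : set T)
    (F : nat -> T -> \bar R) (f : T -> \bar R) (c : \bar R) : measurable D ->
  (forall n, measurable_fun D (F n)) -> measurable_fun D f ->
  (forall n x, D x -> 0 <= F n x) -> (forall x, D x -> 0 <= f x) ->
  (forall x, D x -> {homo F^~ x : n m / (n <= m)%N >-> n <= m}) ->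
  (forall x y, D x -> (forall n, F n x <= y) -> f x <= y) ->
  (forall n, \int[mu]_(x in D) F n x <= c) ->
  \int[mu]_(x in D) f x <= c.
Proof.
move=> mD mF mf F0 f0 ndF hf hc.
have hcv := @cvg_monotone_convergence _ _ _ mu D mD F mF F0 ndF.
have Fcv x : D x -> cvgn (F^~ x).
  by move=> Dx; apply: ereal_nondecreasing_is_cvgn; exact: ndF.
apply: (@le_trans _ _ (\int[mu]_(x in D) limn (F^~ x))).
  apply: ge0_le_integral => //.
    exact: (@emeasurable_fun_cvg _ _ _ D F).
  move=> x Dx; apply: hf => // n.
  rewrite (cvg_lim _ (ereal_nondecreasing_cvgn (ndF _ Dx)))//.
  by apply: ereal_sup_ubound; exists n.
rewrite -(cvg_lim _ hcv)//; apply: lime_le.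
  by apply/cvg_ex; eexists; exact: hcv.
exact: nearW.
Qed.

Section avg_monotone.
Variable g : mR -> \bar R.
Hypotheses (mg : measurable_fun setT g) (g0 : forall x, 0 <= g x).
Hypothesis dg : nonincr_Rp g.

Let I (t : R) : \bar R := \int[leb]_(b in `]0%R, t[) g b.

Lemma integral_nonincr_ge (s : R) : (0 < s)%R -> s%:E * g s <= I s.
Proof.
move=> s0; rewrite /I.
apply: (@le_trans _ _ (\int[leb]_(b in `]0%R, s[) cst (g s) b)).
  rewrite integral_cst// leb_itv/= lte_fin s0.
  by rewrite oppr0 adde0 muleC.
apply: ge0_le_integral => //; first by move=> x _; exact: g0.
  exact: measurable_funTS.
by move=> x /=; rewrite in_itv/= => /andP[x0 xs]; apply: dg => //; exact: ltW.
Qed.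

Lemma integral_nonincr_le (s t : R) : (0 < s)%R -> (s <= t)%R ->
  I t <= I s + (t - s)%:E * g s.
Proof.
move=> s0 st; rewrite /I.
have -> : `]0%R, t[%classic = `]0%R, s[%classic `|` `[s, t[%classic :> set mR.
  by rewrite -itv_bndbnd_setU// bnd_simp.
rewrite ge0_integral_setU//; last 2 first.
- exact: measurable_funTS.
- apply/disj_setPS => x [] /=; rewrite !in_itv/= => /andP[_ xs] /andP[].
  by rewrite leNgt xs.
apply: leeD2l; apply: (@le_trans _ _ (\int[leb]_(b in `[s, t[) cst (g s) b)).
  apply: ge0_le_integral => //; first exact: measurable_funTS.
  by move=> x /=; rewrite in_itv/= => /andP[xs xt]; exact: dg.
rewrite integral_cst// leb_itv/= lte_fin.
by case: ltP => // ts; rewrite ?mule0 muleC// mule_ge0// lee_fin subr_ge0.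
Qed.

Lemma le_avg (t : R) : (0 < t)%R -> g t <= avg g t.
Proof.
move=> t0; rewrite /avg lee_pdivlMl// -/(I t); exact: integral_nonincr_ge.
Qed.

Lemma avg_nonincr : nonincr_Rp (avg g).
Proof.
move=> s t s0 st; have t0 := lt_le_trans s0 st.
rewrite /avg lee_pdivrMl// muleA -/(I s) -/(I t).
apply: le_trans (integral_nonincr_le s0 st) _.
apply: (@le_trans _ _ (1 * I s + ((t - s) / s)%:E * I s)).
  rewrite mul1e leeD2l// EFinM -muleA lee_wpmul2l ?lee_fin ?subr_ge0//.
  by rewrite lee_pdivlMl// integral_nonincr_ge.
rewrite -ge0_muleDl ?lee_fin//; last by rewrite divr_ge0 ?subr_ge0// ltW.
rewrite -EFinD -EFinM lee_wpmul2r//; first exact: integral_ge0.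
by rewrite lee_fin mulrBl mulfV ?gt_eqF// addrC subrK.
Qed.

(** The average over ]0, t[ is the average over ]0, t / m[ with the small
    coefficient [m^-1], up to a value of [g]. *)
Lemma avg_dilation_le (m t : R) : (1 <= m)%R -> (0 < t)%R ->
  avg g t <= (m^-1)%:E * avg g (t / m)%R + g (t / m)%R.
Proof.
move=> m1 t0; have m0 : (0 < m)%R by exact: lt_le_trans m1.
have s0 : (0 < t / m)%R by exact: divr_gt0.
have st : (t / m <= t)%R by rewrite ler_pdivrMr// ler_peMr// ltW.
rewrite {1}/avg lee_pdivrMl// -/(I t).
apply: le_trans (integral_nonincr_le s0 st) _.
rewrite ge0_muleDr//; last by rewrite mule_ge0 ?avg_ge0// lee_fin invr_ge0 ltW.
apply: leeD.
  rewrite /avg -/(I (t / m)) !muleA -!EFinM invf_div.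
  have -> : (t * m^-1 * (m / t) = 1)%R by field; rewrite !gt_eqF.
  by rewrite mul1e.
by rewrite lee_wpmul2r// lee_fin gerBl ltW.
Qed.

End avg_monotone.

Lemma le_avg_fun (f g : mR -> \bar R) (t : R) :
  measurable_fun setT f -> measurable_fun setT g ->
  (forall x, 0 <= f x) -> (forall x, (0 < x)%R -> f x <= g x) -> avg f t <= avg g t.
Proof.
move=> mf mg f0 fg; have [t0|t0] := ltP 0%R t; last first.
  by rewrite /avg set_itv_ge ?integral_set0 ?mule0// bnd_simp -leNgt.
apply: lee_wpmul2l; first by rewrite lee_fin invr_ge0 ltW.
apply: ge0_le_integral => //; try exact: measurable_funTS.
by move=> x /=; rewrite in_itv/= => /andP[x0 _]; exact: fg.
Qed.

End nonincreasing_averages.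

(** * The weighted Hardy inequality *)

Section hardy_inequality.
Context {R : realType}.
Local Notation mR := (measurableTypeR R).
Local Open Scope ereal_scope.

Section Hardy.
Variables (p : R) (w : R -> R).
Hypotheses (p0 : (0 < p)%R) (hw : weight w) (hB : Bp p w).

Lemma tail_lty (r : R) : (0 < r)%R -> tail p w r < +oo.
Proof.
move=> r0; case: hB => C C0 hC.
have : (r `^ p)%:E * tail p w r < +oo.
  apply: le_lt_trans (hC _ r0) _.
  by rewrite -/(prim w r) -(fineK (prim_fin hw r)) -EFinM ltry.
case: (tail p w r) => [t||]//; first by move=> _; rewrite ltry.
by rewrite gt0_muley ?lte_fin ?powR_gt0.
Qed.

(** For bounded functions of bounded support the integral to be absorbed in
    the Hardy inequality is finite. *)
Lemma avg_pow_lty (N : R) (g : mR -> \bar R) : (0 < N)%R ->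
  measurable_fun setT g -> (forall x, 0 <= g x) -> nonincr_Rp g ->
  (forall x, (0 < x)%R -> g x <= N%:E) -> (forall x, (N <= x)%R -> g x = 0) ->
  \int[leb]_(t in Rp) (avg g t `^ p * (w t)%:E) < +oo.
Proof.
move=> N0 mg g0 dg gN gN0.
have mA : measurable_fun setT (avg g : mR -> \bar R) by exact: measurable_avg.
have A0 t : 0 <= avg g t by exact: avg_ge0.
have mAw (D : set mR) : D `<=` @Rp R ->
    measurable_fun D ((fun t => avg g t `^ p * (w t)%:E) : mR -> \bar R).
  move=> DR; apply: emeasurable_funM; last exact: weightM.
  by apply: measurable_funTS; exact: measurable_poweR_comp.
have Aw0 t : Rp t -> 0 <= avg g t `^ p * (w t)%:E.
  by move=> t0; rewrite mule_ge0 ?poweR_ge0 ?weight_ge0.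
have R1 : `]0%R, N] `<=` @Rp R by exact: sub_itvoc_Rp.
have R2 : `]N, +oo[ `<=` @Rp R by apply: sub_itvy_Rp; exact: ltW.
have -> : @Rp R = `]0%R, N]%classic `|` `]N, +oo[%classic :> set mR.
  by rewrite -itv_bndbnd_setU// bnd_simp// ltW.
rewrite ge0_integral_setU//; last 3 first.
- by apply: mAw => x [/R1|/R2].
- by move=> x [/R1|/R2]; exact: Aw0.
- apply/disj_setPS => x [] /=; rewrite !in_itv/= andbT => /andP[_].
  by move=> /le_lt_trans h /h; rewrite ltxx.
have I_le t : (0 < t)%R -> \int[leb]_(b in `]0%R, t[) g b <= (t * N)%:E.
  move=> t0; apply: (@le_trans _ _ (\int[leb]_(b in `]0%R, t[) cst N%:E b)).
    apply: ge0_le_integral => //; first exact: measurable_funTS.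
    by move=> x /=; rewrite in_itv/= => /andP[x0 _]; exact: gN.
  by rewrite integral_cst// leb_itv/= lte_fin t0 oppr0 adde0 muleC.
have A1 t : (0 < t)%R -> avg g t <= N%:E.
  by move=> t0; rewrite /avg lee_pdivrMl// I_le.
have A2 t : (N < t)%R -> avg g t <= (N * N / t)%:E.
  move=> Nt; have t0 := lt_trans N0 Nt.
  rewrite /avg lee_pdivrMl// -EFinM mulrC divfK ?gt_eqF//.
  apply: le_trans (integral_nonincr_le mg g0 dg N0 (ltW Nt)) _.
  by rewrite gN0// mule0 adde0 I_le.
apply: lte_add_pinfty.
  apply: (@le_lt_trans _ _ ((N `^ p)%:E * prim w N)); last first.
    by rewrite -(fineK (prim_fin hw N)) -EFinM ltry.
  rewrite /prim integral_itv_bndo_bndc; last by apply: weightM => //; exact: sub_itv_Rp.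
  rewrite -ge0_integralZl//; last 3 first.
  - exact: weightM.
  - by move=> x /R1; exact: weight_ge0.
  - by rewrite lee_fin powR_ge0.
  apply: ge0_le_integral => //.
  - by move=> x /R1; exact: Aw0.
  - exact: mAw.
  - by apply: measurable_funeM; exact: weightM.
  move=> x /R1 xR; rewrite lee_wpmul2r ?weight_ge0// -poweR_EFin.
  by apply: le_poweR => //; apply: A1; rewrite -RpE.
apply: (@le_lt_trans _ _ (((N * N) `^ p)%:E * tail p w N)); last first.
  by apply: lte_mul_pinfty; rewrite ?lee_fin ?powR_ge0// tail_lty.
rewrite /tail -ge0_integralZl//; last 3 first.
- exact: measurable_tail.
- by move=> x /R2; exact: tail_integrand_ge0.
- by rewrite lee_fin powR_ge0.
apply: ge0_le_integral => //.
- by move=> x /R2; exact: Aw0.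
- exact: mAw.
- by apply: measurable_funeM; exact: measurable_tail.
move=> x xI; have xR := R2 _ xI; have := xR; rewrite RpE => x0.
have : avg g x `^ p <= ((N * N / x) `^ p)%:E.
  rewrite -poweR_EFin; apply: le_poweR => //; apply: A2.
  by move: xI; rewrite /= in_itv/= andbT.
have := weight_ge0 hw xR.
move=> /lee_wpmul2r h /h /le_trans; apply.
rewrite -!EFinM lee_fin powRM ?invr_ge0 ?mulr_ge0//; try exact: ltW.
rewrite -powR_inv1 ?(ltW x0)// -!powRrM mulN1r powRN.
by rewrite [(w x * _)%R]mulrC mulrA.
Qed.

(** With a dilation by [m] that is small against [m ^ p], the terms that
    contain the average make up at most half of the left side, which can be
    absorbed since it is finite. *)
Lemma hardy_trunc : exists2 C : R, (0 < C)%R & forall g : mR -> \bar R,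
  measurable_fun setT g -> (forall x, 0 <= g x) -> nonincr_Rp g ->
  \int[leb]_(t in Rp) (avg g t `^ p * (w t)%:E) < +oo ->
  \int[leb]_(t in Rp) (avg g t `^ p * (w t)%:E) <=
  C%:E * \int[leb]_(t in Rp) (g t `^ p * (w t)%:E).
Proof.
(* the factor [2 `^ p] comes from the p-th power of a sum of two terms *)
pose e : R := ((2 `^ p)^-1 / 2)%R.
have P0 : (0 < 2 `^ p :> R)%R by exact: powR_gt0.
have e0 : (0 < e)%R by rewrite divr_gt0// invr_gt0.
have [n hn] := Bp_dyadic_decay p0 hw e0 hB.
pose m : R := (2 ^+ n)%R.
have m1 : (1 <= m)%R by rewrite exprn_ege1// ler1n.
have m0 : (0 < m)%R by exact: lt_le_trans m1.
exists (m `^ p)%R; first exact: powR_gt0.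
move=> g mg g0 dg; set X := integral _ _ _ => Xfin; set Y := integral _ _ _.
have mA : measurable_fun setT (avg g : mR -> \bar R) by exact: measurable_avg.
have A0 t : 0 <= avg g t by exact: avg_ge0.
have K0 : (0 <= e * m `^ p)%R by rewrite mulr_ge0 ?powR_ge0// ltW.
have dil (h : mR -> \bar R) : measurable_fun setT h -> (forall x, 0 <= h x) ->
    nonincr_Rp h -> \int[leb]_(t in Rp) (h (t / m)%R `^ p * (w t)%:E) <=
     (e * m `^ p)%:E * \int[leb]_(t in Rp) (h t `^ p * (w t)%:E).
  move=> mh h0 dh.
  apply: (@le_dilation R w m (e * m `^ p)%R (fun t => h t `^ p)) => //.
  - exact: measurable_poweR_comp.
  - by move=> x; exact: poweR_ge0.
  - by move=> s t s0 st; apply: le_poweR => //; exact: dh.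
have mw : measurable_fun Rp ((fun x => (w x)%:E) : mR -> \bar R) by exact: weightM.
have mdiv (h : mR -> \bar R) : measurable_fun setT h ->
    measurable_fun Rp ((fun t => h (t / m)%R `^ p * (w t)%:E) : mR -> \bar R).
  move=> mh; apply: emeasurable_funM => //; apply: measurable_funTS.
  apply: measurable_poweR_comp; apply: (measurableT_comp mh).
  exact: mulrr_measurable.
have P2 t : Rp t -> avg g t `^ p * (w t)%:E <=
    (2 `^ p)%:E * ((m^-1 `^ p)%:E * (avg g (t / m)%R `^ p * (w t)%:E)) +
    (2 `^ p)%:E * (g (t / m)%R `^ p * (w t)%:E).
  move=> tR; have := tR; rewrite RpE => t0.
  have w0 := weight_ge0 hw tR.
  have := avg_dilation_le mg g0 dg m1 t0.
  move=> /(le_poweR p0 (A0 t)) /le_trans -/(_ _ (poweR_addr_le p0 _ _)).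
  rewrite mule_ge0 ?lee_fin ?invr_ge0 ?(ltW m0)// => /(_ isT (g0 _)).
  move=> /(lee_wpmul2r w0) /le_trans; apply.
  rewrite poweRM ?lee_fin ?invr_ge0 ?(ltW m0)// poweR_EFin.
  rewrite ge0_muleDr ?mule_ge0 ?poweR_ge0 ?lee_fin ?powR_ge0//.
  by rewrite ge0_muleDl ?mule_ge0 ?poweR_ge0 ?lee_fin ?powR_ge0// !muleA.
have X1 : X <= (2 `^ p)%:E * ((m^-1 `^ p)%:E * ((e * m `^ p)%:E * X)) +
    (2 `^ p)%:E * ((e * m `^ p)%:E * Y).
  have t0 (h : mR -> \bar R) t : Rp t -> 0 <= h (t / m)%R `^ p * (w t)%:E.
    by move=> tR; rewrite mule_ge0 ?poweR_ge0 ?weight_ge0.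
  apply: (@le_trans _ _ (\int[leb]_(t in Rp)
    ((2 `^ p)%:E * ((m^-1 `^ p)%:E * (avg g (t / m)%R `^ p * (w t)%:E)) +
     (2 `^ p)%:E * (g (t / m)%R `^ p * (w t)%:E)))).
    apply: ge0_le_integral => //.
    - exact: measurable_Rp.
    - by move=> t tR; rewrite mule_ge0 ?poweR_ge0 ?weight_ge0.
    - apply: emeasurable_funM => //; apply: measurable_funTS.
      exact: measurable_poweR_comp.
    - apply: emeasurable_funD; apply: measurable_funeM; last exact: mdiv.
      by apply: measurable_funeM; exact: (mdiv (avg g)).
  have mRp := @measurable_Rp R.
  have a0 := @t0 (avg g); have b0 := @t0 g.
  have ma := mdiv _ mA; have mb := mdiv _ mg.
  have P0' : (0 <= 2 `^ p :> R)%R by exact: ltW.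
  have c0 (k : R) (h : mR -> \bar R) : (0 <= k)%R -> (forall t, Rp t -> 0 <= h t) ->
      forall t, Rp t -> 0 <= k%:E * h t.
    by move=> k0 h0 t tR; apply: mule_ge0; [rewrite lee_fin|exact: h0].
  have m'0 : (0 <= m^-1 `^ p)%R by exact: powR_ge0.
  have ca0 := c0 _ _ m'0 a0.
  have mca := measurable_funeM (m^-1 `^ p)%:E ma.
  rewrite (@ge0_integralD _ _ _ leb Rp mRp _ _ (c0 _ _ P0' ca0) _ (c0 _ _ P0' b0));
    [|exact: measurable_funeM|exact: measurable_funeM].
  rewrite (@ge0_integralZl_EFin _ _ _ leb Rp mRp _ ca0 mca _ P0').
  rewrite (@ge0_integralZl_EFin _ _ _ leb Rp mRp _ a0 ma _ m'0).
  rewrite (@ge0_integralZl_EFin _ _ _ leb Rp mRp _ b0 mb _ P0').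
  apply: leeD; rewrite !lee_wpmul2l ?lee_fin ?powR_ge0//; last exact: dil.
  by apply: (dil (avg g)) => //; exact: avg_nonincr.
have X0 : 0 <= X.
  by apply: integral_ge0 => t tR; rewrite mule_ge0 ?poweR_ge0 ?weight_ge0.
have Y0 : 0 <= Y.
  by apply: integral_ge0 => t tR; rewrite mule_ge0 ?poweR_ge0 ?weight_ge0.
move: X1; rewrite !muleA -!EFinM.
have -> : (2 `^ p * m^-1 `^ p * (e * m `^ p) = 2^-1 :> R)%R.
  have Q0 : (m `^ p != 0)%R by rewrite gt_eqF// powR_gt0.
  rewrite -powR_inv1 ?(ltW m0)// -powRrM mulN1r powRN /e.
  by field; rewrite Q0 gt_eqF.
have -> : (2 `^ p * (e * m `^ p) = 2^-1 * m `^ p :> R)%R.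
  by rewrite /e; field; rewrite gt_eqF.
case: X Xfin X0 => [x| |]// _; rewrite lee_fin => x0.
case: Y Y0 => [y| |]// y0; last first.
  by move=> _; rewrite gt0_muley ?leey// lte_fin powR_gt0.
by rewrite -!EFinM -EFinD !lee_fin; lra.
Qed.

(** The weighted Hardy inequality on nonincreasing functions. *)
Lemma hardy : exists2 C : R, (0 < C)%R & forall g : mR -> \bar R,
  measurable_fun setT g -> (forall x, 0 <= g x) -> nonincr_Rp g ->
  \int[leb]_(t in Rp) (avg g t `^ p * (w t)%:E) <=
  C%:E * \int[leb]_(t in Rp) (g t `^ p * (w t)%:E).
Proof.
have [C C0 hC] := hardy_trunc; exists C => // g mg g0 dg.
(* truncations of [g], both in height and in support *)
pose G (n : nat) (t : mR) : \bar R := if (t < n.+1%:R)%R then mine (g t) n.+1%:R%:E else 0.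
have mG n : measurable_fun setT (G n).
  apply: measurable_fun_ifT => //; first by apply: measurable_fun_ltr.
  by apply: measurable_mine.
have G0 n x : 0 <= G n x.
  by rewrite /G; case: ifP => // _; rewrite le_min g0/= lee_fin ler0n.
have Gg n x : G n x <= g x.
  by rewrite /G; case: ifP => // _; rewrite ge_min lexx.
have dG n : nonincr_Rp (G n).
  move=> s t s0 st; rewrite {1}/G; case: ifP => // tn.
  rewrite /G (le_lt_trans st tn) le_min !ge_min lexx orbT andbT.
  by rewrite dg.
have ndG x : {homo G^~ x : n k / (n <= k)%N >-> n <= k}.
  move=> n k nk; rewrite {1}/G; case: ifP => // xn.
  have nk1 : (n.+1%:R <= k.+1%:R :> R)%R by rewrite ler_nat.
  rewrite /G (lt_le_trans xn nk1) le_min !ge_min lexx/=.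
  by rewrite lee_fin nk1 orbT.
have supG x y : (forall n, G n x <= y) -> g x <= y.
  move=> h; case: y h => [y| |] h; last 2 first.
  - by rewrite leey.
  - by have := le_trans (G0 0%N x) (h 0%N).
  pose n := Num.truncn (Num.max `|x| `|y|)%R.
  have hn : (Num.max `|x| `|y| < n.+1%:R)%R by exact: truncnS_gt.
  move: hn; rewrite gt_max => /andP[xn yn].
  have := h n; rewrite /G (le_lt_trans (ler_norm x) xn) ge_min => /orP[//|].
  by rewrite lee_fin => ny; have := le_lt_trans (ler_norm y) yn; rewrite ltNge ny.
have mRp := @measurable_Rp R.
have mw : measurable_fun Rp ((fun x => (w x)%:E) : mR -> \bar R) by exact: weightM.
have mpw (h : mR -> \bar R) : measurable_fun setT h ->
    measurable_fun Rp ((fun t => h t `^ p * (w t)%:E) : mR -> \bar R).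
  move=> mh; apply: emeasurable_funM => //; apply: measurable_funTS.
  exact: measurable_poweR_comp.
have A0 t : 0 <= avg g t by exact: avg_ge0.
have AG0 n t : 0 <= avg (G n) t by exact: avg_ge0.
have mA : measurable_fun setT (avg g : mR -> \bar R) by exact: measurable_avg.
have mAG n : measurable_fun setT (avg (G n) : mR -> \bar R) by exact: measurable_avg.
have pw0 (h : mR -> \bar R) t : Rp t -> 0 <= h t `^ p * (w t)%:E.
  by move=> tR; rewrite mule_ge0 ?poweR_ge0 ?weight_ge0.
apply: (@ge0_integral_sup_le _ _ _ leb Rp (fun n t => avg (G n) t `^ p * (w t)%:E)) => //.
- by move=> n; exact: (mpw (avg (G n))).
- exact: (mpw (avg g)).
- by move=> n x xR; exact: (pw0 (avg (G n))).
- by move=> x xR; exact: (pw0 (avg g)).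
- move=> x xR n k nk; rewrite lee_wpmul2r ?weight_ge0//.
  apply: le_poweR => //; apply: le_avg_fun => // z z0.
  exact: ndG.
- move=> x y xR h; have w0 := weight_ge0 hw xR.
  move: xR; rewrite RpE => x0.
  have y0 : 0 <= y by apply: le_trans (h 0%N); rewrite mule_ge0// poweR_ge0.
  move: w0; rewrite le_eqVlt => /predU1P[w0|w0].
    by rewrite -w0 mule0.
  move: w0; rewrite lte_fin => w0.
  rewrite -lee_pdivlMr//.
  suff : avg g x <= (y * ((w x)^-1)%:E) `^ p^-1.
    move=> /(le_poweR p0 (A0 x)) /le_trans; apply.
    rewrite -poweRrM mulVf ?gt_eqF// poweRe1// mule_ge0// lee_fin invr_ge0.
    exact: ltW.
  rewrite /avg lee_pdivrMl//.
  apply: (@ge0_integral_sup_le _ _ _ leb `]0%R, x[ G) => //.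
  - by move=> n; exact: measurable_funTS.
  - exact: measurable_funTS.
  - by move=> z c _; exact: supG.
  move=> n; rewrite -lee_pdivrMl// -/(avg (G n) x).
  have := h n; rewrite -lee_pdivlMr// => hn.
  have := @le_poweR _ p^-1 _ _ _ (poweR_ge0 _ _) hn.
  rewrite invr_gt0 -poweRrM mulfV ?gt_eqF// poweRe1//; exact.
- move=> n; apply: (@le_trans _ _ (C%:E * \int[leb]_(t in Rp) (G n t `^ p * (w t)%:E))).
    apply: hC => //; apply: (@avg_pow_lty n.+1%:R) => //.
    - move=> x x0; rewrite /G; case: ifP => // _; first by rewrite ge_min lexx orbT.
    - by move=> x nx; rewrite /G ltNge nx.
  apply: lee_wpmul2l; first by rewrite lee_fin ltW.
  apply: ge0_le_integral => //.
  - by move=> x xR; exact: pw0.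
  - exact: mpw.
  - exact: mpw.
  - move=> x xR; rewrite lee_wpmul2r ?weight_ge0//.
    by apply: le_poweR.
Qed.

End Hardy.

End hardy_inequality.

(** * The maximal function of a rearrangement as a K-functional *)

Section K_functional_properties.
Context {R : realType}.
Local Notation mR := (measurableTypeR R).
Local Open Scope ereal_scope.

(** The excess of [x] over the level [c]; it vanishes at the level [+oo]. *)
Definition excess (x c : \bar R) : \bar R := maxe (x - c) 0.

Lemma excess_ge0 x c : 0 <= excess x c.
Proof. by rewrite /excess le_max lexx orbT. Qed.

Lemma lt_excess (a c : R) (x : \bar R) : (0 <= a)%R ->
  (a%:E < excess x c%:E) = ((a + c)%:E < x).
Proof.
move=> a0; rewrite /excess lt_max lte_fin [(a < 0)%R]ltNge a0 orbF.
by rewrite EFinD lteBrDr.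
Qed.

Lemma le_excess (x c : \bar R) : 0 <= x -> 0 <= c -> x <= c + excess x c.
Proof.
case: c => [c| |]// x0 c0; last by rewrite ge0_addye ?leey// excess_ge0.
rewrite /excess; have [h|h] := leP (x - c%:E) 0.
  by rewrite adde0; rewrite leeBlDr// add0e in h.
by rewrite addeC subeK.
Qed.

Lemma excess_le (x y : \bar R) (c : R) : 0 <= y -> x <= c%:E + y -> excess x c%:E <= y.
Proof. by move=> y0 xy; rewrite /excess ge_max y0 andbT leeBlDl. Qed.

Lemma measurable_excess d (T : measurableType d) (D : set T) (f g : T -> \bar R) :
  measurable_fun D f -> measurable_fun D g ->
  measurable_fun D (fun x => excess (f x) (g x)).
Proof.
by move=> mf mg; apply: measurable_maxe => //; exact: emeasurable_funB.
Qed.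

Lemma integral_layers (D : set mR) (f : mR -> \bar R) : measurable D ->
  measurable_fun D f -> (forall x, D x -> 0 <= f x) ->
  measurable_fun Rp ((fun a => leb (D `&` [set x | a%:E < f x])) : mR -> \bar R) /\
  \int[leb]_(x in D) f x = \int[leb]_(a in Rp) leb (D `&` [set x | a%:E < f x]).
Proof.
move=> mD mf f0; have m1 : measurable_fun D (cst 1 : mR -> \bar R) by [].
have [h1 h2] := @layer_cake_tonelli _ D f (cst 1) mD mf m1 f0 (fun _ _ => lee01).
have E a : leb (D `&` [set x | a%:E < f x]) =
    \int[leb]_(x in D `&` [set x | a%:E < f x]) cst 1 x.
  rewrite integral_cst ?mul1e//.
  exact: (@measurable_lte _ _ _ _ _ (cst a%:E) f).
split; first by move: h1; congr measurable_fun; apply/funext => a; rewrite E.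
transitivity (\int[leb]_(x in D) (f x * cst 1 x)).
  by apply: eq_integral => x _; rewrite mule1.
by rewrite h2; apply: eq_integral => a _; rewrite E.
Qed.

Section K_functional.
Variable g : mR -> \bar R.
Hypothesis mg : measurable_fun setT g.

Let mg' : measurable_fun setT ((fun x => `|g x|) : mR -> \bar R).
Proof. exact: measurableT_comp. Qed.

Let mr : measurable_fun setT (rearr g : mR -> \bar R).
Proof. exact: measurable_rearr. Qed.

Lemma integral_excess_rearr_le (c t : R) : (0 <= c)%R ->
  \int[leb]_(b in `]0%R, t[) excess (rearr g b) c%:E <=
  \int[leb]_x excess `|g x| c%:E.
Proof.
move=> c0.
have m1 : measurable_fun `]0%R, t[ ((fun b => excess (rearr g b) c%:E) : mR -> \bar R).
  by apply: measurable_excess => //; exact: measurable_funTS.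
have m2 : measurable_fun setT ((fun x => excess `|g x| c%:E) : mR -> \bar R).
  exact: measurable_excess.
have [k1 ->] := integral_layers (measurable_itv _) m1 (fun _ _ => excess_ge0 _ _).
have [k2 ->] := integral_layers (measurableT : measurable [set: mR]) m2 (fun _ _ => excess_ge0 _ _).
apply: ge0_le_integral => //; first exact: measurable_Rp.
move=> a; rewrite RpE => /ltW a0.
have ac : (0 <= a + c)%R by rewrite addr_ge0.
apply: (@le_trans _ _ (leb [set b : mR | Rp b /\ b%:E < distr_fun g (a + c)])).
  apply: le_measure; rewrite ?inE.
  - exact: (@measurable_lte _ _ _ _ _ (cst a%:E) (fun b => excess (rearr g b) c%:E)).
  - apply: (@measurable_lte _ _ _ _ _ EFin (cst (distr_fun g (a + c)))) => //.
    exact: measurable_Rp.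
  - move=> b [] /=; rewrite in_itv/= => /andP[b0 _]; rewrite lt_excess// rearr_gt//.
    by rewrite RpE.
rewrite leb_below ?distr_fun_ge0// setTI.
rewrite le_eqVlt; apply/orP; left; apply/eqP; congr (leb _).
by apply/seteqP; split => x /=; rewrite lt_excess.
Qed.

Lemma integral_excess_rearr_ge (c t : R) : (0 <= c)%R -> rearr g t <= c%:E ->
  \int[leb]_x excess `|g x| c%:E <=
  \int[leb]_(b in `]0%R, t[) excess (rearr g b) c%:E.
Proof.
move=> c0 gtc.
have m1 : measurable_fun `]0%R, t[ ((fun b => excess (rearr g b) c%:E) : mR -> \bar R).
  by apply: measurable_excess => //; exact: measurable_funTS.
have m2 : measurable_fun setT ((fun x => excess `|g x| c%:E) : mR -> \bar R).
  exact: measurable_excess.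
have [k1 ->] := integral_layers (measurable_itv _) m1 (fun _ _ => excess_ge0 _ _).
have [k2 ->] := integral_layers (measurableT : measurable [set: mR]) m2 (fun _ _ => excess_ge0 _ _).
apply: ge0_le_integral => //; first exact: measurable_Rp.
move=> a; rewrite RpE => /ltW a0.
have ac : (0 <= a + c)%R by rewrite addr_ge0.
have -> : leb ([set: mR] `&` [set x | a%:E < excess `|g x| c%:E]) = distr_fun g (a + c).
  by rewrite setTI; congr (leb _); apply/seteqP; split => x /=; rewrite lt_excess.
rewrite -(leb_below (distr_fun_ge0 g (a + c))).
apply: le_measure; rewrite ?inE.
- apply: (@measurable_lte _ _ _ _ _ EFin (cst (distr_fun g (a + c)))) => //.
  exact: measurable_Rp.
- exact: (@measurable_lte _ _ _ _ _ (cst a%:E) (fun b => excess (rearr g b) c%:E)).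
move=> b [b0 /=]; rewrite -rearr_gt// => hb.
split; last by rewrite /= lt_excess.
rewrite /= in_itv/=; rewrite RpE in b0; rewrite b0/= ltNge; apply/negP => tb.
move: hb; rewrite ltNge => /negP; apply.
apply: le_trans (rearr_nonincreasing g tb) _; apply: le_trans gtc _.
by rewrite lee_fin lerDr.
Qed.

(** The maximal function as a K-functional:
    [avg (rearr g) t] is the infimum over [c] of
    [c + t^-1 * \int (|g| - c)^+], attained at [c = rearr g t]. *)
Lemma avg_rearr_le (c t : R) : (0 <= c)%R -> (0 < t)%R ->
  avg (rearr g) t <= c%:E + (t^-1)%:E * \int[leb]_x excess `|g x| c%:E.
Proof.
move=> c0 t0; rewrite /avg lee_pdivrMl//.
have m1 : measurable_fun `]0%R, t[ ((fun b => excess (rearr g b) c%:E) : mR -> \bar R).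
  by apply: measurable_excess => //; exact: measurable_funTS.
apply: (@le_trans _ _ (\int[leb]_(b in `]0%R, t[) (cst c%:E b + excess (rearr g b) c%:E))).
  apply: ge0_le_integral => //.
  - by move=> x _; exact: rearr_ge0.
  - exact: measurable_funTS.
  - exact: emeasurable_funD.
  - by move=> x _; apply: le_excess => //; exact: rearr_ge0.
rewrite ge0_integralD//; last by move=> x _; exact: excess_ge0.
have I0 : 0 <= \int[leb]_x excess `|g x| c%:E.
  by apply: integral_ge0 => x _; exact: excess_ge0.
rewrite integral_cst// leb_itv/= lte_fin t0 oppr0 adde0.
rewrite ge0_muleDr//; last by rewrite mule_ge0// lee_fin invr_ge0 ltW.
rewrite muleA -!EFinM mulfV ?gt_eqF// mul1e mulrC leeD2l//.
exact: integral_excess_rearr_le.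
Qed.

Lemma le_avg_rearr (t : R) : (0 < t)%R ->
  rearr g t + (t^-1)%:E * \int[leb]_x excess `|g x| (rearr g t) <= avg (rearr g) t.
Proof.
move=> t0; have r0 := rearr_ge0 g t.
have dr : nonincr_Rp (rearr g) by move=> a b _; exact: rearr_nonincreasing.
have := le_avg mr (@rearr_ge0 R g) dr t0.
case E : (rearr g t) r0 => [c| |]// c0; last first.
  by rewrite leye_eq => /eqP ->; rewrite leey.
move=> _; rewrite lee_fin in c0.
have I0 : 0 <= \int[leb]_x excess `|g x| c%:E.
  by apply: integral_ge0 => x _; exact: excess_ge0.
have m1 : measurable_fun `]0%R, t[ ((fun b => excess (rearr g b) c%:E) : mR -> \bar R).
  by apply: measurable_excess => //; exact: measurable_funTS.
rewrite /avg lee_pdivlMl// ge0_muleDr//; last first.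
  by rewrite mule_ge0// lee_fin invr_ge0 ltW.
rewrite muleA -!EFinM mulfV ?gt_eqF// mul1e.
apply: (@le_trans _ _ (\int[leb]_(b in `]0%R, t[) (cst c%:E b + excess (rearr g b) c%:E))).
  rewrite ge0_integralD//; last by move=> x _; exact: excess_ge0.
  rewrite integral_cst// leb_itv/= lte_fin t0 oppr0 adde0 -EFinM mulrC leeD2l//.
  by apply: integral_excess_rearr_ge => //; rewrite E.
apply: ge0_le_integral => //.
- by move=> x _; rewrite adde_ge0 ?excess_ge0.
- exact: emeasurable_funD.
- exact: measurable_funTS.
move=> b /=; rewrite in_itv/= => /andP[_ /ltW bt].
have cb : c%:E <= rearr g b by rewrite -E; exact: rearr_nonincreasing.
rewrite /excess; have [h|h] := leP (rearr g b - c%:E) 0.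
  by rewrite adde0.
by rewrite addeC subeK.
Qed.

End K_functional.

(** The infimum for [h] is tested at the sum of the optimal levels of [f] and
    of [g]. *)
Lemma avg_rearr_subadd (f g h : mR -> \bar R) (t : R) : (0 < t)%R ->
  measurable_fun setT f -> measurable_fun setT g -> measurable_fun setT h ->
  (forall x, `|h x| <= `|f x| + `|g x|) ->
  avg (rearr h) t <= avg (rearr f) t + avg (rearr g) t.
Proof.
move=> t0 mf mg mh hfg.
have Af := le_avg_rearr mf t0; have Ag := le_avg_rearr mg t0.
have Pf0 : 0 <= avg (rearr f) t by apply: avg_ge0; exact: rearr_ge0.
have Pg0 : 0 <= avg (rearr g) t by apply: avg_ge0; exact: rearr_ge0.
have ti : (0 <= t^-1)%R by rewrite invr_ge0 ltW.
have I0 k c : 0 <= \int[leb]_x excess `|(k : mR -> \bar R) x| c.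
  by apply: integral_ge0 => x _; exact: excess_ge0.
have J0 k c : 0 <= (t^-1)%:E * \int[leb]_x excess `|(k : mR -> \bar R) x| c.
  by rewrite mule_ge0.
have rf0 := rearr_ge0 f t; have rg0 := rearr_ge0 g t.
have Jf := J0 f (rearr f t); have Jg := J0 g (rearr g t).
case: (rearr f t) rf0 Af Jf => [c| |]// c0 Af Jf; last first.
  move: Af; rewrite (ge0_addye Jf) leye_eq => /eqP ->.
  by rewrite (ge0_addye Pg0) leey.
case: (rearr g t) rg0 Ag Jg => [d| |]// d0 Ag Jg; last first.
  move: Ag; rewrite (ge0_addye Jg) leye_eq => /eqP ->.
  by rewrite (ge0_addey Pf0) leey.
rewrite !lee_fin in c0 d0.
apply: le_trans (avg_rearr_le mh (addr_ge0 c0 d0) t0) _.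
apply: le_trans (leeD Af Ag); rewrite EFinD addeACA leeD2l//.
rewrite -ge0_muleDr//; apply: lee_wpmul2l; first by rewrite lee_fin.
have mabs (k : mR -> \bar R) c' : measurable_fun setT k ->
    measurable_fun setT ((fun x => excess `|k x| c') : mR -> \bar R).
  by move=> mk; apply: measurable_excess => //; exact: measurableT_comp.
rewrite -ge0_integralD//; try exact: mabs; try by move=> x _; exact: excess_ge0.
apply: ge0_le_integral => //.
- by move=> x _; exact: excess_ge0.
- exact: mabs.
- by apply: emeasurable_funD; exact: mabs.
move=> x _; apply: excess_le; first by rewrite adde_ge0 ?excess_ge0.
apply: le_trans (hfg x) _; rewrite EFinD addeACA.
by apply: leeD; apply: le_excess => //; rewrite lee_fin.
Qed.

(** Minkowski's integral inequality for the maximal function: the infimum for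
    [h] is tested at the integral of the optimal levels of the functions
    [F (_, b)]. *)
Lemma avg_rearr_integral (F : mR * mR -> \bar R) (h : mR -> \bar R) (T s : R) :
  (0 < s)%R -> measurable_fun setT F -> (forall z, 0 <= F z) ->
  measurable_fun setT h ->
  (forall x, `|h x| <= \int[leb]_(b in `]0%R, T[) F (x, b)) ->
  avg (rearr h) s <=
  \int[leb]_(b in `]0%R, T[) avg (rearr (fun x => F (x, b))) s.
Proof.
move=> s0 mF F0 mh hF.
have si : (0 <= s^-1)%R by rewrite invr_ge0 ltW.
have mFb b : measurable_fun setT ((fun x => F (x, b)) : mR -> \bar R).
  exact: measurableT_comp.
have mFx x : measurable_fun setT ((fun b => F (x, b)) : mR -> \bar R).
  exact: measurableT_comp.
have mFs : measurable_fun setT ((fun z => F (z.2, z.1)) : mR * mR -> \bar R).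
  by apply: (measurableT_comp mF); exact: measurable_swap.
pose c (b : mR) := rearr (fun x => F (x, b)) s.
have mr := measurable_rearr_param mFs.
have mc : measurable_fun setT c.
  by move: mr => /(measurableT_comp) /(_ (pair2_measurable (s : mR))).
have c0 b : 0 <= c b by exact: rearr_ge0.
have mA : measurable_fun setT ((fun b => avg (rearr (fun x => F (x, b))) s) : mR -> \bar R).
  have := measurable_avg_param mr (fun z => rearr_ge0 _ _).
  by move=> /(measurableT_comp) /(_ (pair2_measurable (s : mR))).
have A0 b : 0 <= avg (rearr (fun x => F (x, b))) s by apply: avg_ge0; exact: rearr_ge0.
have FE z : `|F z| = F z by rewrite gee0_abs.
have mex : measurable_fun setT ((fun z => excess (F z) (c z.2)) : mR * mR -> \bar R).
  apply: (measurable_excess mF); exact: (measurableT_comp mc measurable_snd).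
have I0 : 0 <= \int[leb]_(b in `]0%R, T[) c b by exact: integral_ge0.
have cA b : c b + (s^-1)%:E * \int[leb]_x excess (F (x, b)) (c b) <=
    avg (rearr (fun x => F (x, b))) s.
  have := le_avg_rearr (mFb b) s0.
  by under eq_integral do rewrite FE.
have mexx x : measurable_fun setT ((fun b => excess (F (x, b)) (c b)) : mR -> \bar R).
  exact: measurable_excess.
have cI : \int[leb]_(b in `]0%R, T[) c b <= \int[leb]_(b in `]0%R, T[) avg (rearr (fun x => F (x, b))) s.
  apply: ge0_le_integral => //; try exact: measurable_funTS.
  move=> b _; apply: le_trans (cA b); rewrite leeDl// mule_ge0//.
  by apply: integral_ge0 => x _; exact: excess_ge0.
case E : (\int[leb]_(b in `]0%R, T[) c b) I0 cI => [C| |]// C0 cI; last first.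
  by move: cI; rewrite leye_eq => /eqP ->; rewrite leey.
rewrite lee_fin in C0.
apply: le_trans (avg_rearr_le mh C0 s0) _.
pose G (z : mR * mR) : \bar R := ((fun z => excess (F z) (c z.2)) \_ (setT `*` `]0%R, T[)) z.
have mST : measurable ([set: mR] `*` (`]0%R, T[%classic : set mR)).
  by apply: measurableX.
have mG : measurable_fun setT G.
  apply: (measurable_restrictT (fun z : mR * mR => excess (F z) (c z.2)) mST).1.
  exact: measurable_funTS.
have G0 z : 0 <= G z by rewrite /G patchE; case: ifP => // _; exact: excess_ge0.
have GE x : \int[leb]_b G (x, b) = \int[leb]_(b in `]0%R, T[) excess (F (x, b)) (c b).
  rewrite [RHS]integral_mkcond; apply: eq_integral => b _; rewrite /G !patchE.
  congr (if _ then _ else _).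
  by apply/idP/idP => /set_mem hb; apply/mem_set; [case: hb|split].
have GE2 b : \int[leb]_x G (x, b) =
    ((fun b => \int[leb]_x excess (F (x, b)) (c b)) \_ (`]0%R, T[%classic : set mR)) b.
  rewrite patchE; case: ifPn => [/set_mem hb|hb].
    apply: eq_integral => x _; rewrite /G patchE ifT//; apply/mem_set; split => //.
  apply: integral0_eq => x _; rewrite /G patchE ifN//; apply: contra hb => /set_mem[_ ?].
  exact/mem_set.
have step1 : \int[leb]_x excess `|h x| C%:E <= \int[leb]_x \int[leb]_b G (x, b).
  apply: ge0_le_integral => //.
  - by move=> x _; exact: excess_ge0.
  - by apply: measurable_excess => //; exact: measurableT_comp.
  - exact: (@measurable_fun_fubini_tonelli_F _ _ _ _ _ leb G mG G0).
  move=> x _; rewrite GE; apply: excess_le.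
    by apply: integral_ge0 => b _; exact: excess_ge0.
  apply: le_trans (hF x) _; rewrite -E -ge0_integralD//; last 3 first.
  - exact: measurable_funTS.
  - by move=> b _; exact: excess_ge0.
  - exact: measurable_funTS.
  apply: ge0_le_integral => //.
  - exact: measurable_funTS.
  - by apply: measurable_funTS; exact: emeasurable_funD.
  - by move=> b _; exact: le_excess.
have mGb : measurable_fun setT ((fun b => \int[leb]_x G (x, b)) : mR -> \bar R).
  exact: (@measurable_fun_fubini_tonelli_G _ _ _ _ _ leb G mG G0).
have mGb' : measurable_fun `]0%R, T[
    ((fun b => \int[leb]_x excess (F (x, b)) (c b)) : mR -> \bar R).
  apply: (measurable_restrictT _ (measurable_itv _)).2.
  by move: mGb; congr measurable_fun; apply/funext => b; rewrite GE2.
have E0 b : 0 <= \int[leb]_x excess (F (x, b)) (c b).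
  by apply: integral_ge0 => x _; exact: excess_ge0.
apply: (@le_trans _ _ (C%:E + (s^-1)%:E * \int[leb]_x \int[leb]_b G (x, b))).
  by rewrite leeD2l// lee_wpmul2l.
rewrite (@fubini_tonelli _ _ _ _ _ leb leb G mG G0).
under eq_integral do rewrite GE2.
rewrite -integral_mkcond -E -ge0_integralZl// -ge0_integralD//; last 3 first.
- exact: measurable_funTS.
- by move=> b _; rewrite mule_ge0.
- exact: measurable_funeM.
apply: ge0_le_integral => //.
- by move=> b _; rewrite adde_ge0// mule_ge0.
- apply: emeasurable_funD; first exact: measurable_funTS.
  exact: measurable_funeM.
- exact: measurable_funTS.
Qed.

End K_functional_properties.

(** * Weighted L^p functionals *)

Section weighted_Lp.
Context {R : realType}.
Local Notation mR := (measurableTypeR R).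
Local Open Scope ereal_scope.

(** Convexity of the power, the point [x + y] being divided in the ratio of
    [a] to [b]. *)
Lemma powR_convex_add (p a b x y : R) : (1 <= p)%R -> (0 < a)%R -> (0 < b)%R ->
  (0 <= x)%R -> (0 <= y)%R ->
  ((x + y) `^ p <= (a + b) `^ p * (a / (a + b) / a `^ p) * x `^ p +
    (a + b) `^ p * (b / (a + b) / b `^ p) * y `^ p)%R.
Proof.
move=> p1 a0 b0 x0 y0.
have p0 : (0 < p)%R by exact: lt_le_trans p1.
have ab : (0 < a + b)%R by exact: addr_gt0.
have t0 : (0 <= a / (a + b))%R by rewrite divr_ge0// ltW.
have t1 : (a / (a + b) <= 1)%R by rewrite ler_pdivrMr// mul1r lerDl ltW.
have : ((a / (a + b) * (x / a) + (1 - a / (a + b)) * (y / b)) `^ p <=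
    a / (a + b) * (x / a) `^ p + (1 - a / (a + b)) * (y / b) `^ p)%R.
  by apply: (convex_powR p1 (Itv01 t0 t1)); rewrite inE/= in_itv/= andbT;
    [exact: divr_ge0 x0 (ltW a0)|exact: divr_ge0 y0 (ltW b0)].
have -> : (1 - a / (a + b) = b / (a + b))%R by field; rewrite gt_eqF.
have -> : (a / (a + b) * (x / a) + b / (a + b) * (y / b) = (x + y) / (a + b))%R.
  by field; rewrite !gt_eqF.
have E (u c : R) : (0 <= u)%R -> (0 < c)%R -> ((u / c) `^ p = u `^ p / c `^ p)%R.
  move=> u0 c0; have c1 := ltW c0; rewrite powRM// ?invr_ge0//; congr (_ * _)%R.
  by rewrite -powR_inv1// -powRrM mulN1r powRN.
rewrite (E _ _ x0 a0) (E _ _ y0 b0) (E _ _ (addr_ge0 x0 y0) ab).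
rewrite ler_pdivrMr ?powR_gt0// => /le_trans; apply.
by rewrite mulrDl le_eqVlt; apply/orP; left; apply/eqP; ring.
Qed.

Section weighted_norm.
Context d (T : measurableType d) (mu : {measure set T -> \bar R}).
Variables (D : set T) (p : R) (w : T -> R).
Hypotheses (mD : measurable D) (p1 : (1 <= p)%R).
Hypotheses (mw : measurable_fun D ((fun z => (w z)%:E) : T -> \bar R))
  (w0 : forall z, D z -> 0 <= (w z)%:E).

Let p0 : (0 < p)%R. Proof. exact: lt_le_trans p1. Qed.

(** The functional of L^p(w d mu) over [D]. *)
Definition lpn (f : T -> \bar R) : \bar R :=
  (\int[mu]_(z in D) (`|f z| `^ p * (w z)%:E)) `^ p^-1.

Let mint (f : T -> \bar R) : measurable_fun D f ->
  measurable_fun D ((fun z => `|f z| `^ p * (w z)%:E) : T -> \bar R).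
Proof.
move=> mf; apply: emeasurable_funM => //; apply: measurable_poweR_comp.
exact: measurableT_comp.
Qed.

Let int0 (f : T -> \bar R) z : D z -> 0 <= `|f z| `^ p * (w z)%:E.
Proof. by move=> Dz; rewrite mule_ge0 ?poweR_ge0 ?w0. Qed.

Lemma lpn_ge0 f : 0 <= lpn f. Proof. exact: poweR_ge0. Qed.

Lemma lpn_pow f : lpn f `^ p = \int[mu]_(z in D) (`|f z| `^ p * (w z)%:E).
Proof.
rewrite -poweRrM mulVf ?gt_eqF// poweRe1//; apply: integral_ge0 => z Dz; exact: int0.
Qed.

Lemma lpn_le f g : measurable_fun D f -> measurable_fun D g ->
  (forall z, D z -> `|f z| <= `|g z|) -> lpn f <= lpn g.
Proof.
move=> mf mg fg; apply: le_poweR; first by rewrite invr_gt0.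
  by apply: integral_ge0 => z Dz; exact: int0.
apply: ge0_le_integral => //; [by move=> z; exact: int0|exact: mint|exact: mint|].
move=> z Dz; rewrite lee_wpmul2r ?w0//; apply: le_poweR => //; exact: fg.
Qed.

Lemma lpn_eq f g : (forall z, D z -> `|f z| = `|g z|) -> lpn f = lpn g.
Proof.
move=> fg; congr (_ `^ _); apply: eq_integral => z /set_mem Dz.
by rewrite fg.
Qed.

Lemma lpnZ (c : R) f : measurable_fun D f ->
  lpn (fun z => c%:E * f z) = `|c|%:E * lpn f.
Proof.
move=> mf; rewrite /lpn.
have -> : \int[mu]_(z in D) (`|c%:E * f z| `^ p * (w z)%:E) =
    (`|c| `^ p)%:E * \int[mu]_(z in D) (`|f z| `^ p * (w z)%:E).
  rewrite -(@ge0_integralZl_EFin _ _ _ mu D mD _ (@int0 f) (mint mf)) ?powR_ge0//.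
  by apply: eq_integral => z _; rewrite abseM poweRM// -muleA.
rewrite poweRM ?lee_fin ?powR_ge0//; last first.
  by apply: integral_ge0 => z Dz; exact: int0.
by rewrite poweR_EFin -powRrM mulfV ?gt_eqF// powRr1.
Qed.

(** Minkowski's inequality for extended-real functions, by convexity divided
    in the ratio of the norms. *)
Lemma lpn_triangle f g h : measurable_fun D f -> measurable_fun D g ->
  measurable_fun D h -> (forall z, D z -> `|h z| <= `|f z| + `|g z|) ->
  lpn h <= lpn f + lpn g.
Proof.
move=> mf mg mh hfg.
have := lpn_ge0 f; have := lpn_ge0 g; have := lpn_pow f; have := lpn_pow g.
case: (lpn f) => [a| |]//; last first.
  by move=> _ _ g0 _; rewrite ge0_addye ?leey.
case: (lpn g) => [b| |]//; last by move=> _ _ _ ?; rewrite ge0_addey ?leey.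
rewrite !poweR_EFin !lee_fin => Ig If b0 a0.
(* the norms are increased by [e / 2] to make them positive *)
apply/lee_addgt0Pr => e e0; pose a' := (a + e / 2)%R; pose b' := (b + e / 2)%R.
have a'0 : (0 < a')%R by rewrite /a'; lra.
have b'0 : (0 < b')%R by rewrite /b'; lra.
have -> : a%:E + b%:E + e%:E = (a' + b')%:E.
  by rewrite -!EFinD; congr EFin; rewrite /a' /b'; lra.
pose c1 := ((a' + b') `^ p * (a' / (a' + b') / a' `^ p))%R.
pose c2 := ((a' + b') `^ p * (b' / (a' + b') / b' `^ p))%R.
have c10 : (0 < c1)%R by rewrite /c1 mulr_gt0// ?divr_gt0// ?powR_gt0// ?divr_gt0// addr_gt0.
have c20 : (0 < c2)%R by rewrite /c2 mulr_gt0// ?divr_gt0// ?powR_gt0// ?divr_gt0// addr_gt0.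
have pw z : D z -> `|h z| `^ p <= c1%:E * `|f z| `^ p + c2%:E * `|g z| `^ p.
  move=> Dz; apply: le_trans (le_poweR p0 (abse_ge0 _) (hfg _ Dz)) _.
  have := abse_ge0 (f z); have := abse_ge0 (g z).
  case: `|f z| => [x| |]//; last first.
    move=> g0 _; rewrite (ge0_addye g0) poweRyr ?gt_eqF// gt0_muley ?lte_fin//.
    by rewrite ge0_addye ?leey// mule_ge0 ?poweR_ge0// lee_fin ltW.
  case: `|g z| => [y| |]//; last first.
    move=> _ f0; rewrite (ge0_addey f0) poweRyr ?gt_eqF// [c2%:E * _]gt0_muley ?lte_fin//.
  move=> y0 x0; rewrite !lee_fin in y0 x0; rewrite -EFinD !poweR_EFin -!EFinM -EFinD lee_fin.
  exact: powR_convex_add.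
have c1p : 0 <= c1%:E by rewrite lee_fin ltW.
have c2p : 0 <= c2%:E by rewrite lee_fin ltW.
have : \int[mu]_(z in D) (`|h z| `^ p * (w z)%:E) <= ((a' + b') `^ p)%:E.
  apply: (@le_trans _ _ (\int[mu]_(z in D) (c1%:E * (`|f z| `^ p * (w z)%:E) +
     c2%:E * (`|g z| `^ p * (w z)%:E)))).
    apply: ge0_le_integral => //; [by move=> z; exact: int0|exact: mint| |].
      by apply: emeasurable_funD; apply: measurable_funeM; exact: mint.
    move=> z Dz; rewrite !muleA -ge0_muleDl ?mule_ge0 ?poweR_ge0//.
    by rewrite lee_wpmul2r ?w0// pw.
  rewrite ge0_integralD//; first last.
  - by apply: measurable_funeM; exact: mint.
  - by move=> z Dz; apply: mule_ge0 => //; exact: int0.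
  - by apply: measurable_funeM; exact: mint.
  - by move=> z Dz; apply: mule_ge0 => //; exact: int0.
  rewrite (@ge0_integralZl_EFin _ _ _ mu D mD _ (@int0 f) (mint mf)) ?(ltW c10)//.
  rewrite (@ge0_integralZl_EFin _ _ _ mu D mD _ (@int0 g) (mint mg)) ?(ltW c20)//.
  rewrite -If -Ig -!EFinM -EFinD lee_fin.
  apply: (@le_trans _ _ (c1 * a' `^ p + c2 * b' `^ p))%R.
    by apply: lerD; apply: ler_wpM2l; rewrite ?(ltW c10) ?(ltW c20)//;
      apply: ge0_ler_powR; rewrite ?nnegrE ?(ltW p0) ?(ltW a'0) ?(ltW b'0)// lerDl;
      rewrite divr_ge0// ltW.
  rewrite /c1 /c2 le_eqVlt; apply/orP; left; apply/eqP.
  have A0 : (a' `^ p != 0)%R by rewrite gt_eqF ?powR_gt0.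
  have B0 : (b' `^ p != 0)%R by rewrite gt_eqF ?powR_gt0.
  have S0 : (a' + b' != 0)%R by rewrite gt_eqF// addr_gt0.
  by field; rewrite A0 B0 S0.
have pi0 : (0 < p^-1)%R by rewrite invr_gt0.
have h0 : 0 <= \int[mu]_(z in D) (`|h z| `^ p * (w z)%:E).
  by apply: integral_ge0 => z Dz; exact: int0.
move=> /(le_poweR pi0 h0) /le_trans; apply.
by rewrite poweR_EFin -powRrM mulfV ?gt_eqF// powRr1// addr_ge0// ltW.
Qed.

Lemma lpn_le_of_int (K : R) f g : (0 <= K)%R ->
  \int[mu]_(z in D) (`|f z| `^ p * (w z)%:E) <=
    K%:E * \int[mu]_(z in D) (`|g z| `^ p * (w z)%:E) ->
  lpn f <= (K `^ p^-1)%:E * lpn g.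
Proof.
move=> K0 h; rewrite /lpn -poweR_EFin -poweRM ?lee_fin//; last first.
  by apply: integral_ge0 => z Dz; exact: int0.
apply: le_poweR => //; first by rewrite invr_gt0.
by apply: integral_ge0 => z Dz; exact: int0.
Qed.

End weighted_norm.

End weighted_Lp.

(** * Product weights and the two-dimensional Hardy inequality *)

Section two_dimensional_hardy.
Context {R : realType}.
Local Notation mR := (measurableTypeR R).
Local Open Scope ereal_scope.

Lemma measurable_slice_t (h : R * R -> \bar R) :
  measurable_fun Rp2 (h : mR * mR -> \bar R) -> (forall z, Rp2 z -> 0 <= h z) ->
  measurable_fun Rp ((fun t => \int[leb]_(s in Rp) h (s, t)) : mR -> \bar R).
Proof.
move=> mh h0; apply: (measurable_restrictT _ (@measurable_Rp R)).2.
have mH : measurable_fun setT ((h \_ Rp2) : mR * mR -> \bar R).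
  exact: (measurable_restrictT _ (@measurable_Rp2 R)).1.
have H0 z : 0 <= (h \_ Rp2) z.
  by rewrite patchE; case: ifPn => // /set_mem; exact: h0.
have := @measurable_fun_fubini_tonelli_G _ _ _ _ _ leb _ mH H0.
congr measurable_fun; apply/funext => y; rewrite /fubini_G patchE.
case: ifPn => [/set_mem yp|yp].
  rewrite [RHS]integral_mkcond; apply: eq_integral => x _ /=.
  rewrite !patchE; congr (if _ then _ else _).
  by apply/idP/idP => /set_mem; rewrite ?Rp2E/= => H; apply/mem_set;
    rewrite ?Rp2E/=; move: yp H; rewrite !RpE; tauto.
rewrite integral0_eq// => x _; rewrite patchE ifN//.
by apply: contra yp => /set_mem []/= _ ?; exact/mem_set.
Qed.

Lemma measurable_slice_s (h : R * R -> \bar R) :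
  measurable_fun Rp2 (h : mR * mR -> \bar R) -> (forall z, Rp2 z -> 0 <= h z) ->
  measurable_fun Rp ((fun s => \int[leb]_(t in Rp) h (s, t)) : mR -> \bar R).
Proof.
move=> mh h0.
have sw : measurable_fun Rp2 ((fun z => h (z.2, z.1)) : mR * mR -> \bar R).
  apply: (measurable_comp (@measurable_Rp2 R) _ mh).
    by move=> _ [[x y] [/= ? ?] <-]; split.
  by apply: measurable_funTS; exact: measurable_swap.
apply: (@measurable_slice_t (fun z => h (z.2, z.1))) => //.
by move=> [x y] [/= ? ?]; apply: h0; split.
Qed.

Section product_weight.
Variables (u v : R -> R).
Hypotheses (hu : weight u) (hv : weight v).

Lemma measurable_prodw :
  measurable_fun Rp2 ((fun z => (prodw u v z)%:E) : mR * mR -> \bar R).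
Proof.
have mf : measurable_fun Rp2 ((fun z => (u z.1)%:E) : mR * mR -> \bar R).
  apply: (@measurable_comp _ _ _ _ _ _ Rp (fun x : mR => (u x)%:E)) => //.
  - exact: measurable_Rp.
  - by move=> _ [z [? _] <-].
  - exact: weightM.
  - by apply: measurable_funTS; exact: measurable_fst.
have mg : measurable_fun Rp2 ((fun z => (v z.2)%:E) : mR * mR -> \bar R).
  apply: (@measurable_comp _ _ _ _ _ _ Rp (fun x : mR => (v x)%:E)) => //.
  - exact: measurable_Rp.
  - by move=> _ [z [_ ?] <-].
  - exact: weightM.
  - by apply: measurable_funTS; exact: measurable_snd.
by apply: (eq_measurable_fun _ _ (emeasurable_funM mf mg)) => z _; rewrite -EFinM.
Qed.

Lemma prodw_ge0 z : Rp2 z -> 0 <= (prodw u v z)%:E.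
Proof.
by move=> [z1 z2]; rewrite /prodw EFinM mule_ge0// weight_ge0.
Qed.

Let mHW (H : R * R -> \bar R) : measurable_fun Rp2 (H : mR * mR -> \bar R) ->
  measurable_fun Rp2 ((fun z => H z * (prodw u v z)%:E) : mR * mR -> \bar R).
Proof. by move=> mH; apply: emeasurable_funM => //; exact: measurable_prodw. Qed.

Let HW0 (H : R * R -> \bar R) : (forall z, Rp2 z -> 0 <= H z) ->
  forall z, Rp2 z -> 0 <= H z * (prodw u v z)%:E.
Proof. by move=> H0 z zR; rewrite mule_ge0 ?H0 ?prodw_ge0. Qed.

Lemma measurable_sect1 (H : R * R -> \bar R) t :
  measurable_fun Rp2 (H : mR * mR -> \bar R) -> Rp t ->
  measurable_fun Rp ((fun s => H (s, t)) : mR -> \bar R).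
Proof.
move=> mH tR; apply: (measurable_comp (@measurable_Rp2 R) _ mH).
  by move=> _ [s sR <-]; split.
by apply: measurable_funTS; exact: (pair2_measurable (t : mR)).
Qed.

Lemma measurable_sect2 (H : R * R -> \bar R) s :
  measurable_fun Rp2 (H : mR * mR -> \bar R) -> Rp s ->
  measurable_fun Rp ((fun t => H (s, t)) : mR -> \bar R).
Proof.
move=> mH tR; apply: (measurable_comp (@measurable_Rp2 R) _ mH).
  by move=> _ [t tR' <-]; split.
by apply: measurable_funTS; exact: (pair1_measurable (s : mR)).
Qed.

Lemma integral_prodw_t (H : R * R -> \bar R) :
  measurable_fun Rp2 (H : mR * mR -> \bar R) -> (forall z, Rp2 z -> 0 <= H z) ->
  \int[leb2]_(z in Rp2) (H z * (prodw u v z)%:E) =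
  \int[leb]_(t in Rp) ((v t)%:E * \int[leb]_(s in Rp) (H (s, t) * (u s)%:E)).
Proof.
move=> mH H0; rewrite integral_Rp2_swap; [|exact: mHW|exact: HW0].
apply: eq_integral => t /set_mem tR.
rewrite -ge0_integralZl//.
- by apply: eq_integral => s _; rewrite /prodw/= EFinM muleA muleC.
- exact: measurable_Rp.
- by apply: emeasurable_funM; [exact: measurable_sect1|exact: weightM].
- by move=> s sR; rewrite mule_ge0 ?weight_ge0// H0.
- exact: weight_ge0.
Qed.

Lemma integral_prodw_s (H : R * R -> \bar R) :
  measurable_fun Rp2 (H : mR * mR -> \bar R) -> (forall z, Rp2 z -> 0 <= H z) ->
  \int[leb2]_(z in Rp2) (H z * (prodw u v z)%:E) =
  \int[leb]_(s in Rp) ((u s)%:E * \int[leb]_(t in Rp) (H (s, t) * (v t)%:E)).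
Proof.
move=> mH H0; rewrite integral_Rp2; [|exact: mHW|exact: HW0].
apply: eq_integral => s /set_mem sR.
rewrite -ge0_integralZl//.
- by apply: eq_integral => t _; rewrite /prodw/= EFinM muleCA.
- exact: measurable_Rp.
- by apply: emeasurable_funM; [exact: measurable_sect2|exact: weightM].
- by move=> t tR; rewrite mule_ge0 ?weight_ge0// H0.
- exact: weight_ge0.
Qed.

Lemma measurable_inner_t (H : R * R -> \bar R) :
  measurable_fun Rp2 (H : mR * mR -> \bar R) -> (forall z, Rp2 z -> 0 <= H z) ->
  measurable_fun Rp ((fun t => (v t)%:E * \int[leb]_(s in Rp) (H (s, t) * (u s)%:E)) : mR -> \bar R).
Proof.
move=> mH H0; apply: emeasurable_funM; first exact: weightM.
apply: (@measurable_slice_t (fun z => H z * (u z.1)%:E)).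
  apply: emeasurable_funM => //.
  apply: (@measurable_comp _ _ _ _ _ _ Rp (fun x : mR => (u x)%:E)) => //.
  - exact: measurable_Rp.
  - by move=> _ [z [? _] <-].
  - exact: weightM.
  - by apply: measurable_funTS; exact: measurable_fst.
by move=> z zR; rewrite mule_ge0 ?H0 ?weight_ge0//; case: zR.
Qed.

Lemma measurable_inner_s (H : R * R -> \bar R) :
  measurable_fun Rp2 (H : mR * mR -> \bar R) -> (forall z, Rp2 z -> 0 <= H z) ->
  measurable_fun Rp ((fun s => (u s)%:E * \int[leb]_(t in Rp) (H (s, t) * (v t)%:E)) : mR -> \bar R).
Proof.
move=> mH H0; apply: emeasurable_funM; first exact: weightM.
apply: (@measurable_slice_s (fun z => H z * (v z.2)%:E)).
  apply: emeasurable_funM => //.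
  apply: (@measurable_comp _ _ _ _ _ _ Rp (fun x : mR => (v x)%:E)) => //.
  - exact: measurable_Rp.
  - by move=> _ [z [_ ?] <-].
  - exact: weightM.
  - by apply: measurable_funTS; exact: measurable_snd.
by move=> z zR; rewrite mule_ge0 ?H0 ?weight_ge0//; case: zR.
Qed.

(** An inequality on all slices integrates to one on the quadrant. *)
Lemma le_slices_t (K : R) (H G : R * R -> \bar R) : (0 <= K)%R ->
  measurable_fun Rp2 (H : mR * mR -> \bar R) ->
  measurable_fun Rp2 (G : mR * mR -> \bar R) ->
  (forall z, Rp2 z -> 0 <= H z) -> (forall z, Rp2 z -> 0 <= G z) ->
  (forall t, Rp t -> \int[leb]_(s in Rp) (H (s, t) * (u s)%:E) <=
    K%:E * \int[leb]_(s in Rp) (G (s, t) * (u s)%:E)) ->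
  \int[leb2]_(z in Rp2) (H z * (prodw u v z)%:E) <=
  K%:E * \int[leb2]_(z in Rp2) (G z * (prodw u v z)%:E).
Proof.
move=> K0 mH mG H0 G0 HG; rewrite !integral_prodw_t//.
have in0 (F : R * R -> \bar R) t : (forall z, Rp2 z -> 0 <= F z) -> Rp t ->
    0 <= (v t)%:E * \int[leb]_(s in Rp) (F (s, t) * (u s)%:E).
  move=> F0 tR; rewrite mule_ge0 ?weight_ge0//; apply: integral_ge0 => s sR.
  by rewrite mule_ge0 ?weight_ge0// F0.
rewrite -ge0_integralZl//; first last.
- by move=> t tR; exact: in0.
- exact: measurable_inner_t.
- exact: measurable_Rp.
apply: ge0_le_integral => //.
- exact: measurable_Rp.
- by move=> t tR; exact: in0.
- exact: measurable_inner_t.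
- by apply: measurable_funeM; exact: measurable_inner_t.
by move=> t tR; rewrite muleCA lee_wpmul2l ?weight_ge0// HG.
Qed.

Lemma le_slices_s (K : R) (H G : R * R -> \bar R) : (0 <= K)%R ->
  measurable_fun Rp2 (H : mR * mR -> \bar R) ->
  measurable_fun Rp2 (G : mR * mR -> \bar R) ->
  (forall z, Rp2 z -> 0 <= H z) -> (forall z, Rp2 z -> 0 <= G z) ->
  (forall s, Rp s -> \int[leb]_(t in Rp) (H (s, t) * (v t)%:E) <=
    K%:E * \int[leb]_(t in Rp) (G (s, t) * (v t)%:E)) ->
  \int[leb2]_(z in Rp2) (H z * (prodw u v z)%:E) <=
  K%:E * \int[leb2]_(z in Rp2) (G z * (prodw u v z)%:E).
Proof.
move=> K0 mH mG H0 G0 HG; rewrite !integral_prodw_s//.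
have in0 (F : R * R -> \bar R) s : (forall z, Rp2 z -> 0 <= F z) -> Rp s ->
    0 <= (u s)%:E * \int[leb]_(t in Rp) (F (s, t) * (v t)%:E).
  move=> F0 sR; rewrite mule_ge0 ?weight_ge0//; apply: integral_ge0 => t tR.
  by rewrite mule_ge0 ?weight_ge0// F0.
rewrite -ge0_integralZl//; first last.
- by move=> t tR; exact: in0.
- exact: measurable_inner_s.
- exact: measurable_Rp.
apply: ge0_le_integral => //.
- exact: measurable_Rp.
- by move=> t tR; exact: in0.
- exact: measurable_inner_s.
- by apply: measurable_funeM; exact: measurable_inner_s.
by move=> t tR; rewrite muleCA lee_wpmul2l ?weight_ge0// HG.
Qed.

End product_weight.

(** S^2 is the iteration of the one-dimensional averages. *)
Lemma S2E (h : mR * mR -> \bar R) (z : R * R) :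
  measurable_fun setT h -> (forall z, 0 <= h z) -> Rp2 z ->
  S2 h z = avg (fun a => avg (fun b => h (a, b)) z.2) z.1.
Proof.
case: z => s t mh h0; rewrite Rp2E/= => -[s0 t0].
rewrite /S2/= /avg ge0_integralZl//.
- by rewrite muleA -EFinM invfM.
- apply: measurable_funTS.
  have := measurable_integral_param mh h0.
  by move=> /(measurableT_comp) /(_ (pair2_measurable (t : mR))).
- by move=> x _; exact: integral_ge0.
- by rewrite lee_fin invr_ge0 ltW.
Qed.

Lemma measurable_swap_fun (F : mR * mR -> \bar R) : measurable_fun setT F ->
  measurable_fun setT ((fun z => F (z.2, z.1)) : mR * mR -> \bar R).
Proof. by move=> mF; apply: (measurableT_comp mF); exact: measurable_swap. Qed.

Lemma measurable_iter_avg (h : mR * mR -> \bar R) :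
  measurable_fun setT h -> (forall z, 0 <= h z) ->
  measurable_fun setT
    ((fun z => avg (fun a => avg (fun b => h (a, b)) z.2) z.1) : mR * mR -> \bar R).
Proof.
move=> mh h0; pose k (z : mR * mR) := avg (fun b => h (z.1, b)) z.2.
have mk : measurable_fun setT k := measurable_avg_param mh h0.
have mk' := measurable_swap_fun mk.
have k0 (z : mR * mR) : 0 <= k (z.2, z.1) by exact: avg_ge0.
exact: (measurable_swap_fun (measurable_avg_param mk' k0)).
Qed.

(** Nonincreasing in each variable on the quadrant. *)
Definition nonincr_Rp2 (h : R * R -> \bar R) :=
  (forall s s' t, (0 < s)%R -> (0 < t)%R -> (s <= s')%R -> h (s', t) <= h (s, t)) /\
  (forall s t t', (0 < s)%R -> (0 < t)%R -> (t <= t')%R -> h (s, t') <= h (s, t)).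

(** The two-dimensional Hardy inequality on nonincreasing functions. *)
Lemma hardy2 (p : R) (u v : R -> R) : (0 < p)%R -> weight u -> weight v ->
  Bp p u -> Bp p v ->
  exists2 C : R, (0 < C)%R & forall h : mR * mR -> \bar R,
  measurable_fun setT h -> (forall z, 0 <= h z) -> nonincr_Rp2 h ->
  \int[leb2]_(z in Rp2) (S2 h z `^ p * (prodw u v z)%:E) <=
  C%:E * \int[leb2]_(z in Rp2) (h z `^ p * (prodw u v z)%:E).
Proof.
move=> p0 hu hv Bu Bv; have [A A0 hA] := hardy p0 hu Bu; have [B B0 hB] := hardy p0 hv Bv.
exists (A * B)%R; first exact: mulr_gt0.
move=> h mh h0 [dh1 dh2].
pose k (z : R * R) := avg (fun b => h (z.1, b)) z.2.
have mk : measurable_fun setT (k : mR * mR -> \bar R) by exact: measurable_avg_param.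
have k0 z : 0 <= k z by exact: avg_ge0.
pose S (z : R * R) := avg (fun a => k (a, z.2)) z.1.
have mS : measurable_fun setT (S : mR * mR -> \bar R) by exact: measurable_iter_avg.
have S0 z : 0 <= S z by exact: avg_ge0.
have mks t : measurable_fun setT ((fun a => k (a, t)) : mR -> \bar R).
  by apply: (measurableT_comp mk); exact: pair2_measurable.
have mhs s : measurable_fun setT ((fun b => h (s, b)) : mR -> \bar R).
  exact: measurableT_comp.
have mpow (f : mR * mR -> \bar R) : measurable_fun setT f ->
    measurable_fun Rp2 ((fun z => f z `^ p) : mR * mR -> \bar R).
  by move=> mf; apply: measurable_funTS; exact: measurable_poweR_comp.
have -> : \int[leb2]_(z in Rp2) (S2 h z `^ p * (prodw u v z)%:E) =
    \int[leb2]_(z in Rp2) (S z `^ p * (prodw u v z)%:E).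
  by apply: eq_integral => z /set_mem zR; rewrite S2E.
apply: (@le_trans _ _ (A%:E * \int[leb2]_(z in Rp2) (k z `^ p * (prodw u v z)%:E))).
  apply: (@le_slices_t u v hu hv A (fun z => S z `^ p) (fun z => k z `^ p)).
  - exact: ltW.
  - exact: mpow.
  - exact: mpow.
  - by move=> z _; exact: poweR_ge0.
  - by move=> z _; exact: poweR_ge0.
  move=> t; rewrite RpE => t0.
  apply: (hA (fun a => k (a, t))) => // s s' s0 ss.
  apply: le_avg_fun => // x x0; exact: dh1.
rewrite EFinM -muleA; apply: lee_wpmul2l; first by rewrite lee_fin ltW.
apply: (@le_slices_s u v hu hv B (fun z => k z `^ p) (fun z => h z `^ p)).
- exact: ltW.
- exact: mpow.
- exact: mpow.
- by move=> z _; exact: poweR_ge0.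
- by move=> z _; exact: poweR_ge0.
move=> s; rewrite RpE => s0.
apply: (hB (fun b => h (s, b))) => // t t' t0 tt; exact: dh2.
Qed.

End two_dimensional_hardy.

(** * The iterated rearrangement and its maximal functions *)

Section iterated_rearrangement.
Context {R : realType}.
Local Notation mR := (measurableTypeR R).
Local Open Scope ereal_scope.

Lemma eq_avg (f g : R -> \bar R) (t : R) :
  (forall b, (0 < b < t)%R -> f b = g b) -> avg f t = avg g t.
Proof.
move=> fg; congr (_ * _); apply: eq_integral => b /set_mem/=.
by rewrite in_itv/=; exact: fg.
Qed.

Lemma avgZ (f : mR -> \bar R) (c t : R) : measurable_fun setT f ->
  (forall x, 0 <= f x) -> (0 <= c)%R ->
  avg (fun b => c%:E * f b) t = c%:E * avg f t.
Proof.
move=> mf f0 c0; rewrite /avg (@ge0_integralZl_EFin _ _ _ leb _ (measurable_itv _)) //.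
  by rewrite muleCA.
exact: measurable_funTS.
Qed.

Lemma measurable_fix2 (F : mR * mR -> \bar R) (t : R) : measurable_fun setT F ->
  measurable_fun setT ((fun x => F (x, t)) : mR -> \bar R).
Proof. by move=> mF; apply: (measurableT_comp mF); exact: pair2_measurable. Qed.

Lemma measurable_fix1 (F : mR * mR -> \bar R) (x : R) : measurable_fun setT F ->
  measurable_fun setT ((fun t => F (x, t)) : mR -> \bar R).
Proof. by move=> mF; apply: (measurableT_comp mF); exact: pair1_measurable. Qed.

Lemma avg_swap (F : mR * mR -> \bar R) (s t : R) : (0 < s)%R -> (0 < t)%R ->
  measurable_fun setT F -> (forall z, 0 <= F z) ->
  avg (fun b => avg (fun a => F (a, b)) s) t =
  avg (fun a => avg (fun b => F (a, b)) t) s.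
Proof.
move=> s0 t0 mF F0.
have ti : (0 <= t^-1)%R by rewrite invr_ge0 ltW.
have si : (0 <= s^-1)%R by rewrite invr_ge0 ltW.
pose G (z : mR * mR) : \bar R := (F \_ (`]0%R, s[ `*` `]0%R, t[)) z.
have mI : measurable ((`]0%R, s[ : set mR) `*` (`]0%R, t[ : set mR)).
  exact: measurableX.
have mG : measurable_fun setT G.
  apply: (measurable_restrictT F mI).1.
  by apply: measurable_funTS; exact: mF.
have G0 z : 0 <= G z by rewrite /G patchE; case: ifP => // _; exact: F0.
have Gs a : \int[leb]_b G (a, b) =
    ((fun a => \int[leb]_(b in `]0%R, t[) F (a, b)) \_ (`]0%R, s[%classic : set mR)) a.
  rewrite patchE; case: ifPn => [/set_mem ha|ha].
    rewrite [RHS]integral_mkcond; apply: eq_integral => b _; rewrite /G !patchE.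
    congr (if _ then _ else _).
    by apply/idP/idP => /set_mem hb; apply/mem_set; [case: hb|split].
  apply: integral0_eq => b _; rewrite /G patchE ifN//; apply: contra ha.
  by move=> /set_mem[? _]; exact/mem_set.
have Gt b : \int[leb]_a G (a, b) =
    ((fun b => \int[leb]_(a in `]0%R, s[) F (a, b)) \_ (`]0%R, t[%classic : set mR)) b.
  rewrite patchE; case: ifPn => [/set_mem hb|hb].
    rewrite [RHS]integral_mkcond; apply: eq_integral => a _; rewrite /G !patchE.
    congr (if _ then _ else _).
    by apply/idP/idP => /set_mem ha; apply/mem_set; [case: ha|split].
  apply: integral0_eq => a _; rewrite /G patchE ifN//; apply: contra hb.
  by move=> /set_mem[_ ?]; exact/mem_set.
have Fub := @fubini_tonelli _ _ _ _ _ leb leb G mG G0.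
pose q (b : mR) := \int[leb]_(a in `]0%R, s[) F (a, b).
pose r (a : mR) := \int[leb]_(b in `]0%R, t[) F (a, b).
have q0 b : 0 <= q b by apply: integral_ge0 => a _; exact: F0.
have r0 a : 0 <= r a by apply: integral_ge0 => b _; exact: F0.
have mq : measurable_fun setT q.
  have := measurable_integral_param (measurable_swap_fun mF) (fun z => F0 _).
  exact: (@measurable_fix2 _ s).
have mr : measurable_fun setT r.
  have := measurable_integral_param mF (fun z => F0 _).
  exact: (@measurable_fix2 _ t).
have E1 : avg (fun b => avg (fun a => F (a, b)) s) t =
    (t^-1)%:E * ((s^-1)%:E * \int[leb]_b \int[leb]_a G (a, b)).
  transitivity ((t^-1)%:E * \int[leb]_(b in `]0%R, t[) ((s^-1)%:E * q b)); first by [].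
  rewrite (@ge0_integralZl_EFin _ _ _ leb _ (measurable_itv _) q (fun b _ => q0 b) _ _ si).
    congr (_ * (_ * _)); rewrite integral_mkcond; apply: eq_integral => b _.
    by rewrite Gt.
  exact: measurable_funTS.
have E2 : avg (fun a => avg (fun b => F (a, b)) t) s =
    (s^-1)%:E * ((t^-1)%:E * \int[leb]_a \int[leb]_b G (a, b)).
  transitivity ((s^-1)%:E * \int[leb]_(a in `]0%R, s[) ((t^-1)%:E * r a)); first by [].
  rewrite (@ge0_integralZl_EFin _ _ _ leb _ (measurable_itv _) r (fun b _ => r0 b) _ _ ti).
    congr (_ * (_ * _)); rewrite integral_mkcond; apply: eq_integral => b _.
    by rewrite Gs.
  exact: measurable_funTS.
rewrite E1 E2 Fub; exact: muleCA.
Qed.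

Section functions.
Variable f : R * R -> R.
Hypothesis mf : meas2 setT f.

Let mF : measurable_fun setT ((fun z => (f z)%:E) : mR * mR -> \bar R).
Proof. exact/measurable_EFinP. Qed.

Lemma measurable_sect_y x : measurable_fun setT ((fun y => (f (x, y))%:E) : mR -> \bar R).
Proof. exact: (@measurable_fix1 (fun z => (f z)%:E) x mF). Qed.

Lemma measurable_rearr_y :
  measurable_fun setT ((fun z => rearr_y f z.1 z.2) : mR * mR -> \bar R).
Proof. exact: (measurable_rearr_param mF). Qed.

Lemma rearr_y_ge0 x t : 0 <= rearr_y f x t.
Proof. exact: rearr_ge0. Qed.

Lemma rearr_y_nonincr x : nonincr_Rp (rearr_y f x).
Proof. by move=> s t _; exact: rearr_nonincreasing. Qed.

Lemma measurable_rearr_y1 t :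
  measurable_fun setT ((fun x => rearr_y f x t) : mR -> \bar R).
Proof.
exact: (@measurable_fix2 (fun z => rearr_y f z.1 z.2) t measurable_rearr_y).
Qed.

Lemma measurable_rearr_y2 x : measurable_fun setT (rearr_y f x : mR -> \bar R).
Proof. exact: measurable_rearr (measurable_sect_y x). Qed.

Lemma measurable_rearr_yx :
  measurable_fun setT (rearr_yx f : mR * mR -> \bar R).
Proof.
pose F (z : mR * mR) := rearr_y f z.1 z.2.
have mF' : measurable_fun setT (fun z : mR * mR => F (z.2, z.1)).
  exact: measurable_swap_fun measurable_rearr_y.
exact: (measurable_swap_fun (measurable_rearr_param mF')).
Qed.

Lemma rearr_yx_ge0 z : 0 <= rearr_yx f z. Proof. exact: rearr_ge0. Qed.

Lemma rearr_yx_nonincr : nonincr_Rp2 (rearr_yx f).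
Proof.
split=> [s s' t s0 t0 ss|s t t' s0 t0 tt]; first exact: rearr_nonincreasing.
apply: le_rearr; [exact: measurable_rearr_y1|exact: measurable_rearr_y1|].
move=> x; rewrite !gee0_abs; try exact: rearr_ge0.
exact: rearr_nonincreasing.
Qed.

Lemma measurable_avg_y : measurable_fun setT ((fun z => avg (rearr_y f z.1) z.2) : mR * mR -> \bar R).
Proof.
exact: (measurable_avg_param measurable_rearr_y (fun z => rearr_y_ge0 _ _)).
Qed.

Lemma avg_y_ge0 x t : 0 <= avg (rearr_y f x) t.
Proof. by apply: avg_ge0; exact: rearr_y_ge0. Qed.

Lemma measurable_avg_y1 t : measurable_fun setT ((fun x => avg (rearr_y f x) t) : mR -> \bar R).
Proof.
exact: (@measurable_fix2 (fun z => avg (rearr_y f z.1) z.2) t measurable_avg_y).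
Qed.

Lemma maximal_yxE z : maximal_yx f z = avg (rearr (fun x => avg (rearr_y f x) z.2)) z.1.
Proof. by []. Qed.

Lemma measurable_maximal_yx :
  measurable_fun setT (maximal_yx f : mR * mR -> \bar R).
Proof.
pose F (z : mR * mR) := avg (rearr_y f z.1) z.2.
have mF' : measurable_fun setT (fun z : mR * mR => F (z.2, z.1)).
  exact: measurable_swap_fun measurable_avg_y.
have := measurable_avg_param (measurable_rearr_param mF') (fun z => rearr_ge0 _ _).
exact: measurable_swap_fun.
Qed.

Lemma maximal_yx_ge0 z : 0 <= maximal_yx f z.
Proof. by rewrite maximal_yxE; apply: avg_ge0 => x; exact: rearr_ge0. Qed.

Lemma rearr_yx_le_maximal_yx z : Rp2 z -> rearr_yx f z <= maximal_yx f z.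
Proof.
case: z => s t; rewrite Rp2E/= => -[s0 t0]; rewrite maximal_yxE/=.
apply: (@le_trans _ _ (rearr (fun x => avg (rearr_y f x) t) s)).
  apply: le_rearr; [exact: measurable_rearr_y1|exact: measurable_avg_y1|].
  move=> x; rewrite !gee0_abs ?rearr_y_ge0 ?avg_y_ge0//.
  apply: le_avg => //; [exact: measurable_rearr_y2|exact: rearr_y_ge0|].
  exact: rearr_y_nonincr.
apply: le_avg => //.
- by apply: measurable_rearr; exact: measurable_avg_y1.
- by move=> x; exact: rearr_ge0.
- by move=> a b _; exact: rearr_nonincreasing.
Qed.

Lemma maximalE z : Rp2 z ->
  maximal f z = avg (fun a => avg (fun b => rearr_yx f (a, b)) z.2) z.1.
Proof. exact: S2E measurable_rearr_yx rearr_yx_ge0. Qed.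

Lemma maximal_ge0 z : Rp2 z -> 0 <= maximal f z.
Proof.
move=> /maximalE ->; apply: avg_ge0 => a; apply: avg_ge0 => b; exact: rearr_yx_ge0.
Qed.

Lemma measurable_maximal : measurable_fun Rp2 (maximal f : mR * mR -> \bar R).
Proof.
have := measurable_iter_avg measurable_rearr_yx rearr_yx_ge0.
move=> /(@measurable_funTS _ _ _ _ Rp2).
apply: eq_measurable_fun => z /set_mem zR; exact/esym/maximalE.
Qed.

(** Averaging in [y] before rearranging in [x] gives less than averaging
    after both rearrangements. *)
Lemma maximal_yx_le_maximal z : Rp2 z -> maximal_yx f z <= maximal f z.
Proof.
move=> zR; rewrite maximalE// maximal_yxE.
case: z zR => s t; rewrite Rp2E/= => -[s0 t0].
have ti : (0 <= t^-1)%R by rewrite invr_ge0 ltW.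
have si : (0 <= s^-1)%R by rewrite invr_ge0 ltW.
pose h x := \int[leb]_(b in `]0%R, t[) rearr_y f x b.
have mh : measurable_fun setT (h : mR -> \bar R).
  have := measurable_integral_param measurable_rearr_y (fun z => rearr_y_ge0 _ _).
  exact: measurable_fix2.
have h0 x : 0 <= h x by apply: integral_ge0 => b _; exact: rearr_y_ge0.
have -> : avg (rearr (fun x => avg (rearr_y f x) t)) s = (t^-1)%:E * avg (rearr h) s.
  rewrite -avgZ//; [|exact: measurable_rearr|by move=> x; exact: rearr_ge0].
  apply: eq_avg => b /andP[b0 _]; rewrite (rearrZ _ mh (ltW b0)).
  by rewrite ger0_norm.
have := @avg_rearr_integral R (fun z => rearr_y f z.1 z.2) h t s s0
  measurable_rearr_y (fun z => rearr_y_ge0 _ _) mh.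
have hE x : `|h x| <= \int[leb]_(b in `]0%R, t[) rearr_y f x b by rewrite gee0_abs.
move=> /(_ hE) /= H.
apply: (le_trans (lee_wpmul2l _ H)); first by rewrite lee_fin.
rewrite -/(avg (fun b => avg (rearr (fun x => rearr_y f x b)) s) t).
rewrite -(avg_swap s0 t0 measurable_rearr_yx rearr_yx_ge0).
exact: lexx.
Qed.

End functions.

Lemma measurable_add2 (f g : R * R -> R) : meas2 setT f -> meas2 setT g ->
  meas2 setT (fun z => f z + g z)%R.
Proof. by move=> mf mg; exact: measurable_funD. Qed.

Lemma measurable_scale2 (c : R) (f : R * R -> R) : meas2 setT f ->
  meas2 setT (fun z => c * f z)%R.
Proof. by move=> mf; apply: measurable_funM. Qed.

Lemma ge0_abs_le_add (a b c : \bar R) : 0 <= a -> 0 <= b -> 0 <= c ->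
  a <= b + c -> `|a| <= `|b| + `|c|.
Proof. by move=> a0 b0 c0; rewrite !gee0_abs. Qed.

Lemma maximal_yx_triangle (f g : R * R -> R) z : meas2 setT f -> meas2 setT g ->
  Rp2 z -> maximal_yx (fun z => f z + g z)%R z <= maximal_yx f z + maximal_yx g z.
Proof.
move=> mf mg; case: z => s t; rewrite Rp2E/= => -[s0 t0]; rewrite !maximal_yxE/=.
have mfg := measurable_add2 mf mg.
apply: (avg_rearr_subadd s0 (measurable_avg_y1 mf t) (measurable_avg_y1 mg t)
  (measurable_avg_y1 mfg t)) => x.
apply: ge0_abs_le_add; [exact: avg_y_ge0|exact: avg_y_ge0|exact: avg_y_ge0|].
apply: (avg_rearr_subadd t0 (measurable_sect_y mf x) (measurable_sect_y mg x)
  (measurable_sect_y mfg x)) => y.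
rewrite /= lee_fin; exact: ler_normD.
Qed.

Lemma rearr_yZ (c : R) (f : R * R -> R) x t : meas2 setT f -> (0 <= t)%R ->
  rearr_y (fun z => c * f z)%R x t = `|c|%:E * rearr_y f x t.
Proof.
move=> mf t0; rewrite /rearr_y -(rearrZ _ (measurable_sect_y mf x) t0).
by congr (rearr _ _).
Qed.

Lemma avg_rearr_yZ (c : R) (f : R * R -> R) x t : meas2 setT f ->
  avg (rearr_y (fun z => c * f z)%R x) t = `|c|%:E * avg (rearr_y f x) t.
Proof.
move=> mf; rewrite -avgZ//; last 2 first.
- exact: measurable_rearr_y2.
- exact: rearr_y_ge0.
by apply: eq_avg => b /andP[b0 _]; rewrite rearr_yZ// ltW.
Qed.

Lemma maximal_yxZ (c : R) (f : R * R -> R) z : meas2 setT f ->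
  maximal_yx (fun z => c * f z)%R z = `|c|%:E * maximal_yx f z.
Proof.
move=> mf; rewrite !maximal_yxE.
rewrite -avgZ//; last 2 first.
- by apply: measurable_rearr; exact: measurable_avg_y1.
- by move=> x; exact: rearr_ge0.
apply: eq_avg => b /andP[b0 _].
rewrite -[X in X%:E]normr_id -rearrZ//; last exact: ltW.
  by congr (rearr _ _); apply/funext => x; rewrite avg_rearr_yZ.
exact: measurable_avg_y1.
Qed.

End iterated_rearrangement.

(** * Null functions and equivalent norms *)

Section null_functions.
Context {R : realType}.
Local Notation mR := (measurableTypeR R).
Local Open Scope ereal_scope.

Lemma integral_eq0_distr (phi : mR -> \bar R) : measurable_fun setT phi ->
  (forall x, 0 <= phi x) -> (\int[leb]_x phi x = 0 <-> distr_fun phi 0 = 0).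
Proof.
move=> mphi phi0.
have mA := measurable_superlevel 0 mphi.
have E : \int[leb]_x `|phi x| = \int[leb]_x phi x.
  by apply: eq_integral => x _; rewrite gee0_abs.
have := @ae_eq_integral_abs _ _ _ leb setT measurableT phi mphi.
rewrite E => -[h1 h2]; split => [/h1 h|h].
  apply: (@negligibleP _ _ _ leb _ mA).1; move: h; apply: negligibleS => x /= h H.
  by move: h; rewrite (H I) /= normr0 ltxx.
apply: h2; have := (@negligibleP _ _ _ leb _ mA).2 h; apply: negligibleS => x /= H.
rewrite lt_neqAle abse_ge0 andbT eq_sym abse_eq0; apply/negP => /eqP h0.
by apply: H => _.
Qed.

Lemma distr0_rearr (g : mR -> \bar R) : measurable_fun setT g ->
  (forall t, (0 < t)%R -> rearr g t = 0) -> distr_fun g 0 = 0.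
Proof.
move=> mg h; apply/eqP; rewrite eq_le distr_fun_ge0 andbT.
apply/lee_addgt0Pr => e e0; rewrite add0e leNgt -rearr_gt// h//.
by rewrite ltxx.
Qed.

Section ae_zero.
Variable f : R * R -> R.
Hypothesis mf : meas2 setT f.

(** The measure of the set where the section of [f] at [x] is nonzero. *)
Definition sect_supp (x : R) : \bar R := distr_fun (fun y => (f (x, y))%:E) 0.

Let A : set (mR * mR) := [set z | 0 < `|(f z)%:E|].

Let mA : measurable A.
Proof. by apply: measurable_superlevel; exact/measurable_EFinP. Qed.

Let suppE x : sect_supp x = (leb \o xsection A) x.
Proof.
by congr (leb _); apply/seteqP; split => y /=; rewrite /xsection/= inE.
Qed.

Lemma measurable_sect_supp : measurable_fun setT (sect_supp : mR -> \bar R).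
Proof.
have := @measurable_fun_xsection _ _ _ _ _ leb A mA.
by congr measurable_fun; apply/funext => x; rewrite suppE.
Qed.

(** By Tonelli's theorem, [f] is null when almost all of its sections are. *)
Lemma ae0P : {ae leb2, forall z, f z = 0%R} <-> distr_fun sect_supp 0 = 0.
Proof.
have s0 x : 0 <= sect_supp x by exact: distr_fun_ge0.
rewrite -(integral_eq0_distr measurable_sect_supp s0).
have -> : \int[leb]_x sect_supp x = leb2 A.
  by rewrite /leb2 /product_measure1; apply: eq_integral => x _; rewrite suppE.
split=> h.
  apply: (@negligibleP _ _ _ leb2 _ mA).1; move: h; apply: negligibleS => z /= h H.
  by move: h; rewrite /A/= H normr0 ltxx.
have := (@negligibleP _ _ _ leb2 _ mA).2 h; apply: negligibleS => z /= H.
by rewrite /A/= lte_fin normr_gt0; apply/eqP.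
Qed.

Lemma sect_supp_rearr x t : (0 <= t)%R -> sect_supp x = 0 -> rearr_y f x t = 0.
Proof. exact: rearr0. Qed.

Lemma rearr_sect_supp x : (forall t, (0 < t)%R -> rearr_y f x t = 0) -> sect_supp x = 0.
Proof. by apply: distr0_rearr; exact: measurable_sect_y. Qed.

Lemma ae0_rearr (G : mR -> \bar R) s : measurable_fun setT G ->
  (forall x, sect_supp x = 0 -> G x = 0) -> {ae leb2, forall z, f z = 0%R} ->
  (0 <= s)%R -> rearr G s = 0.
Proof.
move=> mG hG /ae0P h s0; apply: rearr0 => //.
apply/eqP; rewrite eq_le distr_fun_ge0 andbT -h.
apply: le_distr_fun => //; first exact: measurable_sect_supp.
move=> x; rewrite !lt_neqAle !abse_ge0 !andbT ![0 == _]eq_sym !abse_eq0.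
by apply: contraNN => /eqP/hG ->.
Qed.

(** If f^*_yx vanishes, then for almost every [x] the numbers f^*_y(x, 1/n)
    vanish for all [n], so that the section of [f] at [x] is null. *)
Lemma rearr_yx_eq0 : (forall s t, (0 < s)%R -> (0 < t)%R -> rearr_yx f (s, t) = 0) ->
  {ae leb2, forall z, f z = 0%R}.
Proof.
move=> h; apply/ae0P.
have mS := measurable_superlevel 0 measurable_sect_supp.
pose B n := [set x : mR | 0 < `|rearr_y f x n.+1%:R^-1|].
have mB n : measurable (B n).
  by apply: measurable_superlevel; exact: measurable_rearr_y1.
apply: (@negligibleP _ _ _ leb _ mS).1; apply: (@negligibleS _ _ _ _ (\bigcup_n B n)).
  move=> x /= hx; apply: contrapT => nB.
  move: hx; rewrite rearr_sect_supp ?abse0 ?ltxx// => t t0.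
  have [n tn] : exists n : nat, (n.+1%:R^-1 < t)%R.
    have := @ltr_add_invr R 0 t t0; case=> n; rewrite add0r => tn; by exists n.
  apply/eqP; rewrite eq_le rearr_y_ge0 andbT.
  apply: le_trans (rearr_nonincreasing _ (ltW tn)) _.
  rewrite leNgt; apply/negP => H; apply: nB; exists n => //.
  by rewrite /B/= gee0_abs// rearr_y_ge0.
apply: negligible_bigcup => n; apply: (@negligibleP _ _ _ leb _ (mB n)).2.
apply: distr0_rearr; first exact: measurable_rearr_y1.
by move=> t t0; apply: (h t n.+1%:R^-1%R).
Qed.

End ae_zero.

Section positivity.
Variables (p : R) (w : R -> R).
Hypotheses (p0 : (0 < p)%R) (hw : weight w).
Hypothesis w_neq0 : ~ {ae @leb R, forall x : R, (0 < x)%R -> w x = 0%R}.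

Lemma prim_pos_ex : exists2 q : R, (0 < q)%R & 0 < prim w q.
Proof.
apply: contrapT => h; apply: w_neq0.
have p_eq0 q : prim w q = 0.
  have [q0|q0] := ltP 0%R q; last exact: prim_le0.
  apply/eqP; rewrite eq_le prim_ge0// andbT leNgt; apply/negP => hq.
  by apply: h; exists q.
have mRp := @measurable_Rp R.
have mw : measurable_fun Rp ((fun x => (w x)%:E) : mR -> \bar R) by exact: weightM.
have I0 : \int[leb]_(x in Rp) `|(w x)%:E| = 0.
  have -> : \int[leb]_(x in Rp) `|(w x)%:E| = \int[leb]_(x in Rp) (w x)%:E.
    by apply: eq_integral => x /set_mem xR; rewrite gee0_abs// weight_ge0.
  apply/eqP; rewrite eq_le; apply/andP; split.
    apply: integral_Rp_le => //; first by move=> x; exact: weight_ge0.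
    by move=> n; rewrite -/(prim w n%:R) p_eq0.
  by apply: integral_ge0 => x; exact: weight_ge0.
have := (@ae_eq_integral_abs _ _ _ leb Rp mRp _ mw).1 I0.
apply: negligibleS => x /= hx H; apply: hx => x0.
have [//] : (w x)%:E = 0 by apply: H; rewrite RpE.
Qed.

(** A nonzero weight in B_p charges every interval that starts at the
    origin. *)
Lemma Bp_prim_gt0 (r : R) : Bp p w -> (0 < r)%R -> 0 < prim w r.
Proof.
move=> [C C0 hC] r0; rewrite lt_neqAle prim_ge0// andbT eq_sym; apply/negP => /eqP pr.
have [q q0] := prim_pos_ex; rewrite ltNge => /negP; apply.
have [qr|/ltW rq] := leP q r; first by rewrite -pr le_prim.
have t0 : tail p w r = 0.
  have := hC _ r0; rewrite -/(prim w r) -/(tail p w r) pr mule0.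
  move=> h; apply/eqP; rewrite eq_le tail_ge0 ?andbT//; last exact: ltW.
  move: h; rewrite pmule_rle0// lte_fin powR_gt0//.
rewrite (primD hw r0 rq) pr add0e.
have := tail_block_ge p0 hw r0 rq; have := tailD p hw r0 rq; rewrite t0.
have T0 : 0 <= tail p w q by apply: tail_ge0 => //; exact: ltW.
set J := integral _ _ _ => hJ; have J0 : J <= 0 by rewrite hJ leeDl.
by move=> /le_trans /(_ J0); rewrite pmule_rle0// lte_fin invr_gt0 powR_gt0.
Qed.

End positivity.

(** Chebyshev's inequality on a rectangle. *)
Lemma rect_le (u v : R -> R) (c : \bar R) (H : R * R -> \bar R) (s t : R) :
  weight u -> weight v -> 0 <= c ->
  measurable_fun Rp2 (H : mR * mR -> \bar R) -> (forall z, Rp2 z -> 0 <= H z) ->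
  (forall x y, (0 < x < s)%R -> (0 < y < t)%R -> c <= H (x, y)) ->
  c * (prim u s * prim v t) <= \int[leb2]_(z in Rp2) (H z * (prodw u v z)%:E).
Proof.
move=> hu hv c0 mH H0 hc; rewrite integral_prodw_s//.
have sR r : (`]0%R, r[%classic : set mR) `<=` @Rp R by exact: sub_itv_Rp.
have in0 x : Rp x -> 0 <= (u x)%:E * \int[leb]_(y in Rp) (H (x, y) * (v y)%:E).
  move=> xR; rewrite mule_ge0 ?weight_ge0//; apply: integral_ge0 => y yR.
  by rewrite mule_ge0 ?weight_ge0// H0.
have min := measurable_inner_s hu hv mH H0.
apply: (@le_trans _ _ (\int[leb]_(x in `]0%R, s[)
    ((u x)%:E * \int[leb]_(y in Rp) (H (x, y) * (v y)%:E)))); last first.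
  apply: ge0_subset_integral => //; exact: measurable_Rp.
have -> : c * (prim u s * prim v t) = (c * prim v t) * prim u s.
  by rewrite -muleA [prim v t * _]muleC.
have cv0 : 0 <= c * prim v t by rewrite mule_ge0// prim_ge0.
rewrite -ge0_integralZl//; last 2 first.
- exact: weightM.
- by move=> x /sR; exact: weight_ge0.
apply: ge0_le_integral => //.
- by move=> x /sR xR; rewrite mule_ge0// weight_ge0.
- by apply: measurable_funeM; exact: weightM.
- by apply: measurable_funS min => //; exact: measurable_Rp.
move=> x xs; have xR := sR _ _ xs; rewrite muleC lee_wpmul2l ?weight_ge0//.
have mHx : measurable_fun Rp ((fun y => H (x, y) * (v y)%:E) : mR -> \bar R).
  by apply: emeasurable_funM; [exact: measurable_sect2|exact: weightM].
apply: (@le_trans _ _ (\int[leb]_(y in `]0%R, t[) (H (x, y) * (v y)%:E))); last first.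
  apply: ge0_subset_integral => //; first exact: measurable_Rp.
  by move=> y yR; rewrite mule_ge0 ?weight_ge0// H0.
rewrite /prim -ge0_integralZl//; last 2 first.
- exact: weightM.
- by move=> y /sR; exact: weight_ge0.
apply: ge0_le_integral => //.
- by move=> y /sR yR; rewrite mule_ge0// weight_ge0.
- by apply: measurable_funeM; exact: weightM.
- by apply: measurable_funS mHx => //; exact: measurable_Rp.
move=> y yt; rewrite lee_wpmul2r//; first by apply: weight_ge0 => //; exact: sR yt.
by apply: hc; [move: xs|move: yt]; rewrite /= in_itv.
Qed.

(** A functional that is subadditive and homogeneous, and that lies between [M]
    and a multiple of [M], is a norm equivalent to [M] as soon as [M] vanishes
    on the null functions only. *)
Lemma norm_of_equiv (M N : (R * R -> R) -> \bar R) (C : R) : (0 < C)%R ->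
  (forall f, meas2 setT f -> 0 <= M f) ->
  (forall f, meas2 setT f -> M f <= N f) ->
  (forall f, meas2 setT f -> N f <= C%:E * M f) ->
  (forall f g, meas2 setT f -> meas2 setT g ->
    N (fun z => f z + g z)%R <= N f + N g) ->
  (forall c f, meas2 setT f -> N (fun z => c * f z)%R = `|c|%:E * N f) ->
  (forall f, meas2 setT f -> M f = 0 <-> {ae leb2, forall z, f z = 0%R}) ->
  is_norm_on [set f | meas2 setT f /\ M f < +oo] N /\
  equiv_on [set f | meas2 setT f /\ M f < +oo] N M.
Proof.
move=> C0 M0 MN NM Nadd Nsc Mz.
have Nfin f : meas2 setT f -> M f < +oo -> N f < +oo.
  move=> mf Mf; apply: le_lt_trans (NM _ mf) _.
  by apply: lte_mul_pinfty; rewrite ?lee_fin ?ltW.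
split; last first.
  have hC : (C <= Num.max C 1)%R by rewrite le_max lexx.
  have h1 : (1 <= Num.max C 1)%R by rewrite le_max lexx orbT.
  exists (Num.max C 1)%R; first exact: lt_le_trans hC.
  move=> f [mf Mf]; split.
    apply: le_trans (NM _ mf) _; apply: lee_wpmul2r; first exact: M0.
    by rewrite lee_fin.
  apply: le_trans (MN _ mf) _; rewrite -[leLHS]mul1e; apply: lee_wpmul2r.
    exact: le_trans (M0 _ mf) (MN _ mf).
  by rewrite lee_fin.
split.
- move=> f g [mf Mf] [mg Mg]; have mfg := measurable_add2 mf mg; split => //.
  apply: le_lt_trans (MN _ mfg) _; apply: le_lt_trans (Nadd _ _ mf mg) _.
  by apply: lte_add_pinfty; exact: Nfin.
- move=> c f [mf Mf]; have mcf := measurable_scale2 c mf; split => //.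
  apply: le_lt_trans (MN _ mcf) _; rewrite Nsc//.
  by apply: lte_mul_pinfty; rewrite ?lee_fin// Nfin.
- move=> f [mf Mf]; rewrite Nfin// andbT; exact: le_trans (M0 _ mf) (MN _ mf).
- move=> f [mf Mf]; rewrite -Mz//; split => h; apply/eqP; rewrite eq_le.
    by rewrite M0// andbT -h MN.
  by rewrite (le_trans (M0 _ mf) (MN _ mf)) andbT (le_trans (NM _ mf))// h mule0.
- by move=> c f [mf Mf]; exact: Nsc.
- by move=> f g [mf Mf] [mg Mg]; exact: Nadd.
Qed.

End null_functions.

(** * From B_p to the maximal functions *)

Section Bp_sufficient.
Context {R : realType}.
Local Notation mR := (measurableTypeR R).
Local Open Scope ereal_scope.

Section from_Bp.
Variables (p : R) (u v : R -> R).
Hypotheses (p1 : (1 < p)%R) (hu : weight u) (hv : weight v).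

Let p0 : (0 < p)%R. Proof. exact: lt_trans p1. Qed.

Let mRp2 := @measurable_Rp2 R.
Let mW := measurable_prodw hu hv.
Let W0 := prodw_ge0 hu hv.

Lemma Lp_norm_le (f g : R * R -> \bar R) :
  measurable_fun Rp2 (f : mR * mR -> \bar R) ->
  measurable_fun Rp2 (g : mR * mR -> \bar R) ->
  (forall z, Rp2 z -> 0 <= f z) -> (forall z, Rp2 z -> f z <= g z) ->
  Lp_norm p (prodw u v) f <= Lp_norm p (prodw u v) g.
Proof.
move=> mf mg f0 fg; apply: (lpn_le leb2 mRp2 (ltW p1) mW W0 mf mg) => z zR.
by rewrite !gee0_abs ?f0 ?fg// (le_trans (f0 _ zR)) ?fg.
Qed.

Lemma Lp_norm_pow (f : R * R -> \bar R) : (forall z, Rp2 z -> 0 <= f z) ->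
  Lp_norm p (prodw u v) f `^ p =
  \int[leb2]_(z in Rp2) (f z `^ p * (prodw u v z)%:E).
Proof.
move=> f0; rewrite [LHS](lpn_pow leb2 (ltW p1) W0 f); apply: eq_integral => z /set_mem zR.
by rewrite gee0_abs// f0.
Qed.

Lemma Lp_norm_ge0 (f : R * R -> \bar R) : 0 <= Lp_norm p (prodw u v) f.
Proof. exact: poweR_ge0. Qed.

Lemma eq_Lp_norm (f g : R * R -> \bar R) : (forall z, Rp2 z -> f z = g z) ->
  Lp_norm p (prodw u v) f = Lp_norm p (prodw u v) g.
Proof. by move=> fg; apply: (@lpn_eq _ _ _ leb2 Rp2) => z /fg ->. Qed.

Lemma S2_ge0 (h : R * R -> \bar R) z : (forall z, 0 <= h z) -> Rp2 z -> 0 <= S2 h z.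
Proof.
move=> h0; rewrite Rp2E => -[z1 z2]; apply: mule_ge0.
  by rewrite lee_fin invr_ge0 mulr_ge0// ltW.
by apply: integral_ge0 => a _; exact: integral_ge0.
Qed.

Lemma Lp_norm_S2_le : Bp p u -> Bp p v ->
  exists2 C : R, (0 < C)%R & forall h : mR * mR -> \bar R,
  measurable_fun setT h -> (forall z, 0 <= h z) -> nonincr_Rp2 h ->
  Lp_norm p (prodw u v) (S2 h) <= C%:E * Lp_norm p (prodw u v) h.
Proof.
move=> Bu Bv; have [K K0 hK] := hardy2 p0 hu hv Bu Bv.
exists (K `^ p^-1)%R; first exact: powR_gt0.
move=> h mh h0 dh.
apply: (@lpn_le_of_int _ _ _ leb2 Rp2 p _ (ltW p1) W0 K); first exact: ltW.
have -> : \int[leb2]_(z in Rp2) (`|S2 h z| `^ p * (prodw u v z)%:E) =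
    \int[leb2]_(z in Rp2) (S2 h z `^ p * (prodw u v z)%:E).
  by apply: eq_integral => z /set_mem zR; rewrite gee0_abs// S2_ge0.
have -> : \int[leb2]_(z in Rp2) (`|h z| `^ p * (prodw u v z)%:E) =
    \int[leb2]_(z in Rp2) (h z `^ p * (prodw u v z)%:E).
  by apply: eq_integral => z /set_mem zR; rewrite gee0_abs.
exact: hK.
Qed.

Local Notation M := (Lambda2_norm p (prodw u v)).
Local Notation N := (fun f => Lp_norm p (prodw u v) (maximal_yx f)).
Local Notation N2 := (fun f => Lp_norm p (prodw u v) (maximal f)).

Lemma Lambda2_norm_le_yx f : meas2 setT f -> M f <= N f.
Proof.
move=> mf; apply: Lp_norm_le.
- by apply: measurable_funTS; exact: measurable_rearr_yx.
- by apply: measurable_funTS; exact: measurable_maximal_yx.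
- by move=> z _; exact: rearr_yx_ge0.
- by move=> z zR; exact: rearr_yx_le_maximal_yx.
Qed.

Lemma yx_norm_le_maximal f : meas2 setT f -> N f <= N2 f.
Proof.
move=> mf; apply: Lp_norm_le.
- by apply: measurable_funTS; exact: measurable_maximal_yx.
- exact: measurable_maximal.
- by move=> z _; exact: maximal_yx_ge0.
- by move=> z zR; exact: maximal_yx_le_maximal.
Qed.

Hypotheses (Bu : Bp p u) (Bv : Bp p v).

Lemma maximal_norm_le : exists2 C : R, (0 < C)%R &
  forall f, meas2 setT f -> N2 f <= C%:E * M f.
Proof.
have [C C0 hC] := Lp_norm_S2_le Bu Bv; exists C => // f mf.
apply: hC; [exact: measurable_rearr_yx|exact: rearr_yx_ge0|exact: rearr_yx_nonincr].
Qed.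

Lemma maximal_equiv : equiv_on (Lambda2 p (prodw u v)) N2 M.
Proof.
have [C C0 hC] := maximal_norm_le.
have hm : (C <= Num.max C 1)%R by rewrite le_max lexx.
have h1 : (1 <= Num.max C 1)%R by rewrite le_max lexx orbT.
exists (Num.max C 1)%R; first exact: lt_le_trans hm.
move=> f [mf Mf]; split.
  apply: le_trans (hC _ mf) _; apply: lee_wpmul2r; first exact: Lp_norm_ge0.
  by rewrite lee_fin.
apply: le_trans (Lambda2_norm_le_yx mf) _.
apply: le_trans (yx_norm_le_maximal mf) _.
rewrite -[leLHS]mul1e; apply: lee_wpmul2r; first exact: Lp_norm_ge0.
by rewrite lee_fin.
Qed.

Section nontrivial.
Hypothesis hu0 : ~ {ae @leb R, forall x : R, (0 < x)%R -> u x = 0%R}.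
Hypothesis hv0 : ~ {ae @leb R, forall x : R, (0 < x)%R -> v x = 0%R}.

Lemma Lambda2_norm_eq0 f : meas2 setT f ->
  M f = 0 <-> {ae leb2, forall z, f z = 0%R}.
Proof.
move=> mf; split => h; last first.
  have -> : M f = Lp_norm p (prodw u v) (cst 0).
    apply: eq_Lp_norm => -[s t]; rewrite Rp2E/= => -[s0 t0].
    apply: (ae0_rearr mf (measurable_rearr_y1 mf t)) => //; last exact: ltW.
    by move=> x; apply: sect_supp_rearr; exact: ltW.
  rewrite /Lp_norm integral0_eq ?poweR0r ?invr_eq0 ?gt_eqF// => z _.
  by rewrite /cst abse0 poweR0r ?gt_eqF// mul0e.
apply: rearr_yx_eq0 => // s t s0 t0.
apply/eqP; rewrite eq_le rearr_yx_ge0 andbT leNgt; apply/negP => h0.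
have I0 : \int[leb2]_(z in Rp2) (rearr_yx f z `^ p * (prodw u v z)%:E) = 0.
  rewrite -Lp_norm_pow; last by move=> z _; exact: rearr_yx_ge0.
  by rewrite -/(M f) h poweR0r ?gt_eqF.
have := @rect_le R u v (rearr_yx f (s, t) `^ p) (fun z => rearr_yx f z `^ p) s t hu hv
  (poweR_ge0 _ _).
rewrite I0 => H.
have : 0 < rearr_yx f (s, t) `^ p * (prim u s * prim v t).
  apply: mule_gt0; first exact: poweR_gt0.
  by apply: mule_gt0; apply: Bp_prim_gt0 p0 _ _ _ _ _.
apply/negP; rewrite -leNgt; apply: H.
- apply: measurable_poweR_comp; apply: measurable_funTS; exact: measurable_rearr_yx.
- by move=> z _; exact: poweR_ge0.
- move=> x y /andP[x0 xs] /andP[y0 yt]; apply: le_poweR => //; first exact: rearr_yx_ge0.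
  have [d1 d2] := rearr_yx_nonincr mf.
  apply: (@le_trans _ _ (rearr_yx f (x, t))); first by apply: d1 => //; exact: ltW.
  by apply: d2 => //; exact: ltW.
Qed.

Lemma maximal_yx_norm : is_norm_on (Lambda2 p (prodw u v)) N /\
  equiv_on (Lambda2 p (prodw u v)) N M.
Proof.
have [C C0 hC] := maximal_norm_le.
have mY f : meas2 setT f -> measurable_fun Rp2 (maximal_yx f : mR * mR -> \bar R).
  by move=> mf; apply: measurable_funTS; exact: measurable_maximal_yx.
apply: (@norm_of_equiv R M N C C0).
- by move=> f _; exact: Lp_norm_ge0.
- exact: Lambda2_norm_le_yx.
- by move=> f mf; apply: le_trans (yx_norm_le_maximal mf) (hC _ mf).
- move=> f g mf mg.
  apply: (lpn_triangle leb2 mRp2 (ltW p1) mW W0 (mY _ mf) (mY _ mg) (mY _ (measurable_add2 mf mg))).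
  move=> z zR; apply: ge0_abs_le_add; [exact: maximal_yx_ge0|exact: maximal_yx_ge0|exact: maximal_yx_ge0|].
  exact: maximal_yx_triangle.
- move=> c f mf; rewrite -[in RHS](normr_id c).
  rewrite -[RHS](lpnZ leb2 mRp2 (ltW p1) mW W0 `|c|%R (mY _ mf)).
  by apply: eq_Lp_norm => z _; exact: maximal_yxZ.
- exact: Lambda2_norm_eq0.
Qed.

End nontrivial.

Lemma measurable_extend0 (f : R * R -> R) : meas2 Rp2 f -> meas2 setT (extend0 f).
Proof. by move=> mf; exact: (measurable_restrictT (f : mR * mR -> mR) mRp2).1. Qed.

Lemma extend0E (f : R * R -> R) z : Rp2 z -> extend0 f z = f z.
Proof. by move=> zR; rewrite /extend0 patchE mem_set. Qed.

Lemma extend0_ge0 (f : R * R -> R) z : (forall z, Rp2 z -> (0 <= f z)%R) ->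
  (0 <= extend0 f z)%R.
Proof. by move=> f0; rewrite /extend0 patchE; case: ifPn => // /set_mem; exact: f0. Qed.

Lemma S2_bounded : bounded_on_cone p (prodw u v) (fun f => S2 (EFin \o f)).
Proof.
have [C C0 hC] := Lp_norm_S2_le Bu Bv; exists C => // f [mf f0 d1 d2 _].
have -> : Lp_norm p (prodw u v) (EFin \o f) = Lp_norm p (prodw u v) (EFin \o extend0 f).
  by apply: eq_Lp_norm => z zR /=; rewrite extend0E.
have -> : Lp_norm p (prodw u v) (S2 (EFin \o f)) =
    Lp_norm p (prodw u v) (S2 (EFin \o extend0 f)).
  apply: eq_Lp_norm => z _; congr (_ * _); apply: eq_integral => a /set_mem/=.
  rewrite in_itv/= => /andP[a0 _]; apply: eq_integral => b /set_mem/=.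
  by rewrite in_itv/= => /andP[b0 _]; rewrite extend0E// Rp2E.
apply: hC.
- by apply/measurable_EFinP; exact: measurable_extend0.
- by move=> z; rewrite lee_fin extend0_ge0.
- split=> [s s' t s0 t0 ss|s t t' s0 t0 tt]; rewrite /= lee_fin !extend0E ?Rp2E//=.
  + by apply: d1 => //; rewrite RpE.
  + by split => //; exact: lt_le_trans ss.
  + by apply: d2 => //; rewrite RpE.
  + by split => //; exact: lt_le_trans tt.
Qed.

(** A function that exceeds the level [a] only inside ]0, t[. *)
Lemma distr_fun_le_itv (g : mR -> \bar R) (a t : R) : measurable_fun setT g -> (0 <= t)%R ->
  (forall x, (x <= 0)%R -> g x = 0) -> (0 <= a)%R ->
  (forall x, (t <= x)%R -> `|g x| <= a%:E) -> distr_fun g a <= t%:E.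
Proof.
move=> mg t0 g0 a0 h.
have := leb_itv (Interval (BRight 0%R) (BLeft t)); rewrite /=.
have -> : (if 0%:E < t%:E then t%:E - 0%:E else 0) = t%:E :> \bar R.
  rewrite lte_fin; case: ltP => tt; first by rewrite sube0.
  by congr EFin; apply/eqP; rewrite eq_le t0 tt.
move=> <-; apply: le_measure; rewrite ?inE.
- exact: measurable_superlevel.
- exact: measurable_itv.
move=> x /= ax; rewrite in_itv/=; apply/andP; split.
  rewrite ltNge; apply/negP => /g0 gx; move: ax; rewrite gx abse0 lte_fin.
  by rewrite ltNge a0.
by rewrite ltNge; apply/negP => /h; rewrite leNgt ax.
Qed.

(** On the cone of nonincreasing functions the iterated rearrangement does not
    increase the function. *)
Lemma rearr_yx_extend0_le (f : R * R -> R) : meas2 Rp2 f ->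
  (forall z, Rp2 z -> (0 <= f z)%R) ->
  (forall s s' t, Rp s -> Rp t -> (s <= s')%R -> (f (s', t) <= f (s, t))%R) ->
  (forall s t t', Rp s -> Rp t -> (t <= t')%R -> (f (s, t') <= f (s, t))%R) ->
  forall z, Rp2 z -> rearr_yx (extend0 f) z <= (f z)%:E.
Proof.
move=> mf f0 d1 d2; have mE := measurable_extend0 mf.
have y1 x t : (0 < x)%R -> (0 < t)%R -> rearr_y (extend0 f) x t <= (f (x, t))%:E.
  move=> x0 t0; apply: rearr_le; first by apply: f0; rewrite Rp2E.
  apply: distr_fun_le_itv.
  - exact: measurable_sect_y.
  - exact: ltW.
  - move=> y y0; rewrite /extend0 patchE memNset// Rp2E/= => -[_].
    by rewrite ltNge y0.
  - by apply: f0; rewrite Rp2E.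
  - move=> y ty; rewrite /= lee_fin ger0_norm ?extend0_ge0//.
    have y0 : (0 < y)%R by exact: lt_le_trans ty.
    by rewrite extend0E ?Rp2E//; apply: d2; rewrite ?RpE.
have y2 x t : (x <= 0)%R -> (0 < t)%R -> rearr_y (extend0 f) x t = 0.
  move=> x0 t0; apply: rearr0; first exact: ltW.
  rewrite /distr_fun (_ : [set _ | _] = set0) ?measure0// -subset0 => y /=.
  rewrite /extend0 patchE memNset ?normr0 ?ltxx// Rp2E/= => -[+ _].
  by rewrite ltNge x0.
move=> [s t]; rewrite Rp2E/= => -[s0 t0]; apply: rearr_le; first by apply: f0; rewrite Rp2E.
apply: distr_fun_le_itv.
- exact: measurable_rearr_y1.
- exact: ltW.
- by move=> x x0; exact: y2.
- by apply: f0; rewrite Rp2E.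
- move=> x sx; have x0 : (0 < x)%R by exact: lt_le_trans sx.
  rewrite gee0_abs; last exact: rearr_y_ge0.
  apply: le_trans (y1 _ _ x0 t0) _; rewrite lee_fin.
  by apply: d1; rewrite ?RpE.
Qed.

Lemma maximal_yx_bounded :
  bounded_on_cone p (prodw u v) (fun f => maximal_yx (extend0 f)).
Proof.
have [C C0 hC] := maximal_norm_le; exists C => // f [mf f0 d1 d2 _].
have mE := measurable_extend0 mf.
apply: le_trans (yx_norm_le_maximal mE) _; apply: le_trans (hC _ mE) _.
apply: lee_wpmul2l; first by rewrite lee_fin ltW.
apply: Lp_norm_le.
- by apply: measurable_funTS; exact: measurable_rearr_yx.
- exact/measurable_EFinP.
- by move=> z _; exact: rearr_yx_ge0.
- exact: rearr_yx_extend0_le.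
Qed.

End from_Bp.

End Bp_sufficient.

(** * From B_p to the normability of the mixed space *)

Section mixed_space.
Context {R : realType}.
Local Notation mR := (measurableTypeR R).
Local Open Scope ereal_scope.

Lemma measurable_integral_Rp (H : mR * mR -> \bar R) :
  measurable_fun (setT `*` Rp) H -> (forall z, Rp z.2 -> 0 <= H z) ->
  measurable_fun setT ((fun x => \int[leb]_(t in Rp) H (x, t)) : mR -> \bar R).
Proof.
move=> mH H0.
have mD : measurable ([set: mR] `*` (@Rp R : set mR)).
  by apply: measurableX => //; exact: measurable_Rp.
have mG := (measurable_restrictT H mD).1 mH.
have G0 z : 0 <= (H \_ (setT `*` Rp)) z.
  by rewrite patchE; case: ifPn => // /set_mem[_]; exact: H0.
have := @measurable_fun_fubini_tonelli_F _ _ _ _ _ leb _ mG G0.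
congr measurable_fun; apply/funext => x; rewrite /fubini_F [RHS]integral_mkcond.
apply: eq_integral => t _; rewrite !patchE; congr (if _ then _ else _).
by apply/idP/idP => /set_mem ht; apply/mem_set; [case: ht|split].
Qed.

Section norm1.
Variables (p : R) (w : R -> R).
Hypotheses (p1 : (1 < p)%R) (hw : weight w).

Let p0 : (0 < p)%R. Proof. exact: lt_trans p1. Qed.

(** The functional of L^p(w) on the half-line. *)
Definition norm1 (g : R -> \bar R) : \bar R := @lpn R _ mR leb Rp p w g.

Let mRp := @measurable_Rp R.
Let mw : measurable_fun Rp ((fun x => (w x)%:E) : mR -> \bar R).
Proof. exact: weightM. Qed.
Let w0 := weight_ge0 hw.

Lemma norm1_ge0 g : 0 <= norm1 g. Proof. exact: poweR_ge0. Qed.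

Lemma norm1_le (f g : mR -> \bar R) : measurable_fun setT f -> measurable_fun setT g ->
  (forall t, 0 <= f t) -> (forall t, (0 < t)%R -> f t <= g t) -> norm1 f <= norm1 g.
Proof.
move=> mf mg f0 fg.
apply: (lpn_le leb mRp (ltW p1) mw w0); [exact: measurable_funTS|exact: measurable_funTS|].
move=> t; rewrite RpE => t0; rewrite !gee0_abs ?fg//.
exact: le_trans (f0 t) (fg _ t0).
Qed.

Lemma norm1Z (c : R) (g : mR -> \bar R) : measurable_fun setT g ->
  norm1 (fun t => c%:E * g t) = `|c|%:E * norm1 g.
Proof.
by move=> mg; apply: (lpnZ leb mRp (ltW p1) mw w0); exact: measurable_funTS.
Qed.

Lemma eq_norm1 (f g : mR -> \bar R) : (forall t, (0 < t)%R -> f t = g t) ->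
  norm1 f = norm1 g.
Proof. by move=> fg; apply: lpn_eq => t; rewrite RpE => /fg ->. Qed.

Lemma norm1_triangle (f g h : mR -> \bar R) : measurable_fun setT f ->
  measurable_fun setT g -> measurable_fun setT h -> (forall t, 0 <= h t) ->
  (forall t, 0 <= f t) -> (forall t, 0 <= g t) ->
  (forall t, (0 < t)%R -> h t <= f t + g t) -> norm1 h <= norm1 f + norm1 g.
Proof.
move=> mf mg mh h0 f0 g0 hfg.
apply: (lpn_triangle leb mRp (ltW p1) mw w0); try exact: measurable_funTS.
by move=> t; rewrite RpE => t0; apply: ge0_abs_le_add => //; exact: hfg.
Qed.

Lemma norm1_pow (g : R -> \bar R) : (forall t, 0 <= g t) ->
  norm1 g `^ p = \int[leb]_(t in Rp) (g t `^ p * (w t)%:E).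
Proof.
move=> g0; rewrite [LHS](lpn_pow leb (ltW p1) w0 g); apply: eq_integral => t _.
by rewrite gee0_abs.
Qed.

Lemma norm1E (g : R -> \bar R) : (forall t, 0 <= g t) ->
  norm1 g = (\int[leb]_(t in Rp) (g t `^ p * (w t)%:E)) `^ p^-1.
Proof.
by move=> g0; congr (_ `^ _); apply: eq_integral => t _; rewrite gee0_abs.
Qed.

Lemma norm1_avg_le : Bp p w -> exists2 C : R, (0 < C)%R & forall g : mR -> \bar R,
  measurable_fun setT g -> (forall x, 0 <= g x) -> nonincr_Rp g ->
  norm1 (avg g) <= C%:E * norm1 g.
Proof.
move=> Bw; have [K K0 hK] := hardy p0 hw Bw.
exists (K `^ p^-1)%R; first exact: powR_gt0.
move=> g mg g0 dg.
have A0 t : 0 <= avg g t by exact: avg_ge0.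
rewrite !norm1E// -poweR_EFin -poweRM ?lee_fin ?(ltW K0)//; last first.
  by apply: integral_ge0 => t tR; rewrite mule_ge0 ?poweR_ge0 ?w0.
apply: le_poweR; [by rewrite invr_gt0| |exact: hK].
by apply: integral_ge0 => t tR; rewrite mule_ge0 ?poweR_ge0 ?w0.
Qed.

Lemma norm1_eq0 (g : mR -> \bar R) : measurable_fun setT g -> (forall x, 0 <= g x) ->
  nonincr_Rp g -> (forall r, (0 < r)%R -> 0 < prim w r) ->
  norm1 g = 0 -> forall t, (0 < t)%R -> g t = 0.
Proof.
move=> mg g0 dg wpos h t t0.
apply/eqP; rewrite eq_le g0 andbT leNgt; apply/negP => gt0.
have := norm1_pow g0; rewrite h poweR0r ?gt_eqF// => /esym I0.
have : 0 < g t `^ p * prim w t by rewrite mule_gt0 ?poweR_gt0 ?wpos.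
apply/negP; rewrite -leNgt -I0.
have sR : (`]0%R, t[%classic : set mR) `<=` @Rp R by exact: sub_itv_Rp.
have mgw : measurable_fun Rp ((fun x => g x `^ p * (w x)%:E) : mR -> \bar R).
  apply: emeasurable_funM => //; apply: measurable_funTS.
  exact: measurable_poweR_comp.
apply: (@le_trans _ _ (\int[leb]_(x in `]0%R, t[) (g x `^ p * (w x)%:E))); last first.
  apply: ge0_subset_integral => //.
  by move=> x xR; rewrite mule_ge0 ?poweR_ge0 ?w0.
rewrite -ge0_integralZl//; last 3 first.
- exact: weightM.
- by move=> x /sR; exact: w0.
- exact: poweR_ge0.
apply: ge0_le_integral => //.
- by move=> x /sR xR; rewrite mule_ge0 ?poweR_ge0 ?w0.
- by apply: measurable_funeM; exact: weightM.
- by apply: measurable_funS mgw.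
move=> x xt; apply: lee_wpmul2r; first by apply: w0; exact: sR.
apply: le_poweR => //; apply: dg; move: xt; rewrite /= in_itv/= => /andP[x0 xt] //.
exact: ltW.
Qed.

Lemma norm1_0 (g : mR -> \bar R) : (forall t, (0 < t)%R -> g t = 0) -> norm1 g = 0.
Proof.
move=> g0; rewrite /norm1 /lpn integral0_eq ?poweR0r ?invr_eq0 ?gt_eqF// => t.
by rewrite RpE => /g0 ->; rewrite abse0 poweR0r ?gt_eqF// mul0e.
Qed.

Lemma measurable_norm1_param (F : mR * mR -> \bar R) : measurable_fun setT F ->
  measurable_fun setT ((fun x => norm1 (fun t => F (x, t))) : mR -> \bar R).
Proof.
move=> mF; apply: measurable_poweR_comp.
apply: (@measurable_integral_Rp (fun z => `|F z| `^ p * (w z.2)%:E)); last first.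
  by move=> z zR; rewrite mule_ge0 ?poweR_ge0 ?w0.
apply: emeasurable_funM.
  apply: measurable_funTS; apply: measurable_poweR_comp; exact: measurableT_comp.
apply: (@measurable_comp _ _ _ _ _ _ Rp (fun x : mR => (w x)%:E)) => //.
- by move=> _ [z [_ ?] <-].
- by apply: measurable_funTS; exact: measurable_snd.
Qed.

End norm1.

Lemma ge0_abs_le (a b : \bar R) : 0 <= a -> a <= b -> `|a| <= `|b|.
Proof. by move=> a0 ab; rewrite !gee0_abs// (le_trans a0). Qed.

Section mixed.
Variables (p : R) (u v : R -> R).
Hypotheses (p1 : (1 < p)%R) (hu : weight u) (hv : weight v).

Let p0 : (0 < p)%R. Proof. exact: lt_trans p1. Qed.

(** The norm in L^p(v) of the rearrangement of the section at [x]. *)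
Definition mix0 (f : R * R -> R) (x : R) := norm1 p v (rearr_y f x).

(** The same with the maximal function of the section, which makes it
    subadditive in [f]. *)
Definition mix1 (f : R * R -> R) (x : R) := norm1 p v (avg (rearr_y f x)).

(** The norm that replaces the functional of the mixed space: the
    rearrangement is averaged in both variables. *)
Definition mixN (f : R * R -> R) := norm1 p u (avg (rearr (mix1 f))).

Lemma measurable_mix0 f : meas2 setT f -> measurable_fun setT (mix0 f : mR -> \bar R).
Proof.
move=> mf; exact: (measurable_norm1_param p hv (measurable_rearr_y mf)).
Qed.

Lemma measurable_mix1 f : meas2 setT f -> measurable_fun setT (mix1 f : mR -> \bar R).
Proof.
move=> mf; exact: (measurable_norm1_param p hv (measurable_avg_y mf)).
Qed.

Lemma measurable_avg_y2 f x : meas2 setT f ->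
  measurable_fun setT (avg (rearr_y f x) : mR -> \bar R).
Proof.
move=> mf; apply: measurable_avg; [exact: measurable_rearr_y2|exact: rearr_y_ge0].
Qed.

Lemma mixed_normE f : meas2 setT f -> mixed_norm p u v f = norm1 p u (rearr (mix0 f)).
Proof.
move=> mf; rewrite norm1E; last by move=> t; exact: rearr_ge0.
congr (_ `^ _); apply: eq_integral => s _; congr (_ * _).
rewrite -rearr_poweR//; last exact: measurable_mix0.
congr (rearr _ _); apply/funext => x.
rewrite gee0_abs; last exact: norm1_ge0.
by rewrite norm1_pow// => t; exact: rearr_y_ge0.
Qed.

Lemma mix0_le_mix1 f x : meas2 setT f -> mix0 f x <= mix1 f x.
Proof.
move=> mf; apply: norm1_le => //.
- exact: measurable_rearr_y2.
- exact: measurable_avg_y2.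
- exact: rearr_y_ge0.
- move=> t t0; apply: le_avg => //; [exact: measurable_rearr_y2|exact: rearr_y_ge0|].
  exact: rearr_y_nonincr.
Qed.

Lemma rearr_mix_nonincr (g : mR -> \bar R) : nonincr_Rp (rearr g).
Proof. by move=> s t _; exact: rearr_nonincreasing. Qed.

Lemma mixed_norm_le f : meas2 setT f -> mixed_norm p u v f <= mixN f.
Proof.
move=> mf; rewrite mixed_normE//.
have m0 := measurable_mix0 mf; have m1 := measurable_mix1 mf.
apply: norm1_le => //.
- exact: measurable_rearr.
- by apply: measurable_avg; [exact: measurable_rearr|exact: rearr_ge0].
- exact: rearr_ge0.
move=> s s0; apply: (@le_trans _ _ (rearr (mix1 f) s)).
  apply: (le_rearr s m0 m1) => x; apply: ge0_abs_le; first exact: norm1_ge0.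
  exact: mix0_le_mix1.
exact: (le_avg (measurable_rearr m1) (rearr_ge0 _) (@rearr_mix_nonincr _) s0).
Qed.

Hypotheses (Bu : Bp p u) (Bv : Bp p v).

Lemma mixN_le : exists2 C : R, (0 < C)%R &
  forall f, meas2 setT f -> mixN f <= C%:E * mixed_norm p u v f.
Proof.
have [A A0 hA] := norm1_avg_le p1 hu Bu; have [B B0 hB] := norm1_avg_le p1 hv Bv.
exists (A * B)%R; first exact: mulr_gt0.
move=> f mf; rewrite mixed_normE//.
have m0 := measurable_mix0 mf; have m1 := measurable_mix1 mf.
have mr0 := measurable_rearr m0; have mr1 := measurable_rearr m1.
apply: le_trans (hA _ mr1 (rearr_ge0 _) (@rearr_mix_nonincr _)) _.
rewrite EFinM -muleA; apply: lee_wpmul2l; first by rewrite lee_fin ltW.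
rewrite -[B](ger0_norm (ltW B0)) -(norm1Z p1 hu B mr0).
apply: (norm1_le p1 hu mr1 (measurable_funeM B%:E mr0) (rearr_ge0 _)) => s s0.
apply: (@le_trans _ _ (rearr (fun x => B%:E * mix0 f x) s)); last first.
  by rewrite (rearrZ B m0 (ltW s0)) (ger0_norm (ltW B0)).
apply: (le_rearr s m1 (measurable_funeM B%:E m0)) => x.
apply: ge0_abs_le; first exact: norm1_ge0.
exact: (hB _ (measurable_rearr_y2 mf x) (rearr_y_ge0 f x) (@rearr_y_nonincr _ f x)).
Qed.

Lemma mix1_triangle f g x : meas2 setT f -> meas2 setT g ->
  mix1 (fun z => f z + g z)%R x <= mix1 f x + mix1 g x.
Proof.
move=> mf mg; have mfg := measurable_add2 mf mg.
apply: (norm1_triangle p1 hv (measurable_avg_y2 x mf) (measurable_avg_y2 x mg)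
  (measurable_avg_y2 x mfg) (avg_y_ge0 _ x) (avg_y_ge0 _ x) (avg_y_ge0 _ x)) => t t0.
apply: (avg_rearr_subadd t0 (measurable_sect_y mf x) (measurable_sect_y mg x)
  (measurable_sect_y mfg x)) => y.
rewrite /= lee_fin; exact: ler_normD.
Qed.

Lemma mixN_triangle f g : meas2 setT f -> meas2 setT g ->
  mixN (fun z => f z + g z)%R <= mixN f + mixN g.
Proof.
move=> mf mg; have mfg := measurable_add2 mf mg.
have mA h : meas2 setT h -> measurable_fun setT (avg (rearr (mix1 h)) : mR -> \bar R).
  move=> mh; apply: measurable_avg; last exact: rearr_ge0.
  by apply: measurable_rearr; exact: measurable_mix1.
have A0 h t : 0 <= avg (rearr (mix1 h)) t by apply: avg_ge0; exact: rearr_ge0.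
apply: (norm1_triangle p1 hu (mA _ mf) (mA _ mg) (mA _ mfg) (A0 _) (A0 _) (A0 _)) => t t0.
apply: (avg_rearr_subadd t0 (measurable_mix1 mf) (measurable_mix1 mg) (measurable_mix1 mfg)) => x.
apply: ge0_abs_le_add; [exact: norm1_ge0|exact: norm1_ge0|exact: norm1_ge0|].
exact: mix1_triangle.
Qed.

Lemma mixNZ c f : meas2 setT f -> mixN (fun z => c * f z)%R = `|c|%:E * mixN f.
Proof.
move=> mf; have m1 := measurable_mix1 mf.
have mr := measurable_rearr m1.
have mA : measurable_fun setT (avg (rearr (mix1 f)) : mR -> \bar R).
  by apply: measurable_avg => //; exact: rearr_ge0.
have E x : mix1 (fun z => c * f z)%R x = `|c|%:E * mix1 f x.
  rewrite -[X in X%:E]normr_id -[RHS](norm1Z p1 hv `|c|%R (measurable_avg_y2 x mf)).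
  by apply: eq_norm1 => t _; exact: avg_rearr_yZ.
rewrite -[X in X%:E]normr_id -[RHS](norm1Z p1 hu `|c|%R mA).
apply: eq_norm1 => s s0.
rewrite -(avgZ s mr (rearr_ge0 _))//; apply: eq_avg => b /andP[b0 _].
rewrite -[X in X%:E]normr_id -(rearrZ `|c|%R m1 (ltW b0)).
by congr (rearr _ _); apply/funext => x; rewrite E.
Qed.

Section nontrivial.
Hypothesis hu0 : ~ {ae @leb R, forall x : R, (0 < x)%R -> u x = 0%R}.
Hypothesis hv0 : ~ {ae @leb R, forall x : R, (0 < x)%R -> v x = 0%R}.

Lemma mixed_norm_eq0 f : meas2 setT f ->
  mixed_norm p u v f = 0 <-> {ae leb2, forall z, f z = 0%R}.
Proof.
move=> mf; rewrite mixed_normE//; have m0 := measurable_mix0 mf.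
split=> h; last first.
  apply: norm1_0 => // s s0; apply: (ae0_rearr mf m0) => //; last exact: ltW.
  move=> x hx; apply: norm1_0 => // t t0; apply: sect_supp_rearr => //; exact: ltW.
apply/(ae0P mf); apply/eqP; rewrite eq_le distr_fun_ge0 andbT.
have r0 := @norm1_eq0 p u p1 hu _ (measurable_rearr m0) (rearr_ge0 _) (@rearr_mix_nonincr _)
  (fun r r0 => Bp_prim_gt0 p0 hu hu0 Bu r0) h.
rewrite -(distr0_rearr m0 r0); apply: le_distr_fun => //.
  exact: measurable_sect_supp.
move=> x; rewrite !lt_neqAle !abse_ge0 !andbT ![0 == _]eq_sym !abse_eq0.
apply: contraNN => /eqP hx; apply/eqP; apply: (rearr_sect_supp mf).
exact: (@norm1_eq0 p v p1 hv _ (measurable_rearr_y2 mf x) (rearr_y_ge0 f x)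
  (@rearr_y_nonincr _ f x) (fun r r0 => Bp_prim_gt0 p0 hv hv0 Bv r0) hx).
Qed.

Lemma mixed_normable : normable (mixed_Lambda p u v) (mixed_norm p u v).
Proof.
have [C C0 hC] := mixN_le.
have [h1 h2] := @norm_of_equiv R (mixed_norm p u v) mixN C C0
  (fun _ _ => poweR_ge0 _ _) mixed_norm_le hC mixN_triangle mixNZ mixed_norm_eq0.
by exists mixN.
Qed.

End nontrivial.
End mixed.

End mixed_space.

(** * From bounded operators to B_p *)

Section operators_to_Bp.
Context {R : realType}.
Local Notation mR := (measurableTypeR R).
Local Open Scope ereal_scope.

Lemma integral_indic_prim (w : R -> R) (r : R) :
  \int[leb]_(x in Rp) ((\1_(`]0%R, r[%classic : set R) x)%:E * (w x)%:E) = prim w r.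
Proof.
rewrite /prim; have -> : `]0%R, r[%classic = Rp `&` `]0%R, r[%classic :> set R.
  by apply/esym/setIidr; exact: sub_itv_Rp.
rewrite integral_mkcondr; apply: eq_integral => x /set_mem xR.
rewrite patchE indicE in_setI (mem_set xR)/=.
by case: ifP => _; rewrite ?mul1e ?mul0e.
Qed.

Lemma measurable_indic_itv (D : set mR) (i : interval R) :
  measurable_fun D ((fun x => (\1_([set` i] : set R) x)%:E) : mR -> \bar R).
Proof. by apply/measurable_EFinP; apply: measurable_indic; exact: measurable_itv. Qed.

Lemma indic_ge0 (A : set R) x : 0 <= (\1_A x)%:E :> \bar R.
Proof. by rewrite lee_fin indicE ler0n. Qed.

Lemma integral_prod_split (u v : R -> R) (a b : R -> \bar R) :
  weight u -> weight v ->
  measurable_fun Rp (a : mR -> \bar R) -> measurable_fun Rp (b : mR -> \bar R) ->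
  (forall x, Rp x -> 0 <= a x) -> (forall x, Rp x -> 0 <= b x) ->
  \int[leb2]_(z in Rp2) (a z.1 * b z.2 * (prodw u v z)%:E) =
  (\int[leb]_(s in Rp) (a s * (u s)%:E)) * (\int[leb]_(t in Rp) (b t * (v t)%:E)).
Proof.
move=> hu hv ma mb a0 b0.
have mRp := @measurable_Rp R.
have mw w : weight w -> measurable_fun Rp ((fun x => (w x)%:E) : mR -> \bar R).
  by move=> hw; exact: weightM.
have ma1 : measurable_fun Rp2 ((fun z => a z.1) : mR * mR -> \bar R).
  apply: (measurable_comp mRp _ ma); first by move=> _ [z [? _] <-].
  by apply: measurable_funTS; exact: measurable_fst.
have mb2 : measurable_fun Rp2 ((fun z => b z.2) : mR * mR -> \bar R).
  apply: (measurable_comp mRp _ mb); first by move=> _ [z [_ ?] <-].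
  by apply: measurable_funTS; exact: measurable_snd.
rewrite (@integral_prodw_s R u v hu hv (fun z => a z.1 * b z.2)); last 2 first.
- exact: emeasurable_funM.
- by move=> z [z1 z2]; rewrite mule_ge0 ?a0 ?b0.
set Ib := \int[leb]_(t in Rp) (b t * (v t)%:E).
have Ib0 : 0 <= Ib by apply: integral_ge0 => t tR; rewrite mule_ge0 ?b0 ?weight_ge0.
rewrite -ge0_integralZr//; last 2 first.
- by apply: emeasurable_funM => //; exact: mw.
- by move=> s sR; rewrite mule_ge0 ?a0 ?weight_ge0.
apply: eq_integral => s /set_mem sR /=.
have -> : \int[leb]_(t in Rp) (a s * b t * (v t)%:E) = a s * Ib.
  rewrite -ge0_integralZl//.
  - by apply: eq_integral => t _; rewrite muleA.
  - by apply: emeasurable_funM => //; exact: mw.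
  - by move=> t tR; rewrite mule_ge0 ?b0 ?weight_ge0.
  - exact: a0.
by rewrite muleA [(u s)%:E * _]muleC.
Qed.

Lemma rearr_ge_itv (g : mR -> \bar R) (c : \bar R) (q t : R) :
  measurable_fun setT g -> (forall x, (0 < x < q)%R -> c <= `|g x|) -> (0 < q)%R ->
  (t < q)%R -> c <= rearr g t.
Proof.
move=> mg h q0 tq; apply: ge0_le_lt; first exact: rearr_ge0.
move=> a a0 ac; rewrite rearr_gt//.
apply: (@lt_le_trans _ _ (leb (`]0%R, q[%classic : set mR))).
  by rewrite leb_itv/= lte_fin q0 oppr0 adde0 lte_fin.
apply: le_measure; rewrite ?inE.
- exact: measurable_itv.
- exact: measurable_superlevel.
- by move=> x /=; rewrite in_itv/= => /h; exact: lt_le_trans.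
Qed.

Lemma avg_ge_itv (g : mR -> \bar R) (c : \bar R) (m t : R) :
  measurable_fun setT g -> (forall x, 0 <= g x) -> 0 <= c -> (0 < m)%R -> (m <= t)%R ->
  (forall x, (0 < x < m)%R -> c <= g x) -> (m / t)%:E * c <= avg g t.
Proof.
move=> mg g0 c0 m0 mt h; have t0 : (0 < t)%R by exact: lt_le_trans mt.
rewrite /avg [(m / t)%R]mulrC EFinM -muleA; apply: lee_wpmul2l.
  by rewrite lee_fin invr_ge0 ltW.
apply: (@le_trans _ _ (\int[leb]_(x in `]0%R, m[) g x)); last first.
  apply: ge0_subset_integral => //; first exact: measurable_funTS.
  by apply: subset_itvl; rewrite bnd_simp.
apply: (@le_trans _ _ (\int[leb]_(x in `]0%R, m[) cst c x)).
  by rewrite integral_cst// leb_itv/= lte_fin m0 oppr0 adde0 muleC.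
by apply: ge0_le_integral => //; exact: measurable_funTS.
Qed.

(** The indicator function of a rectangle with a corner at the origin. *)
Definition rect (r q : R) : R * R -> R :=
  fun z => (\1_(`]0%R, r[%classic : set R) z.1 * \1_(`]0%R, q[%classic : set R) z.2)%R.

Section rect.
Variables (r q : R).
Hypotheses (r0 : (0 < r)%R) (q0 : (0 < q)%R).

Lemma measurable_rect : meas2 setT (rect r q).
Proof.
apply: measurable_funM.
  apply: (@measurableT_comp _ _ _ _ _ _ (\1_(`]0%R, r[%classic : set R) : mR -> mR)).
    by apply: measurable_indic; exact: measurable_itv.
  exact: measurable_fst.
apply: (@measurableT_comp _ _ _ _ _ _ (\1_(`]0%R, q[%classic : set R) : mR -> mR)).
  by apply: measurable_indic; exact: measurable_itv.
exact: measurable_snd.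
Qed.

Lemma rect_ge0 z : (0 <= rect r q z)%R.
Proof. by rewrite /rect mulr_ge0// indicE ler0n. Qed.

Lemma rect1 x y : (0 < x < r)%R -> (0 < y < q)%R -> rect r q (x, y) = 1%R.
Proof.
by move=> hx hy; rewrite /rect/= !indicE !mem_set ?mulr1//= in_itv.
Qed.

Lemma indic_nonincr (m s t : R) : (0 < s)%R -> (s <= t)%R ->
  (\1_(`]0%R, m[%classic : set R) t <= \1_(`]0%R, m[%classic : set R) s :> R)%R.
Proof.
move=> s0 st; rewrite !indicE ler_nat; case: (boolP (t \in _)) => // /set_mem/=.
rewrite in_itv/= => /andP[_ tm]; rewrite mem_set//= in_itv/= s0/=.
exact: le_lt_trans tm.
Qed.

Lemma rect_nonincr1 s s' t : Rp s -> Rp t -> (s <= s')%R ->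
  (rect r q (s', t) <= rect r q (s, t))%R.
Proof.
rewrite !RpE => s0 t0 ss; rewrite /rect/=; apply: ler_wpM2r; first by rewrite indicE ler0n.
exact: indic_nonincr.
Qed.

Lemma rect_nonincr2 s t t' : Rp s -> Rp t -> (t <= t')%R ->
  (rect r q (s, t') <= rect r q (s, t))%R.
Proof.
rewrite !RpE => s0 t0 tt; rewrite /rect/=; apply: ler_wpM2l; first by rewrite indicE ler0n.
exact: indic_nonincr.
Qed.

Lemma extend0_rect : extend0 (rect r q) = rect r q.
Proof.
apply/funext => -[x y]; rewrite /extend0 patchE; case: ifPn => // /negP xy.
rewrite /rect/= !indicE; case: (boolP (x \in _)) => [/set_mem/=|_]; last by rewrite mul0r.
rewrite in_itv/= => /andP[x0 _]; case: (boolP (y \in _)) => [/set_mem/=|_]; last by rewrite mulr0.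
rewrite in_itv/= => /andP[y0 _]; exfalso; apply: xy; apply/mem_set.
by rewrite Rp2E.
Qed.

Lemma rect_pow_int (p : R) (u v : R -> R) : (0 < p)%R -> weight u -> weight v ->
  \int[leb2]_(z in Rp2) ((EFin \o rect r q) z `^ p * (prodw u v z)%:E) =
  prim u r * prim v q.
Proof.
move=> p0 hu hv.
have i0 := indic_ge0.
rewrite -(integral_indic_prim u r) -(integral_indic_prim v q).
rewrite -integral_prod_split//; try exact: measurable_indic_itv.
apply: eq_integral => z _; congr (_ * _).
rewrite /rect/= !indicE -!EFinM; congr EFin.
by case: (z.1 \in _); case: (z.2 \in _); rewrite ?mulr1 ?mulr0 ?mul0r ?powR1 ?powR0 ?gt_eqF.
Qed.

Lemma rect_Lp_dec (p : R) (u v : R -> R) : (0 < p)%R -> weight u -> weight v ->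
  Lp_dec p (prodw u v) (rect r q).
Proof.
move=> p0 hu hv; split.
- by apply: measurable_funTS; exact: measurable_rect.
- by move=> z _; exact: rect_ge0.
- exact: rect_nonincr1.
- exact: rect_nonincr2.
- apply: poweR_lty.
  have -> : \int[leb2]_(z in Rp2) (`|(EFin \o rect r q) z| `^ p * (prodw u v z)%:E) =
     prim u r * prim v q.
    rewrite -(rect_pow_int p0 hu hv); apply: eq_integral => z _.
    by rewrite gee0_abs//= lee_fin rect_ge0.
  by rewrite -(fineK (prim_fin hu r)) -(fineK (prim_fin hv q)) -EFinM ltry.
Qed.

Lemma maximal_yx_rect_ge s t : (0 < s)%R -> (0 < t)%R ->
  ((Num.min r s / s) * (Num.min q t / t))%:E <= maximal_yx (rect r q) (s, t).
Proof.
move=> s0 t0; have mrect := measurable_rect.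
have mqt : (0 < Num.min q t)%R by rewrite lt_min q0.
have mrs : (0 < Num.min r s)%R by rewrite lt_min r0.
have y1 x b : (0 < x < r)%R -> (0 < b < q)%R -> 1 <= rearr_y (rect r q) x b.
  move=> hx /andP[b0 bq]; apply: (rearr_ge_itv (measurable_sect_y mrect x) _ q0 bq) => y hy.
  by rewrite rect1//= normr1.
have a1 x : (0 < x < r)%R -> (Num.min q t / t)%:E <= avg (rearr_y (rect r q) x) t.
  move=> hx; rewrite -[leLHS]mule1.
  apply: (avg_ge_itv (measurable_rearr_y2 mrect x) (rearr_y_ge0 _ x) lee01 mqt).
    by rewrite ge_min lexx orbT.
  move=> b /andP[b0]; rewrite lt_min => /andP[bq _]; apply: y1 => //; exact/andP.
have k0 : 0 <= (Num.min q t / t)%:E by rewrite lee_fin divr_ge0 ?ltW.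
rewrite maximal_yxE EFinM.
have mA := measurable_avg_y1 mrect t.
apply: (avg_ge_itv (measurable_rearr mA) (rearr_ge0 _) k0 mrs).
  by rewrite ge_min lexx orbT.
move=> a /andP[a0]; rewrite lt_min => /andP[ar _].
apply: (rearr_ge_itv mA _ r0 ar) => x hx.
by apply: le_trans (a1 _ hx) _; rewrite gee0_abs//; exact: avg_y_ge0.
Qed.

End rect.

Section test.
Variables (p : R) (u v : R -> R).
Hypotheses (p1 : (1 < p)%R) (hu : weight u) (hv : weight v).
Hypothesis hu0 : ~ {ae @leb R, forall x : R, (0 < x)%R -> u x = 0%R}.
Hypothesis hv0 : ~ {ae @leb R, forall x : R, (0 < x)%R -> v x = 0%R}.

Let p0 : (0 < p)%R. Proof. exact: lt_trans p1. Qed.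

(** The left side of the B_p condition, as an integral over the half-line. *)
Lemma tail_indic (w : R -> R) r : weight w -> (0 < r)%R ->
  (r `^ p)%:E * tail p w r =
  \int[leb]_(x in Rp) (((r / x) `^ p)%:E * (\1_(`]r, +oo[%classic : set R) x)%:E * (w x)%:E).
Proof.
move=> hw r0.
have sR : `]r, +oo[%classic `<=` @Rp R by apply: sub_itvy_Rp; exact: ltW.
rewrite /tail -(@ge0_integralZl_EFin _ _ _ leb _ (measurable_itv _)).
- have {1}-> : `]r, +oo[%classic = Rp `&` `]r, +oo[%classic :> set R.
    by apply/esym/setIidr.
  rewrite integral_mkcondr; apply: eq_integral => x /set_mem; rewrite RpE => x0.
  rewrite patchE indicE; case: (boolP (x \in _)) => _; last by rewrite mule0 mul0e.
  rewrite mule1 -!EFinM; congr EFin; rewrite powRM ?invr_ge0//; try exact: ltW.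
  by rewrite -(powR_inv1 (ltW x0)) -powRrM mulN1r powRN mulrAC mulrA.
- by move=> x /sR; exact: tail_integrand_ge0.
- exact: measurable_tail.
- exact: powR_ge0.
Qed.

Lemma measurable_tail_indic (r : R) : (0 < r)%R -> measurable_fun Rp
  ((fun x => ((r / x) `^ p)%:E * (\1_(`]r, +oo[%classic : set R) x)%:E) : mR -> \bar R).
Proof.
move=> r0; apply: emeasurable_funM; last exact: measurable_indic_itv.
apply/measurable_EFinP; apply: measurable_funTS.
apply: (measurableT_comp (measurable_powR p)); apply: measurable_funM => //.
exact: measurable_inv.
Qed.

Let pw0 (r x : R) : 0 <= ((r / x) `^ p)%:E * (\1_(`]r, +oo[%classic : set R) x)%:E.
Proof. by rewrite mule_ge0 ?indic_ge0// lee_fin powR_ge0. Qed.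

(** If the images of the rectangles are as large as their maximal functions
    and are bounded in L^p, both weights are in B_p.  To get the condition for
    one weight, the integral is restricted to the side of a fixed rectangle in
    the other variable. *)
Lemma Bp_of_test (C : R) (T : R -> R -> R * R -> \bar R) : (0 < C)%R ->
  (forall r q, (0 < r)%R -> (0 < q)%R ->
    measurable_fun Rp2 (T r q : mR * mR -> \bar R)) ->
  (forall r q z, (0 < r)%R -> (0 < q)%R -> Rp2 z -> 0 <= T r q z) ->
  (forall r q s t, (0 < r)%R -> (0 < q)%R -> (0 < s)%R -> (0 < t)%R ->
    ((Num.min r s / s) * (Num.min q t / t))%:E <= T r q (s, t)) ->
  (forall r q, (0 < r)%R -> (0 < q)%R ->
    \int[leb2]_(z in Rp2) (T r q z `^ p * (prodw u v z)%:E) <=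
    C%:E * (prim u r * prim v q)) ->
  Bp p u /\ Bp p v.
Proof.
move=> C0 mT T0 T1 T2.
have i0 := indic_ge0.
have mTp r q : (0 < r)%R -> (0 < q)%R ->
    measurable_fun Rp2 ((fun z => T r q z `^ p * (prodw u v z)%:E) : mR * mR -> \bar R).
  move=> r0 q0; apply: emeasurable_funM; last exact: measurable_prodw.
  by apply: measurable_poweR_comp; exact: mT.
have mprod (a b : R -> \bar R) : measurable_fun Rp (a : mR -> \bar R) ->
    measurable_fun Rp (b : mR -> \bar R) ->
    measurable_fun Rp2 ((fun z => a z.1 * b z.2 * (prodw u v z)%:E) : mR * mR -> \bar R).
  move=> ma mb; apply: emeasurable_funM; last exact: measurable_prodw.
  apply: emeasurable_funM.
    apply: (measurable_comp (@measurable_Rp R) _ ma); first by move=> _ [z [? _] <-].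
    by apply: measurable_funTS; exact: measurable_fst.
  apply: (measurable_comp (@measurable_Rp R) _ mb); first by move=> _ [z [_ ?] <-].
  by apply: measurable_funTS; exact: measurable_snd.
have low (a b : R -> \bar R) r q : (0 < r)%R -> (0 < q)%R ->
    measurable_fun Rp (a : mR -> \bar R) -> measurable_fun Rp (b : mR -> \bar R) ->
    (forall x, 0 <= a x) -> (forall x, 0 <= b x) ->
    (forall s t, (0 < s)%R -> (0 < t)%R -> a s * b t <= T r q (s, t) `^ p) ->
    (\int[leb]_(s in Rp) (a s * (u s)%:E)) * (\int[leb]_(t in Rp) (b t * (v t)%:E)) <=
    C%:E * (prim u r * prim v q).
  move=> r0 q0 ma mb a0 b0 hab; rewrite -(integral_prod_split hu hv ma mb)//.
  apply: le_trans (T2 _ _ r0 q0); apply: ge0_le_integral => //.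
  - exact: measurable_Rp2.
  - by move=> z zR; rewrite !mule_ge0 ?a0 ?b0 ?prodw_ge0.
  - exact: mprod.
  - exact: mTp.
  move=> z zR; apply: lee_wpmul2r; first exact: prodw_ge0.
  by case: z zR => s t; rewrite Rp2E/= => -[s0 t0]; exact: hab.
(* the primitive of the other weight is positive and finite *)
have cancel (x y : \bar R) (k : R) : 0 < k%:E -> x * k%:E <= C%:E * (y * k%:E) -> x <= C%:E * y.
  by move=> k0; rewrite muleA lee_pmul2r.
split.
- have [q q0 vq] := prim_pos_ex hv hv0.
  exists C => // r r0; rewrite -/(tail p u r) -/(prim u r).
  apply: (cancel _ _ (fine (prim v q))); rewrite fineK ?prim_fin//.
  rewrite tail_indic// -{1}(integral_indic_prim v q).
  apply: low => //; first exact: measurable_tail_indic.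
    exact: measurable_indic_itv.
  move=> s t s0 t0; rewrite !indicE.
  case: (boolP (s \in _)) => [/set_mem/=|_]; last by rewrite mule0 mul0e poweR_ge0.
  rewrite in_itv/= andbT => rs.
  case: (boolP (t \in _)) => [/set_mem/=|_]; last by rewrite mule0 poweR_ge0.
  rewrite in_itv/= t0/= => tq; rewrite !mule1 -poweR_EFin; apply: le_poweR => //.
    by rewrite lee_fin divr_ge0// ltW.
  apply: le_trans (T1 r q s t r0 q0 s0 t0).
  rewrite lee_fin (min_l (ltW rs)) (min_r (ltW tq)) divff ?gt_eqF// mulr1//.
- have [q q0 uq] := prim_pos_ex hu hu0.
  exists C => // r r0; rewrite -/(tail p v r) -/(prim v r).
  apply: (cancel _ _ (fine (prim u q))); rewrite fineK ?prim_fin//.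
  rewrite tail_indic// -{1}(integral_indic_prim u q) muleC [prim v r * _]muleC.
  apply: low => //; last 2 first.
  + exact: measurable_tail_indic.
  + move=> s t s0 t0; rewrite !indicE.
    case: (boolP (s \in _)) => [/set_mem/=|_]; last by rewrite mul0e poweR_ge0.
    rewrite in_itv/= s0/= => sq.
    case: (boolP (t \in _)) => [/set_mem/=|_]; last by rewrite !mule0 poweR_ge0.
    rewrite in_itv/= andbT => rt; rewrite !mule1 mul1e -poweR_EFin; apply: le_poweR => //.
      by rewrite lee_fin divr_ge0// ltW.
    apply: le_trans (T1 q r s t q0 r0 s0 t0).
    by rewrite lee_fin (min_l (ltW rt)) (min_r (ltW sq)) divff ?gt_eqF// mul1r.
  + exact: measurable_indic_itv.
Qed.

Lemma Lp_rect_pow_le (C : R) (T : R * R -> \bar R) r q : (0 < C)%R -> (forall z, Rp2 z -> 0 <= T z) ->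
  Lp_norm p (prodw u v) T <= C%:E * Lp_norm p (prodw u v) (EFin \o rect r q) ->
  \int[leb2]_(z in Rp2) (T z `^ p * (prodw u v z)%:E) <=
  (C `^ p)%:E * (prim u r * prim v q).
Proof.
move=> C0 T0 h; rewrite -(Lp_norm_pow p1 hu hv T0).
apply: le_trans (le_poweR p0 (Lp_norm_ge0 _ _ _ _) h) _.
rewrite poweRM ?Lp_norm_ge0 ?lee_fin ?(ltW C0)// poweR_EFin.
rewrite (Lp_norm_pow p1 hu hv); last by move=> z _; rewrite lee_fin rect_ge0.
by rewrite rect_pow_int.
Qed.

Lemma rearr_yx_rect_le r q z : Rp2 z -> rearr_yx (rect r q) z <= (rect r q z)%:E.
Proof.
move=> zR; rewrite -{1}(extend0_rect r q).
apply: (rearr_yx_extend0_le _ _ (@rect_nonincr1 r q) (@rect_nonincr2 r q) zR).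
- by apply: measurable_funTS; exact: measurable_rect.
- by move=> ? _; exact: rect_ge0.
Qed.

Lemma Lambda2_norm_rect r q : Lambda2_norm p (prodw u v) (rect r q) <=
  Lp_norm p (prodw u v) (EFin \o rect r q).
Proof.
apply: Lp_norm_le => //.
- by apply: measurable_funTS; apply: measurable_rearr_yx; exact: measurable_rect.
- by apply/measurable_EFinP; apply: measurable_funTS; exact: measurable_rect.
- by move=> z _; exact: rearr_yx_ge0.
- exact: rearr_yx_rect_le.
Qed.

Lemma Bp_of_maximal_yx :
  bounded_on_cone p (prodw u v) (fun f => maximal_yx (extend0 f)) -> Bp p u /\ Bp p v.
Proof.
move=> [C C0 hC].
apply: (@Bp_of_test (C `^ p)%R (fun r q => maximal_yx (rect r q))).
- exact: powR_gt0.
- move=> r q r0 q0; apply: measurable_funTS; apply: measurable_maximal_yx.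
  exact: measurable_rect.
- by move=> r q z _ _ _; exact: maximal_yx_ge0.
- by move=> r q s t r0 q0 s0 t0; exact: maximal_yx_rect_ge.
move=> r q r0 q0; apply: Lp_rect_pow_le => //.
  by move=> z _; exact: maximal_yx_ge0.
rewrite -{1}(extend0_rect r q); apply: hC; exact: rect_Lp_dec.
Qed.

Lemma Bp_of_maximal :
  equiv_on (Lambda2 p (prodw u v)) (fun f => Lp_norm p (prodw u v) (maximal f))
    (Lambda2_norm p (prodw u v)) -> Bp p u /\ Bp p v.
Proof.
move=> [C C0 hC].
apply: (@Bp_of_test (C `^ p)%R (fun r q => maximal (rect r q))).
- exact: powR_gt0.
- by move=> r q r0 q0; apply: measurable_maximal; exact: measurable_rect.
- by move=> r q z _ _; apply: maximal_ge0; exact: measurable_rect.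
- move=> r q s t r0 q0 s0 t0; apply: le_trans (maximal_yx_rect_ge r0 q0 s0 t0) _.
  by apply: maximal_yx_le_maximal; [exact: measurable_rect|rewrite Rp2E].
move=> r q r0 q0; apply: Lp_rect_pow_le => //.
  by move=> z; apply: maximal_ge0; exact: measurable_rect.
have [_ _ _ _ fin] := rect_Lp_dec r q p0 hu hv.
have hX : Lambda2 p (prodw u v) (rect r q).
  split; first exact: measurable_rect.
  exact: le_lt_trans (Lambda2_norm_rect _ _) fin.
apply: le_trans (hC _ hX).1 _; apply: lee_wpmul2l; first by rewrite lee_fin ltW.
exact: Lambda2_norm_rect.
Qed.

Lemma Bp_of_S2 :
  bounded_on_cone p (prodw u v) (fun f => S2 (EFin \o f)) -> Bp p u /\ Bp p v.
Proof.
move=> [C C0 hC].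
have mE r q : measurable_fun setT ((EFin \o rect r q) : mR * mR -> \bar R).
  by apply/measurable_EFinP; exact: measurable_rect.
have E0 r q z : 0 <= (EFin \o rect r q) z by rewrite lee_fin rect_ge0.
apply: (@Bp_of_test (C `^ p)%R (fun r q => S2 (EFin \o rect r q))).
- exact: powR_gt0.
- move=> r q r0 q0; have := measurable_iter_avg (mE r q) (E0 r q).
  move=> /(@measurable_funTS _ _ _ _ Rp2).
  by apply: eq_measurable_fun => z /set_mem zR; rewrite S2E.
- by move=> r q z _ _ zR; exact: S2_ge0.
- move=> r q s t r0 q0 s0 t0; apply: le_trans (maximal_yx_rect_ge r0 q0 s0 t0) _.
  have zR : Rp2 (s, t) by rewrite Rp2E.
  have mrect := measurable_rect r q.
  apply: (le_trans (maximal_yx_le_maximal mrect zR)).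
  rewrite (maximalE mrect zR) (S2E (mE r q) (E0 r q) zR).
  have mk := measurable_avg_param (mE r q) (E0 r q).
  have mk2 := measurable_avg_param (measurable_rearr_yx mrect) (rearr_yx_ge0 (rect r q)).
  apply: le_avg_fun.
  + exact: (measurable_fix2 t mk2).
  + exact: (measurable_fix2 t mk).
  + by move=> a; apply: avg_ge0 => b; exact: rearr_yx_ge0.
  move=> a a0; apply: le_avg_fun.
  + exact: (measurable_fix1 a (measurable_rearr_yx mrect)).
  + exact: (measurable_fix1 a (mE r q)).
  + by move=> b; exact: rearr_yx_ge0.
  by move=> b b0; apply: rearr_yx_rect_le; rewrite Rp2E.
move=> r q r0 q0; apply: Lp_rect_pow_le => //.
  by move=> z; exact: S2_ge0.
apply: hC; exact: rect_Lp_dec.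
Qed.

End test.

End operators_to_Bp.

(** * From subadditivity to B_p *)

Section subadditivity_to_Bp.
Context {R : realType}.
Local Notation mR := (measurableTypeR R).
Local Open Scope ereal_scope.

(** A function that exceeds the level [c] only on an interval of length at
    most [s] has a rearrangement of at most [c] at [s]. *)
Lemma rearr_le_itv (g : mR -> \bar R) (a b c s : R) : measurable_fun setT g ->
  (0 <= c)%R -> (forall x, c%:E < `|g x| -> (a <= x <= b)%R) -> (0 <= s)%R ->
  (b - a <= s)%R -> rearr g s <= c%:E.
Proof.
move=> mg c0 h s0 bas; apply: rearr_le => //.
apply: (@le_trans _ _ (leb (`[a, b]%classic : set mR))).
  apply: le_measure; rewrite ?inE.
  - exact: measurable_superlevel.
  - exact: measurable_itv.
  - by move=> x /= /h; rewrite in_itv.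
by rewrite leb_itv/=; case: ifP => _; rewrite -?EFinB lee_fin.
Qed.

Section doubling.
Variables (p : R) (w : R -> R).
Hypotheses (p1 : (1 < p)%R) (hw : weight w).

Let p0 : (0 < p)%R. Proof. exact: lt_trans p1. Qed.

(** If a dilation by [m] multiplies the primitive by at most [m ^ p / 2], the
    parts of the B_p integral over the blocks ]m^k r, m^(k+1) r] decrease
    geometrically. *)
Lemma Bp_of_half (m : R) : (1 < m)%R ->
  (forall r, (0 < r)%R -> prim w (m * r) <= (m `^ p / 2)%:E * prim w r) -> Bp p w.
Proof.
move=> m1 hm; have m0 : (0 < m)%R by exact: lt_trans m1.
have mp0 : (0 < m `^ p)%R by exact: powR_gt0.
exists (m `^ p)%R => // r r0; rewrite -/(tail p w r) -/(prim w r).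
have block k s : (0 < s)%R ->
    \int[leb]_(x in `]s, (m ^+ k * s)%R]) (w x / x `^ p)%:E <=
    ((s `^ p)^-1 * m `^ p)%:E * prim w s.
  elim: k s => [|k IH] s s0.
    rewrite expr0 mul1r set_itv_ge ?integral_set0; last by rewrite bnd_simp ltxx.
    by rewrite mule_ge0 ?prim_ge0// lee_fin mulr_ge0 ?powR_ge0// invr_ge0 powR_ge0.
  have ms : (0 < m * s)%R by exact: mulr_gt0.
  have sms : (s <= m * s)%R by rewrite ler_peMl// ltW.
  have mk : (m * s <= m ^+ k.+1 * s)%R.
    by rewrite ler_pM2r// exprS ler_peMr// ?exprn_ege1// ltW.
  have R1 : `]s, (m * s)%R] `<=` @Rp R by apply: sub_itvoc_Rp; exact: ltW.
  have R2 : `](m * s)%R, (m ^+ k.+1 * s)%R] `<=` @Rp R by apply: sub_itvoc_Rp; exact: ltW.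
  have -> : `]s, (m ^+ k.+1 * s)%R]%classic =
      `]s, (m * s)%R]%classic `|` `](m * s)%R, (m ^+ k.+1 * s)%R]%classic :> set mR.
    by rewrite -itv_bndbnd_setU// bnd_simp.
  rewrite ge0_integral_setU//; last 3 first.
  - by apply: measurable_tail => // x [/R1|/R2].
  - by move=> x h; apply: tail_integrand_ge0 => //; case: h => [/R1|/R2].
  - apply/disj_setPS => x [] /=; rewrite !in_itv/= => /andP[_].
    by move=> /le_lt_trans h /andP[/h]; rewrite ltxx.
  have b1 := tail_block_le p0 hw s0 sms.
  have := IH _ ms; rewrite mulrA -exprSr => b2.
  apply: le_trans (leeD b1 b2) _.
  have sp0 : (s `^ p != 0)%R by rewrite gt_eqF ?powR_gt0.
  have mp0' : (m `^ p != 0)%R by rewrite gt_eqF.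
  have -> : (((m * s) `^ p)^-1 * m `^ p = (s `^ p)^-1)%R.
    by rewrite powRM ?(ltW m0) ?(ltW s0)//; field; rewrite sp0 mp0'.
  have V0 : 0 <= prim w (m * s) by exact: prim_ge0.
  rewrite -(fineK (prim_fin hw (m * s))) -(fineK (prim_fin hw s)) -!EFinM -EFinD lee_fin.
  have := hm _ s0; rewrite -(fineK (prim_fin hw (m * s))) -(fineK (prim_fin hw s)).
  rewrite -EFinM lee_fin => h.
  have si : (0 <= (s `^ p)^-1)%R by rewrite invr_ge0 powR_ge0.
  have := ler_wpM2l si h; set A := fine _; set B := fine _.
  have -> : ((s `^ p)^-1 * (m `^ p / 2 * B) = ((s `^ p)^-1 * m `^ p * B) / 2)%R by ring.
  by move=> hh /=; lra.
suff : tail p w r <= ((r `^ p)^-1 * m `^ p)%:E * prim w r.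
  have rp : 0 <= (r `^ p)%:E by rewrite lee_fin powR_ge0.
  move=> /(lee_wpmul2l rp) /le_trans; apply.
  by rewrite muleA -EFinM mulrA mulfV ?mul1r// gt_eqF// powR_gt0.
have RR : `]r, +oo[ `<=` @Rp R by apply: sub_itvy_Rp; exact: ltW.
rewrite /tail.
have -> : `]r, +oo[%classic = Rp `&` `]r, +oo[%classic :> set R.
  by apply/esym/setIidr.
rewrite integral_mkcondr; apply: integral_Rp_le.
- have [+ _] := measurable_restrict (fun x : mR => (w x / x `^ p)%:E)
    (measurable_itv `]r, +oo[) (@measurable_Rp R).
  by apply; apply: measurable_tail => // x [].
- by move=> x xR; rewrite patchE; case: ifP => // _; exact: tail_integrand_ge0.
move=> n; rewrite -integral_mkcondr.
have [k hk] : exists k : nat, (n%:R <= m ^+ k * r)%R.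
  have mi : (0 <= m^-1 < 1)%R by rewrite invr_ge0 (ltW m0)/= invf_lt1.
  have [k hk] := expr_small n%:R mi r0.
  exists k; rewrite -ler_pdivrMl ?exprn_gt0//; apply: le_trans hk.
  by rewrite exprVn mulrC.
apply: le_trans (block k _ r0); apply: ge0_subset_integral => //.
- by apply: measurableI.
- by apply: measurable_tail => // x; apply: sub_itvoc_Rp; exact: ltW.
- move=> x h; apply: tail_integrand_ge0 => //; move: x h; apply: sub_itvoc_Rp; exact: ltW.
- move=> x [] /=; rewrite !in_itv/= andbT => /andP[_ xn] rx; rewrite rx/=.
  exact: le_trans (ltW xn) hk.
Qed.

(** Bounded measurable functions with bounded support. *)
Definition adm (g : R -> R) :=
  measurable_fun setT (g : mR -> mR) /\
  exists B L : R, [/\ (0 < B)%R, (0 < L)%R, forall x, (`|g x| <= B)%R &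
    forall x, (L < `|x|)%R -> g x = 0%R].

(** The functional of the one-dimensional Lambda space, the norm in L^p(w) of
    the rearrangement. *)
Definition Lam (g : R -> R) : \bar R := norm1 p w (rearr (EFin \o g)).

Lemma adm0 : adm (fun=> 0%R).
Proof.
split; first exact: measurable_cst.
by exists 1%R, 1%R; split => // x; rewrite normr0.
Qed.

Lemma admD (f g : R -> R) : adm f -> adm g -> adm (fun x => f x + g x)%R.
Proof.
move=> [mf [B [L [B0 L0 hB hL]]]] [mg [B' [L' [B0' L0' hB' hL']]]].
split; first exact: measurable_funD.
exists (B + B')%R, (Num.max L L'); split.
- exact: addr_gt0.
- by rewrite lt_max L0.
- by move=> x; apply: le_trans (ler_normD _ _) _; exact: lerD.
- by move=> x; rewrite gt_max => /andP[h h']; rewrite hL// hL'// addr0.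
Qed.

Lemma adm_sum (phi : nat -> R -> R) m : (forall k, adm (phi k)) ->
  adm (fun x => \sum_(k < m) phi k x)%R.
Proof.
move=> h; elim: m => [|m IH].
  by under eq_fun do rewrite big_ord0; exact: adm0.
by under eq_fun do rewrite big_ord_recr/=; exact: admD.
Qed.

Lemma adm_meas (g : R -> R) : adm g -> measurable_fun setT (EFin \o g : mR -> \bar R).
Proof. by case=> mg _; apply/measurable_EFinP. Qed.

Lemma norm1_indic q :
  norm1 p w (fun t => (\1_(`]0%R, q[%classic : set R) t)%:E) = prim w q `^ p^-1.
Proof.
rewrite norm1E; last exact: indic_ge0.
congr (_ `^ _); rewrite -integral_indic_prim; apply: eq_integral => t _.
by rewrite indicE; case: (_ \in _); rewrite ?poweR1r ?poweR0r ?gt_eqF.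
Qed.

Lemma prim_root_fin q : prim w q `^ p^-1 \is a fin_num.
Proof. by rewrite fin_num_poweR// prim_fin. Qed.

Lemma Lam_ge0 g : 0 <= Lam g. Proof. exact: norm1_ge0. Qed.

Lemma Lam_le (g : R -> R) (B q : R) : measurable_fun setT (g : mR -> mR) -> (0 <= B)%R ->
  (forall s, (0 < s)%R -> rearr (EFin \o g) s <= B%:E * (\1_(`]0%R, q[%classic : set R) s)%:E) ->
  Lam g <= B%:E * prim w q `^ p^-1.
Proof.
move=> mg B0 h; rewrite -norm1_indic -[B in B%:E * norm1 _ _ _](ger0_norm B0).
have mi := @measurable_indic_itv R setT (Interval (BRight 0%R) (BLeft q)).
have mG : measurable_fun setT (EFin \o g : mR -> \bar R) by exact/measurable_EFinP.
rewrite -(norm1Z p1 hw B mi).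
exact: (norm1_le p1 hw (measurable_rearr mG) (measurable_funeM B%:E mi) (rearr_ge0 _) h).
Qed.

Lemma Lam_ge (g : R -> R) (B q : R) : measurable_fun setT (g : mR -> mR) -> (0 <= B)%R ->
  (0 < q)%R -> (forall x, (0 < x < q)%R -> (B <= g x)%R) ->
  B%:E * prim w q `^ p^-1 <= Lam g.
Proof.
move=> mg B0 q0 h; rewrite -norm1_indic -[B in B%:E * norm1 _ _ _](ger0_norm B0).
have mi := @measurable_indic_itv R setT (Interval (BRight 0%R) (BLeft q)).
have mG : measurable_fun setT (EFin \o g : mR -> \bar R) by exact/measurable_EFinP.
rewrite -(norm1Z p1 hw B mi).
apply: (norm1_le p1 hw (measurable_funeM B%:E mi) (measurable_rearr mG)).
  by move=> t; rewrite mule_ge0 ?indic_ge0.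
move=> t t0; rewrite indicE; case: (boolP (t \in _)) => [/set_mem/=|_]; last first.
  by rewrite mule0 rearr_ge0.
rewrite in_itv/= mule1 => /andP[_ tq].
apply: (rearr_ge_itv mG _ q0 tq) => x hx /=; rewrite lee_fin.
by apply: le_trans (h _ hx) _; exact: ler_norm.
Qed.

Lemma Lam_fin g : adm g -> Lam g \is a fin_num.
Proof.
move=> [mg [B [L [B0 L0 hB hL]]]]; rewrite ge0_fin_numE ?Lam_ge0//.
have mG : measurable_fun setT (EFin \o g : mR -> \bar R) by exact/measurable_EFinP.
apply: (@le_lt_trans _ _ (B%:E * prim w (2 * L) `^ p^-1)); last first.
  by rewrite -(fineK (prim_root_fin _)) -EFinM ltry.
apply: Lam_le => //; first exact: ltW.
move=> s s0; rewrite indicE; case: (boolP (s \in _)) => [_|/negP hs].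
  rewrite mule1; apply: rearr_le; first exact: ltW.
  rewrite /distr_fun (_ : [set _ | _] = set0) ?measure0 ?lee_fin ?ltW//.
  by rewrite -subset0 => x /=; rewrite lte_fin ltNge hB.
rewrite mule0; apply: (@rearr_le_itv _ (- L)%R L) => //.
- move=> x /=; rewrite lte_fin normr_gt0 => gx; rewrite -ler_norml leNgt.
  by apply/negP => /hL h; move: gx; rewrite h eqxx.
- exact: ltW.
- rewrite opprK leNgt; apply/negP => sL; apply: hs; apply/mem_set => /=.
  by rewrite in_itv/= s0/=; lra.
Qed.

(** From here on [Lam] is subadditive up to a constant, whatever the number of
    terms. *)
Hypothesis hsum : exists2 C : R, (0 < C)%R & forall m (phi : nat -> R -> R),
  (forall k, adm (phi k)) ->
  Lam (fun x => \sum_(k < m) phi k x)%R <= C%:E * \sum_(k < m) Lam (phi k).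

Lemma le_root (x y : \bar R) : 0 <= x -> 0 <= y -> x `^ p^-1 <= y `^ p^-1 -> x <= y.
Proof.
move=> x0 y0 /(le_poweR p0 (poweR_ge0 _ _)).
by rewrite -!poweRrM mulVf ?gt_eqF// !poweRe1.
Qed.

(** The indicator of an interval of length [2 r] centred at [k r]. *)
Let bump (r : R) (k : nat) : R -> R :=
  \1_(`](k%:R * r - r)%R, (k%:R * r + r)%R[%classic : set R).

Let bump_adm r k : (0 < r)%R -> adm (bump r k).
Proof.
move=> r0; split; first by apply: measurable_indic; exact: measurable_itv.
have kr0 : (0 <= k%:R * r)%R by rewrite mulr_ge0// ltW.
exists 1%R, (k%:R * r + r)%R; split => //.
- by lra.
- by move=> x; rewrite /bump indicE; case: (_ \in _); rewrite ?normr1 ?normr0.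
- move=> x hx; rewrite /bump indicE memNset//= in_itv/= => /andP[h1 h2].
  by move: hx; apply/negP; rewrite -leNgt ler_norml; apply/andP; split; lra.
Qed.

(** The interval ]0, j r[ is covered by [2 j] intervals of length [r]. *)
Lemma prim_dilation_le : exists2 C : R, (0 < C)%R & forall (j : nat) (r : R),
  (0 < r)%R -> prim w (j%:R * r) <= ((C * j%:R) `^ p)%:E * prim w r.
Proof.
have [C C0 hC] := hsum; exists (2 * C)%R; first exact: mulr_gt0.
move=> j s s0.
have [->|j0] := posnP j.
  rewrite mul0r prim_le0// mule_ge0 ?prim_ge0// lee_fin powR_ge0//.
pose r := (s / 2)%R; have r0 : (0 < r)%R by rewrite divr_gt0.
pose n := (2 * j)%N.
have -> : (j%:R * s = n%:R * r)%R by rewrite /n /r natrM; field.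
have n0 : (0 < n%:R :> R)%R by rewrite ltr0n muln_gt0.
have q0 : (0 < n%:R * r)%R by rewrite mulr_gt0.
have cov x : (0 < x < n%:R * r)%R -> (1 <= \sum_(k < n) bump r k x)%R.
  move=> /andP[x0 xn].
  have xr0 : (0 <= x / r)%R by rewrite divr_ge0// ltW.
  have hk := truncn_itv xr0; set k := Num.truncn _ in hk.
  move: hk => /andP[k1 k2].
  have kn : (k < n)%N.
    by rewrite -(ltr_nat R); apply: le_lt_trans k1 _; rewrite ltr_pdivrMr.
  rewrite (bigD1 (Ordinal kn))//=; apply: (@le_trans _ _ (bump r k x)); last first.
    by rewrite lerDl; apply: sumr_ge0 => i _; rewrite /bump indicE ler0n.
  rewrite /bump indicE mem_set//= in_itv/=.
  move: k1 k2; rewrite ler_pdivlMr// ltr_pdivrMr// -natr1 mulrDl mul1r => k1 k2.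
  by apply/andP; split; lra.
have msum : measurable_fun setT ((fun x => \sum_(k < n) bump r k x)%R : mR -> mR).
  by have [] := adm_sum n (fun k => bump_adm k r0).
have L1 := Lam_ge msum ler01 q0 cov; rewrite mul1e in L1.
have L2 k : Lam (bump r k) <= prim w s `^ p^-1.
  rewrite -[leRHS]mul1e; apply: Lam_le => //; first by have [] := bump_adm k r0.
  have mb := adm_meas (bump_adm k r0).
  move=> t t0; rewrite mul1e indicE; case: (boolP (t \in _)) => [_|/negP ht].
    apply: rearr_le => //=.
    rewrite /distr_fun (_ : [set _ | _] = set0) ?measure0 ?lee_fin ?ltW//.
    rewrite -subset0 => x /=; rewrite /bump lte_fin indicE; case: (_ \in _);
      by rewrite ?normr1 ?normr0 ?ltxx// ltr10.
  apply: (@rearr_le_itv _ (k%:R * r - r)%R (k%:R * r + r)%R) => //.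
  - move=> x /=; rewrite lte_fin /bump indicE; case: (boolP (x \in _)) => [/set_mem/=|_].
      by rewrite in_itv/= => /andP[h1 h2] _; rewrite (ltW h1) (ltW h2).
    by rewrite normr0 ltxx.
  - exact: ltW.
  - have -> : (k%:R * r + r - (k%:R * r - r) = s)%R by rewrite /r; lra.
    rewrite leNgt; apply/negP => ts; apply: ht; apply/mem_set => /=.
    by rewrite in_itv/= t0.
have := hC n (bump r) (fun k => bump_adm k r0).
have S : \sum_(k < n) Lam (bump r k) <= n%:R%:E * prim w s `^ p^-1.
  apply: (@le_trans _ _ (\sum_(k < n) prim w s `^ p^-1)).
    by apply: lee_sum => k _; exact: L2.
  by rewrite -(fineK (prim_root_fin s)) sumEFin sumr_const card_ord -EFinM mulr_natl.
have C0' : 0 <= C%:E by rewrite lee_fin ltW.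
move=> /(le_trans L1) /le_trans /(_ (lee_wpmul2l C0' S)) H.
apply: le_root; first exact: prim_ge0.
  by rewrite mule_ge0 ?prim_ge0// lee_fin powR_ge0.
apply: le_trans H _; rewrite poweRM ?prim_ge0 ?lee_fin ?powR_ge0//.
rewrite poweR_EFin -powRrM mulfV ?gt_eqF// powRr1; last first.
  by rewrite !mulr_ge0// ltW.
by rewrite muleA -EFinM /n natrM mulrA [(C * 2)%R]mulrC.
Qed.

(** The hyperbola r / |x - k r|, truncated at height 1 and cut off at distance
    [m r] from its centre [k r]. *)
Let hyp (r m : R) (k : nat) (x : R) : R :=
  (r / Num.max r `|x - k%:R * r| *
   \1_(`[(k%:R * r - m * r)%R, (k%:R * r + m * r)%R]%classic : set R) x)%R.

Let hyp_bound r m k x : (0 < r)%R -> (0 <= hyp r m k x <= 1)%R.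
Proof.
move=> r0; have M0 : (r <= Num.max r `|x - k%:R * r|)%R by rewrite le_max lexx.
have M1 : (0 < Num.max r `|x - k%:R * r|)%R by exact: lt_le_trans M0.
have q0 : (0 <= r / Num.max r `|x - k%:R * r|)%R by rewrite divr_ge0// ltW.
have q1 : (r / Num.max r `|x - k%:R * r| <= 1)%R by rewrite ler_pdivrMr// mul1r.
by rewrite /hyp indicE; case: (_ \in _); rewrite ?mulr1 ?mulr0 ?q0 ?lexx ?ler01.
Qed.

Let hyp_gt r m k x c : (0 < r)%R -> (0 <= c)%R -> (c < hyp r m k x)%R ->
  [/\ (`|x - k%:R * r| <= m * r)%R & (c * `|x - k%:R * r| < r)%R].
Proof.
move=> r0 c0; have M0 : (r <= Num.max r `|x - k%:R * r|)%R by rewrite le_max lexx.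
have M1 : (0 < Num.max r `|x - k%:R * r|)%R by exact: lt_le_trans M0.
have M2 : (`|x - k%:R * r| <= Num.max r `|x - k%:R * r|)%R by rewrite le_max lexx orbT.
rewrite /hyp indicE; case: (boolP (x \in _)) => [/set_mem/=|_]; last first.
  by rewrite mulr0 ltNge c0.
rewrite in_itv/= mulr1 ltr_pdivlMr// => /andP[h1 h2] h; split.
  by rewrite ler_norml; apply/andP; split; lra.
exact: le_lt_trans (ler_wpM2l c0 M2) h.
Qed.

Let hyp_adm r m k : (0 < r)%R -> (0 < m)%R -> adm (hyp r m k).
Proof.
move=> r0 m0; have mr0 : (0 < m * r)%R by exact: mulr_gt0.
have kr0 : (0 <= k%:R * r)%R by rewrite mulr_ge0// ltW.
split.
  apply: measurable_funM; last by apply: measurable_indic; exact: measurable_itv.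
  apply: measurable_funM; first exact: measurable_cst.
  apply: (measurableT_comp (@measurable_inv R)).
  apply: (@measurable_maxr _ _ _ _ (fun=> r) (fun x : mR => `|x - k%:R * r|%R)).
    exact: measurable_cst.
  apply: (measurableT_comp (@normr_measurable R setT)).
  by apply: measurable_funB => //; exact: measurable_cst.
exists 1%R, (k%:R * r + m * r)%R; split => //.
- exact: ltr_wpDl.
- by move=> x; have /andP[h0 h1] := hyp_bound m k x r0; rewrite ger0_norm.
- move=> x hx; have /andP[+ _] := hyp_bound m k x r0.
  rewrite le_eqVlt => /predU1P[//|/(hyp_gt r0 (lexx _))[h _]].
  exfalso; have := ler_normD (x - k%:R * r)%R (k%:R * r)%R.
  by rewrite subrK (ger0_norm kr0); lra.
Qed.

Let harmonic_ge n : (n%:R / 2 <= \sum_(j < 2 ^ n) (j.+1%:R)^-1 :> R)%R.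
Proof.
elim: n => [|n IH]; first by rewrite mul0r sumr_ge0.
rewrite expnS mul2n -addnn big_split_ord/=.
rewrite -natr1 mulrDl; apply: lerD => //.
apply: (@le_trans _ _ (\sum_(j < 2 ^ n) ((2 ^ n.+1)%:R)^-1)%R); last first.
  apply: ler_sum => j _; rewrite lef_pV2 ?posrE ?ltr0n ?expn_gt0// ler_nat.
  by rewrite expnS mul2n -addnn -addnS leq_add2l ltn_ord.
by rewrite sumr_const card_ord -[leRHS]mulr_natr expnS natrM invfM -mulrA mulVf ?mulr1 ?mul1r//.
Qed.

(** At a point of ]0, m r[ the hyperbolas centred to its right already
    contribute a partial harmonic series. *)
Let hyp_sum_ge r n x : (0 < r)%R -> (0 < x < (2 ^ n)%:R * r)%R ->
  (n%:R / 2 <= \sum_(k < 2 * 2 ^ n) hyp r (2 ^ n)%:R k x)%R.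
Proof.
move=> r0 /andP[x0 xm]; apply: le_trans (harmonic_ge n) _.
have xr0 : (0 <= x / r)%R by rewrite divr_ge0// ltW.
have hi := truncn_itv xr0; set i := Num.truncn _ in hi.
move: hi => /andP[i1 i2].
have im : (i < 2 ^ n)%N.
  by rewrite -(ltr_nat R); apply: le_lt_trans i1 _; rewrite ltr_pdivrMr.
move: i1 i2; rewrite ler_pdivlMr// ltr_pdivrMr// => i1 i2.
rewrite -(big_mkord xpredT (fun k => hyp r (2 ^ n)%:R k x)).
have im2 : (i.+1 + 2 ^ n <= 2 * 2 ^ n)%N by rewrite mul2n -addnn leq_add2r.
rewrite (@big_cat_nat _ _ _ i.+1) //=; last exact: leq_trans (leq_addr _ _) im2.
rewrite (@big_cat_nat _ _ _ (i.+1 + 2 ^ n) i.+1) //=; last exact: leq_addr.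
have s0 a b : (0 <= \sum_(a <= k < b) hyp r (2 ^ n)%:R k x)%R.
  by apply: sumr_ge0 => k _; have /andP[] := hyp_bound (2 ^ n)%:R k x r0.
rewrite addrA; apply: ler_wpDr => //; apply: ler_wpDl => //.
rewrite -{1}[i.+1]add0n big_addn addKn big_mkord.
apply: ler_sum => j _.
have jm : (j.+1 <= 2 ^ n)%N := ltn_ord j.
have jmR : (j.+1%:R <= (2 ^ n)%:R :> R)%R by rewrite ler_nat.
have j0 : (0 < j.+1%:R :> R)%R by rewrite ltr0n.
have d1 : (`|x - (j + i.+1)%:R * r| <= j.+1%:R * r)%R.
  move: i1 i2; rewrite natrD mulrDl -!natr1 !mulrDl !mul1r => i1 i2.
  have jr : (0 <= j%:R * r)%R by rewrite mulr_ge0// ltW.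
  by rewrite ler_norml; apply/andP; split; lra.
have d2 : (`|x - (j + i.+1)%:R * r| <= (2 ^ n)%:R * r)%R.
  by apply: le_trans d1 _; rewrite ler_pM2r.
rewrite /hyp indicE mem_set/=; last first.
  by rewrite in_itv/=; move: d2; rewrite ler_norml => /andP[? ?]; apply/andP; split; lra.
rewrite mulr1 ler_pdivlMr; last by rewrite lt_max r0.
rewrite ler_pdivrMl// ge_max d1 andbT ler_peMl//; first exact: ltW.
by rewrite ler1n.
Qed.

Let hyp_rearr_le r m k s l : (0 < r)%R -> (0 < m)%R -> (0 < s)%R ->
  (l == 0 \/ ((2 ^ l)%:R * r <= s)%R)%N ->
  rearr (EFin \o hyp r m k) s <= (2 / (2 ^ l)%:R)%:E.
Proof.
move=> r0 m0 s0 hl; have mh := adm_meas (hyp_adm k r0 m0).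
have L0 : (0 < (2 ^ l)%:R :> R)%R by rewrite ltr0n expn_gt0.
have c0 : (0 <= 2 / (2 ^ l)%:R :> R)%R by rewrite divr_ge0// ltW.
have [/eqP l0|ls] := hl.
  apply: rearr_le => //; rewrite /distr_fun (_ : [set _ | _] = set0) ?measure0 ?lee_fin ?ltW//.
  rewrite -subset0 => x /=; have /andP[h0 h1] := hyp_bound m k x r0.
  by rewrite l0 expn0 divr1 lte_fin ger0_norm// => /lt_le_trans /(_ h1); lra.
pose h := ((2 ^ l)%:R * r / 2)%R.
apply: (@rearr_le_itv _ (k%:R * r - h)%R (k%:R * r + h)%R) => //.
- move=> x /=; have /andP[h0 _] := hyp_bound m k x r0.
  rewrite lte_fin ger0_norm// => /(hyp_gt r0 c0)[_].
  rewrite mulrAC ltr_pdivrMr// => hx.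
  have : (`|x - k%:R * r| <= h)%R by rewrite /h; lra.
  by rewrite ler_norml => /andP[? ?]; apply/andP; split; lra.
- exact: ltW.
- by apply: le_trans ls; rewrite /h; lra.
Qed.

Let hyp_rearr0 r m k s : (0 < r)%R -> (0 < m)%R -> (2 * m * r <= s)%R ->
  rearr (EFin \o hyp r m k) s = 0.
Proof.
move=> r0 m0 ms; have mh := adm_meas (hyp_adm k r0 m0).
have mr0 : (0 < m * r)%R by exact: mulr_gt0.
apply/eqP; rewrite eq_le rearr_ge0 andbT.
apply: (@rearr_le_itv _ (k%:R * r - m * r)%R (k%:R * r + m * r)%R) => //.
- move=> x /=; have /andP[h0 _] := hyp_bound m k x r0.
  rewrite lte_fin ger0_norm// => /(hyp_gt r0 (lexx _))[+ _].
  by rewrite ler_norml => /andP[? ?]; apply/andP; split; lra.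
- by lra.
- by lra.
Qed.

(** The rearrangement of a hyperbola is at most 2 / 2^l on the dyadic block
    that ends at 2^(l+1) r, and it vanishes beyond 2^(n+1) r. *)
Let hyp_rearr_pow_le r n k s : (0 < r)%R -> (0 < s)%R ->
  rearr (EFin \o hyp r (2 ^ n)%:R k) s `^ p <=
  \sum_(l < n.+1) ((2 / (2 ^ l)%:R) `^ p)%:E *
    (\1_(`]0%R, ((2 ^ l.+1)%:R * r)%R[%classic : set R) s)%:E.
Proof.
move=> r0 s0; have m0 : (0 < (2 ^ n)%:R :> R)%R by rewrite ltr0n expn_gt0.
have t0 (l : nat) : 0 <= ((2 / (2 ^ l)%:R) `^ p)%:E *
    (\1_(`]0%R, ((2 ^ l.+1)%:R * r)%R[%classic : set R) s)%:E.
  by rewrite mule_ge0 ?indic_ge0// lee_fin powR_ge0.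
have [ms|sm] := leP ((2 ^ n.+1)%:R * r)%R s.
  rewrite hyp_rearr0 ?poweR0r ?gt_eqF//; first exact: sume_ge0.
  by move: ms; rewrite expnS natrM.
(* the dyadic block that contains [s] *)
have ex : exists l, (s < (2 ^ l.+1)%:R * r)%R by exists n.
case: (ex_minnP ex) => l sl lmin.
have ln : (l < n.+1)%N by rewrite ltnS; exact: lmin.
rewrite (bigD1 (Ordinal ln))//=; apply: (@le_trans _ _ (((2 / (2 ^ l)%:R) `^ p)%:E *
    (\1_(`]0%R, ((2 ^ l.+1)%:R * r)%R[%classic : set R) s)%:E)); last first.
  by rewrite leeDl// sume_ge0.
rewrite indicE mem_set/= ?in_itv/= ?s0// mule1 -poweR_EFin.
apply: le_poweR => //; first exact: rearr_ge0.
apply: hyp_rearr_le => //; case: l sl lmin {ln} => [|l] sl lmin; [by left|right].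
by rewrite leNgt; apply/negP => /lmin; rewrite ltnn.
Qed.

(** Each of the [n + 1] dyadic blocks contributes the same amount. *)
Let Lam_hyp_le (C : R) r n k : (0 < C)%R ->
  (forall (j : nat) (r : R), (0 < r)%R ->
    prim w (j%:R * r) <= ((C * j%:R) `^ p)%:E * prim w r) -> (0 < r)%R ->
  Lam (hyp r (2 ^ n)%:R k) <=
  ((4 * C) * (n.+1%:R `^ p^-1))%:E * prim w r `^ p^-1.
Proof.
move=> C0 hC r0; have m0 : (0 < (2 ^ n)%:R :> R)%R by rewrite ltr0n expn_gt0.
have C4 : (0 <= 4 * C)%R by rewrite mulr_ge0// ltW.
have mh := adm_meas (hyp_adm k r0 m0).
have mi l := @measurable_indic_itv R Rp (Interval (BRight 0%R) (BLeft ((2 ^ l.+1)%:R * r)%R)).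
have mw := weightM hw (fun x => id : Rp x -> Rp x).
rewrite /Lam norm1E; last by move=> t; exact: rearr_ge0.
have -> : ((4 * C * n.+1%:R `^ p^-1)%:E * prim w r `^ p^-1 =
    (((4 * C) `^ p * n.+1%:R)%:E * prim w r) `^ p^-1).
  rewrite poweRM ?prim_ge0//; last by rewrite lee_fin mulr_ge0 ?powR_ge0.
  by rewrite poweR_EFin powRM ?powR_ge0// -powRrM mulfV ?gt_eqF// powRr1.
apply: le_poweR; first by rewrite invr_gt0.
  apply: integral_ge0 => t tR; rewrite mule_ge0 ?poweR_ge0//.
  by rewrite lee_fin; case: hw => _ /(_ _ tR).
apply: (@le_trans _ _ (\int[leb]_(s in Rp) (\sum_(l < n.+1)
    ((2 / (2 ^ l)%:R) `^ p)%:E *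
    ((\1_(`]0%R, ((2 ^ l.+1)%:R * r)%R[%classic : set R) s)%:E * (w s)%:E)))).
  apply: ge0_le_integral => //; first exact: measurable_Rp.
  - move=> t tR; rewrite mule_ge0 ?poweR_ge0//.
    by rewrite lee_fin; case: hw => _ /(_ _ tR).
  - apply: emeasurable_funM; last exact: mw.
    apply: (@measurable_poweR_comp _ _ mR _ _ (rearr (EFin \o hyp r (2 ^ n)%:R k))).
    by apply: measurable_funTS; exact: measurable_rearr.
  - apply: (@emeasurable_sum _ mR) => l.
    exact: (measurable_funeM _ (emeasurable_funM (mi l) mw)).
  - move=> t tR; have w0 : 0 <= (w t)%:E by rewrite lee_fin; case: hw => _ /(_ _ tR).
    under eq_bigr do rewrite muleA.
    rewrite -ge0_sume_distrl; last first.
      by move=> i _; rewrite mule_ge0 ?indic_ge0// lee_fin powR_ge0.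
    apply: lee_wpmul2r => //; apply: hyp_rearr_pow_le => //.
    by move: tR; rewrite RpE.
rewrite ge0_integral_sum; last 3 first.
- exact: measurable_Rp.
- by move=> l; exact: (measurable_funeM _ (emeasurable_funM (mi l) mw)).
- move=> l t tR; rewrite mule_ge0 ?mule_ge0 ?indic_ge0// lee_fin ?powR_ge0//.
  by case: hw => _ /(_ _ tR).
apply: (@le_trans _ _ (\sum_(l < n.+1) ((4 * C) `^ p)%:E * prim w r)).
  apply: lee_sum => l _; rewrite ge0_integralZl_EFin ?powR_ge0//; last 3 first.
  - exact: measurable_Rp.
  - move=> t tR; rewrite mule_ge0 ?indic_ge0// lee_fin.
    by case: hw => _ /(_ _ tR).
  - exact: (emeasurable_funM (mi l) mw).
  rewrite integral_indic_prim.
  have q0 : 0 <= ((2 / (2 ^ l)%:R) `^ p)%:E by rewrite lee_fin powR_ge0.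
  apply: le_trans (lee_wpmul2l q0 (hC _ _ r0)) _.
  have L0 : (0 < (2 ^ l)%:R :> R)%R by rewrite ltr0n expn_gt0.
  rewrite muleA -EFinM -powRM ?divr_ge0 ?mulr_ge0 ?(ltW C0) ?(ltW L0)//.
  rewrite (_ : (2 / (2 ^ l)%:R * (C * (2 ^ l.+1)%:R) = 4 * C)%R)//.
  rewrite expnS natrM; field; by rewrite gt_eqF.
rewrite -(fineK (prim_fin hw r)) -EFinM sumEFin sumr_const card_ord -EFinM lee_fin.
by rewrite -[leLHS]mulr_natr mulrAC.
Qed.

Lemma Bp_of_sum : Bp p w.
Proof.
have [C1 C10 h1] := hsum; have [C2 C20 h2] := prim_dilation_le.
pose K := (16 * C1 * C2)%R; have K0 : (0 < K)%R by rewrite /K !mulr_gt0.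
have Kp0 : (0 < K `^ p)%R by exact: powR_gt0.
pose N := (4 * K `^ p)%R; have N0 : (0 < N)%R by rewrite mulr_gt0.
have p10 : (0 < p - 1)%R by rewrite subr_gt0.
(* [n] is so large that [K `^ p * (n + 1) / n `^ p] is at most 1/2 *)
have [n n_gt0 nN] : exists2 n, (0 < n)%N & (N <= n%:R `^ (p - 1))%R.
  exists (Num.truncn (N `^ (p - 1)^-1)).+1 => //.
  have /andP[_ /ltW h] := truncn_itv (powR_ge0 N (p - 1)^-1).
  have := ge0_ler_powR (ltW p10) (powR_ge0 _ _) (ler0n _ _) h.
  by rewrite -powRrM mulVf ?gt_eqF// powRr1// ltW.
have n0 : (0 < n%:R :> R)%R by rewrite ltr0n.
have m0 : (0 < (2 ^ n)%:R :> R)%R by rewrite ltr0n expn_gt0.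
apply: (@Bp_of_half (2 ^ n)%:R).
  by rewrite ltr1n -(expn0 2) ltn_exp2l.
move=> r r0; pose m : R := (2 ^ n)%:R.
have q0 : (0 < m * r)%R by rewrite mulr_gt0.
have ha k : adm (hyp r m k) by exact: hyp_adm.
have [ms _] := adm_sum (2 * 2 ^ n) ha.
have n20 : (0 <= n%:R / 2 :> R)%R by rewrite divr_ge0.
have A1 := Lam_ge ms n20 q0 (fun x => @hyp_sum_ge r n x r0).
have A2 := h1 (2 * 2 ^ n)%N (hyp r m) ha.
have A3 : \sum_(k < 2 * 2 ^ n) Lam (hyp r m k) <=
    ((2 * m) * ((4 * C2) * (n.+1%:R `^ p^-1)))%:E * prim w r `^ p^-1.
  apply: (@le_trans _ _ (\sum_(k < 2 * 2 ^ n)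
      ((4 * C2) * (n.+1%:R `^ p^-1))%:E * prim w r `^ p^-1)).
    by apply: lee_sum => k _; exact: Lam_hyp_le.
  rewrite -(fineK (prim_root_fin r)) -EFinM sumEFin sumr_const card_ord -EFinM lee_fin.
  by rewrite -[leLHS]mulr_natl natrM -!mulrA.
have C1' : 0 <= C1%:E by rewrite lee_fin ltW.
have := le_trans A1 (le_trans A2 (lee_wpmul2l C1' A3)).
rewrite muleA -EFinM => B1.
have nn : (0 <= (n%:R / 2)^-1 :> R)%R by rewrite invr_ge0.
have := lee_wpmul2l (_ : 0 <= ((n%:R / 2)^-1)%:E) B1.
rewrite lee_fin => /(_ nn); rewrite !muleA -!EFinM mulVf ?mul1e; last first.
  by rewrite gt_eqF// divr_gt0.
have alg (a b c d e : R) : (a != 0)%R ->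
    ((a / 2)^-1 * (b * (2 * c * (4 * d * e))) = c * (16 * b * d) / a * e)%R.
  by move=> a0; field; rewrite a0.
rewrite alg ?gt_eqF// -/K.
move=> B2; apply: le_root; first exact: prim_ge0.
  by rewrite mule_ge0 ?prim_ge0// lee_fin divr_ge0 ?powR_ge0.
apply: le_trans B2 _; rewrite poweRM ?prim_ge0 ?lee_fin ?divr_ge0 ?powR_ge0//.
apply: lee_wpmul2r; first exact: poweR_ge0.
rewrite poweR_EFin lee_fin.
have m0' : (0 < m)%R by [].
have mKn : (0 <= m * K / n%:R)%R by apply: divr_ge0; [apply: mulr_ge0; exact: ltW|exact: ltW].
have alg2 (a b c : R) : (0 <= a)%R -> (0 <= b)%R -> (0 < c)%R ->
    (a * b / c = (a `^ p * (b `^ p / c `^ p)) `^ p^-1)%R.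
  move=> a0 b0 c0; have ci0 : (0 <= c^-1)%R by rewrite invr_ge0 ltW.
  have -> : ((c `^ p)^-1 = c^-1 `^ p)%R.
    by rewrite -(powR_inv1 (ltW c0)) -powRrM mulN1r powRN.
  rewrite mulrA -(powRM p a0 b0) -(powRM p (mulr_ge0 a0 b0) ci0).
  by rewrite -powRrM mulfV ?gt_eqF// powRr1// !mulr_ge0.
have e1 := alg2 m K n%:R (ltW m0) (ltW K0) n0.
have mp : (0 < m `^ p)%R by exact: powR_gt0.
have Y0 : (0 <= K `^ p / n%:R `^ p)%R by rewrite divr_ge0 ?powR_ge0.
have X0 : (0 <= m `^ p * (K `^ p / n%:R `^ p))%R by exact: mulr_ge0 (ltW mp) Y0.
rewrite e1 -(powRM p^-1 X0 (ler0n _ n.+1)).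
apply: ge0_ler_powR; rewrite ?nnegrE; first by rewrite invr_ge0 ltW.
- by apply: mulr_ge0.
- by rewrite divr_ge0// ltW.
rewrite -mulrA ler_pM2l ?powR_gt0//.
have np0 : (0 < n%:R `^ p)%R by exact: powR_gt0.
rewrite mulrAC ler_pdivrMr//.
have -> : (n%:R `^ p = n%:R `^ (p - 1) * n%:R)%R.
  by rewrite -[X in (_ * X)%R]powRr1 ?ler0n// -powRD ?subrK// gt_eqF ?implybT.
have n1 : (n.+1%:R <= 2 * n%:R :> R)%R by rewrite -natrM ler_nat mul2n -addnn -addn1 leq_add2l.
apply: (@le_trans _ _ (K `^ p * (2 * n%:R))%R); first by rewrite ler_pM2l.
have := ler_wpM2r (ltW n0) nN; rewrite /N.
by move: (K `^ p)%R (n%:R `^ (p - 1))%R (n%:R)%R => a b c; lra.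
Qed.

End doubling.

End subadditivity_to_Bp.

(** * From normability to subadditivity *)

Section normability_to_Bp.
Context {R : realType}.
Local Notation mR := (measurableTypeR R).
Local Open Scope ereal_scope.

Section sum_of_normable.
Variables (p : R) (w : R -> R).

(** A normable functional that restricts to [Lam] along a linear embedding of
    the functions of one variable makes [Lam] subadditive up to a constant. *)
Lemma sum_of_normable (X : set (R * R -> R)) (M : (R * R -> R) -> \bar R)
    (J : (R -> R) -> R * R -> R) (K : R) :
  normable X M -> (0 < K)%R -> (forall z, J (fun=> 0%R) z = 0%R) ->
  (forall f g z, J (fun x => f x + g x)%R z = (J f z + J g z)%R) ->
  (forall g, adm g -> X (J g)) -> (forall g, adm g -> M (J g) = K%:E * Lam p w g) ->
  exists2 C : R, (0 < C)%R & forall m (phi : nat -> R -> R),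
    (forall k, adm (phi k)) ->
    Lam p w (fun x => \sum_(k < m) phi k x)%R <= C%:E * \sum_(k < m) Lam p w (phi k).
Proof.
move=> [N [Xadd Xscale N0 _ NZ Ntri] [C C0 hC]] K0 J0 JD JX JM.
exists (C * C)%R; first exact: mulr_gt0.
move=> m phi hphi.
have NJ : N (J (fun x => \sum_(k < m) phi k x)%R) <= \sum_(k < m) N (J (phi k)).
  elim: m => [|m IH].
    rewrite big_ord0; have X0 := JX _ adm0.
    have -> : J (fun x => \sum_(k < 0) phi k x)%R = (fun z => 0 * J (fun=> 0) z)%R.
      apply/funext => z; rewrite mul0r -[RHS](J0 z); congr (J _ z).
      by apply/funext => x; rewrite big_ord0.
    by rewrite NZ// normr0 mul0e.
  rewrite big_ord_recr/=.
  have -> : J (fun x => \sum_(k < m.+1) phi k x)%R =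
      (fun z => J (fun x => \sum_(k < m) phi k x) z + J (phi m) z)%R.
    apply/funext => z; rewrite -JD; congr (J _ z).
    by apply/funext => x; rewrite big_ord_recr.
  apply: le_trans (Ntri _ _ (JX _ (adm_sum m hphi)) (JX _ (hphi m))) _.
  by rewrite leeD2r.
have as' := adm_sum m hphi.
have [_ h1] := hC _ (JX _ as'); rewrite JM// in h1.
have C0' : 0 <= C%:E by rewrite lee_fin ltW.
have h2 : \sum_(k < m) N (J (phi k)) <= \sum_(k < m) C%:E * (K%:E * Lam p w (phi k)).
  by apply: lee_sum => k _; rewrite -JM//; exact: (hC _ (JX _ (hphi k))).1.
have := le_trans h1 (lee_wpmul2l C0' (le_trans NJ h2)).
have L0 k : 0 <= Lam p w (phi k) by exact: Lam_ge0.
rewrite -ge0_sume_distrr; last by move=> k _; rewrite mule_ge0// lee_fin ltW.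
rewrite -ge0_sume_distrr// !muleA -!EFinM mulrC EFinM -muleA.
by rewrite (@lee_pmul2l _ K%:E).
Qed.

End sum_of_normable.

(** The indicator of ]0, q[. *)
Let ind (q : R) : R -> R := \1_(`]0%R, q[%classic : set R).

Let measurable_ind q : measurable_fun setT (ind q : mR -> mR).
Proof. by apply: measurable_indic; exact: measurable_itv. Qed.

Let measurable_indE q : measurable_fun setT ((fun t => (ind q t)%:E) : mR -> \bar R).
Proof. exact: measurable_indic_itv. Qed.

Let ind_ge0 q t : (0 <= ind q t)%R.
Proof. by rewrite /ind indicE ler0n. Qed.

Lemma rearr_indic (q t : R) : (0 < q)%R -> (0 < t)%R ->
  rearr (fun y => (ind q y)%:E) t = (ind q t)%:E.
Proof.
move=> q0 t0; apply/eqP; rewrite eq_le; apply/andP; split; last first.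
  rewrite {1}/ind indicE; case: (boolP (t \in _)) => [/set_mem/=|_]; last exact: rearr_ge0.
  rewrite in_itv/= => /andP[_ tq].
  apply: (rearr_ge_itv (measurable_indE q) _ q0 tq) => x hx.
  by rewrite /ind indicE mem_set/= ?normr1// in_itv.
rewrite {2}/ind indicE; case: (boolP (t \in _)) => [_|/negP ht].
  apply: rearr_le => //.
  rewrite /distr_fun (_ : [set _ | _] = set0) ?measure0 ?lee_fin ?(ltW t0)//.
  rewrite -subset0 => x /=; rewrite lte_fin /ind indicE.
  by case: (_ \in _); rewrite ?normr1 ?normr0 ?ltxx// ltr10.
apply: (@rearr_le_itv R _ 0%R q) => //; last 2 first.
- exact: ltW.
- rewrite subr0 leNgt; apply/negP => tq; apply: ht; apply/mem_set => /=.
  by rewrite in_itv/= t0.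
move=> x /=; rewrite lte_fin /ind indicE; case: (boolP (x \in _)) => [/set_mem/=|_].
  by rewrite in_itv/= => /andP[h1 h2] _; rewrite !ltW.
by rewrite normr0 ltxx.
Qed.

Lemma rearr_norm (g : R -> R) t :
  rearr (fun x => `|g x|%:E) t = rearr (EFin \o g) t.
Proof.
rewrite /rearr; congr (ereal_inf (_ @` _)); apply/seteqP; split => a /= [a0 h]; split => //.
  by move: h; rewrite /distr_fun; under eq_set do rewrite /= normr_id.
by rewrite /distr_fun; under eq_set do rewrite /= normr_id.
Qed.

Section embeddings.
Variables (p : R) (u v : R -> R).
Hypotheses (p1 : (1 < p)%R) (hu : weight u) (hv : weight v).
Let p0 : (0 < p)%R. Proof. exact: lt_trans p1. Qed.

(** The products of a function of one variable and an indicator of the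
    other. *)
Let tens1 (q : R) (g : R -> R) : R * R -> R := fun z => (g z.1 * ind q z.2)%R.
Let tens2 (q : R) (g : R -> R) : R * R -> R := fun z => (ind q z.1 * g z.2)%R.

Let meas_tens1 q g : adm g -> meas2 setT (tens1 q g).
Proof.
move=> [mg _]; apply: measurable_funM.
  by apply: (@measurableT_comp _ _ _ _ _ _ (g : mR -> mR)) => //; exact: measurable_fst.
apply: (@measurableT_comp _ _ _ _ _ _ (ind q : mR -> mR)) => //; exact: measurable_snd.
Qed.

Let meas_tens2 q g : adm g -> meas2 setT (tens2 q g).
Proof.
move=> [mg _]; apply: measurable_funM; last first.
  by apply: (@measurableT_comp _ _ _ _ _ _ (g : mR -> mR)) => //; exact: measurable_snd.
apply: (@measurableT_comp _ _ _ _ _ _ (ind q : mR -> mR)) => //; exact: measurable_fst.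
Qed.

Let rearr_y_tens1 q g x t : (0 < q)%R -> (0 < t)%R ->
  rearr_y (tens1 q g) x t = `|g x|%:E * (ind q t)%:E.
Proof.
move=> q0 t0; rewrite -(rearr_indic q0 t0).
exact: (rearrZ (g x) (measurable_indE q) (ltW t0)).
Qed.

Let rearr_y_tens2 q g x t : adm g -> (0 < t)%R ->
  rearr_y (tens2 q g) x t = (ind q x)%:E * rearr (EFin \o g) t.
Proof.
move=> ag t0; rewrite -[ind q x in RHS](ger0_norm (ind_ge0 _ _)).
exact: (rearrZ (ind q x) (adm_meas ag) (ltW t0)).
Qed.

Let rearr_fin (g : R -> R) (t : R) : adm g -> (0 <= t)%R -> rearr (EFin \o g) t \is a fin_num.
Proof.
move=> [_ [B [_ [B0 _ hB _]]]] t0; rewrite ge0_fin_numE ?rearr_ge0//.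
apply: (@le_lt_trans _ _ B%:E); last exact: ltry.
apply: rearr_le; first exact: ltW.
rewrite /distr_fun (_ : [set _ | _] = set0) ?measure0 ?lee_fin//.
by rewrite -subset0 => x /=; rewrite lte_fin ltNge hB.
Qed.

Let rearr_yx_tens1 q g s t : adm g -> (0 < q)%R -> (0 < s)%R -> (0 < t)%R ->
  rearr_yx (tens1 q g) (s, t) = rearr (EFin \o g) s * (ind q t)%:E.
Proof.
move=> ag q0 s0 t0; rewrite muleC -(rearr_norm g).
have ma : measurable_fun setT ((fun x => `|g x|%:E) : mR -> \bar R).
  have [mg _] := ag; apply/measurable_EFinP.
  exact: (measurableT_comp (@normr_measurable R setT) mg).
rewrite -[ind q t](ger0_norm (ind_ge0 _ _)) -(rearrZ (ind q t) ma (ltW s0)).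
rewrite /rearr_yx/=; congr (rearr _ s); apply/funext => x.
by rewrite rearr_y_tens1// muleC.
Qed.

Let rearr_yx_tens2 q g s t : adm g -> (0 < q)%R -> (0 < s)%R -> (0 < t)%R ->
  rearr_yx (tens2 q g) (s, t) = (ind q s)%:E * rearr (EFin \o g) t.
Proof.
move=> ag q0 s0 t0; have rf := fineK (rearr_fin ag (ltW t0)).
have rn : (0 <= fine (rearr (EFin \o g) t))%R by apply: fine_ge0; exact: rearr_ge0.
rewrite muleC -rf -(ger0_norm rn) -(rearr_indic q0 s0).
rewrite -(rearrZ _ (measurable_indE q) (ltW s0)).
rewrite /rearr_yx/=; congr (rearr _ s); apply/funext => x.
by rewrite rearr_y_tens2// muleC rf.
Qed.

Let Lp_norm_tens (a b : R -> \bar R) (f : R * R -> R) :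
  measurable_fun setT (a : mR -> \bar R) -> measurable_fun setT (b : mR -> \bar R) ->
  (forall x, 0 <= a x) -> (forall x, 0 <= b x) ->
  (forall s t, (0 < s)%R -> (0 < t)%R -> rearr_yx f (s, t) = a s * b t) ->
  Lambda2_norm p (prodw u v) f = norm1 p u a * norm1 p v b.
Proof.
move=> ma mb a0 b0 hf; rewrite !norm1E//.
have I0 (c : R -> \bar R) (w : R -> R) : weight w -> (forall x, 0 <= c x) ->
    0 <= \int[leb]_(t in Rp) (c t `^ p * (w t)%:E).
  move=> [_ w0 _] c0; apply: integral_ge0 => t tR.
  by rewrite mule_ge0 ?poweR_ge0// lee_fin w0.
rewrite -poweRM ?I0// -integral_prod_split//; last 4 first.
- by apply: measurable_funTS; exact: (@measurable_poweR_comp _ _ mR).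
- by apply: measurable_funTS; exact: (@measurable_poweR_comp _ _ mR).
- by move=> x _; exact: poweR_ge0.
- by move=> x _; exact: poweR_ge0.
rewrite /Lambda2_norm /Lp_norm; congr (_ `^ _); apply: eq_integral => -[s t] /set_mem.
rewrite Rp2E/= => -[s0 t0]; congr (_ * _).
by rewrite hf// gee0_abs ?mule_ge0// poweRM.
Qed.

Let norm1_ind (w : R -> R) q : norm1 p w (fun t => (ind q t)%:E) = prim w q `^ p^-1.
Proof. exact: norm1_indic. Qed.

Let measurable_rearr_adm (g : R -> R) : adm g -> measurable_fun setT (rearr (EFin \o g) : mR -> \bar R).
Proof. by move=> ag; apply: measurable_rearr; exact: adm_meas. Qed.

Let Lambda2_norm_tens1 q g : adm g -> (0 < q)%R ->
  Lambda2_norm p (prodw u v) (tens1 q g) = prim v q `^ p^-1 * Lam p u g.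
Proof.
move=> ag q0; rewrite muleC -norm1_ind.
apply: Lp_norm_tens => //; first exact: measurable_rearr_adm.
- by move=> x; exact: rearr_ge0.
- by move=> x; rewrite lee_fin.
- by move=> s t s0 t0; exact: rearr_yx_tens1.
Qed.

Let Lambda2_norm_tens2 q g : adm g -> (0 < q)%R ->
  Lambda2_norm p (prodw u v) (tens2 q g) = prim u q `^ p^-1 * Lam p v g.
Proof.
move=> ag q0; rewrite -norm1_ind.
apply: Lp_norm_tens => //; first exact: measurable_rearr_adm.
- by move=> x; rewrite lee_fin.
- by move=> x; exact: rearr_ge0.
- by move=> s t s0 t0; exact: rearr_yx_tens2.
Qed.

Let mixed_norm_tens1 q g : adm g -> (0 < q)%R ->
  mixed_norm p u v (tens1 q g) = prim v q `^ p^-1 * Lam p u g.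
Proof.
move=> ag q0; rewrite mixed_normE//; last exact: meas_tens1.
have ff := prim_root_fin p hv q.
have f0 : (0 <= fine (prim v q `^ p^-1))%R by apply: fine_ge0; exact: poweR_ge0.
rewrite -(fineK ff) -{1}(ger0_norm f0) -norm1Z//; last exact: measurable_rearr_adm.
apply: eq_norm1 => s s0; rewrite -(rearr_norm g) -{1}(ger0_norm f0).
have ma : measurable_fun setT ((fun x => `|g x|%:E) : mR -> \bar R).
  have [mg _] := ag; apply/measurable_EFinP.
  exact: (measurableT_comp (@normr_measurable R setT) mg).
rewrite -(rearrZ _ ma (ltW s0)).
congr (rearr _ s); apply/funext => x.
rewrite (fineK ff) -norm1_ind muleC -(normr_id (g x)) -norm1Z//.
by apply: eq_norm1 => t t0; exact: rearr_y_tens1.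
Qed.

Let mixed_norm_tens2 q g : adm g -> (0 < q)%R ->
  mixed_norm p u v (tens2 q g) = prim u q `^ p^-1 * Lam p v g.
Proof.
move=> ag q0; rewrite mixed_normE//; last exact: meas_tens2.
have ff := Lam_fin p1 hv ag.
have f0 : (0 <= fine (Lam p v g))%R by apply: fine_ge0; exact: Lam_ge0.
rewrite -norm1_ind muleC -(fineK ff) -{1}(ger0_norm f0) -norm1Z//.
apply: eq_norm1 => s s0; rewrite -(rearr_indic q0 s0) -{1}(ger0_norm f0).
rewrite -(rearrZ _ (measurable_indE q) (ltW s0)).
congr (rearr _ s); apply/funext => x.
rewrite (fineK ff) muleC -(ger0_norm (ind_ge0 q x)) -norm1Z//; last exact: measurable_rearr_adm.
by apply: eq_norm1 => t t0; exact: rearr_y_tens2.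
Qed.

Hypothesis hu0 : ~ {ae @leb R, forall x : R, (0 < x)%R -> u x = 0%R}.
Hypothesis hv0 : ~ {ae @leb R, forall x : R, (0 < x)%R -> v x = 0%R}.

Let Bp_of_normable (X : set (R * R -> R)) (M : (R * R -> R) -> \bar R) :
  (forall f, meas2 setT f -> M f < +oo -> X f) ->
  (forall q g, adm g -> (0 < q)%R -> M (tens1 q g) = prim v q `^ p^-1 * Lam p u g) ->
  (forall q g, adm g -> (0 < q)%R -> M (tens2 q g) = prim u q `^ p^-1 * Lam p v g) ->
  normable X M -> Bp p u /\ Bp p v.
Proof.
move=> hX h1 h2 nXM.
have root_gt0 w q : weight w -> 0 < prim w q -> (0 < fine (prim w q `^ p^-1))%R.
  move=> hw w0; apply: fine_gt0; rewrite poweR_gt0//=.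
  by rewrite -(fineK (prim_root_fin p hw q)) ltry.
split; apply: Bp_of_sum => //.
- have [q q0 pq] := prim_pos_ex hv hv0; have ff := prim_root_fin p hv q.
  apply: (@sum_of_normable p u X M (tens1 q) (fine (prim v q `^ p^-1))) => //.
  + exact: root_gt0.
  + by move=> z; rewrite /tens1 mul0r.
  + by move=> f g z; rewrite /tens1 mulrDl.
  + move=> g ag; apply: hX; first exact: meas_tens1.
    by rewrite h1// -(fineK ff) -(fineK (Lam_fin p1 hu ag)) -EFinM ltry.
  + by move=> g ag; rewrite (fineK ff) h1.
- have [q q0 pq] := prim_pos_ex hu hu0; have ff := prim_root_fin p hu q.
  apply: (@sum_of_normable p v X M (tens2 q) (fine (prim u q `^ p^-1))) => //.
  + exact: root_gt0.
  + by move=> z; rewrite /tens2 mulr0.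
  + by move=> f g z; rewrite /tens2 mulrDr.
  + move=> g ag; apply: hX; first exact: meas_tens2.
    by rewrite h2// -(fineK ff) -(fineK (Lam_fin p1 hv ag)) -EFinM ltry.
  + by move=> g ag; rewrite (fineK ff) h2.
Qed.

Lemma Bp_of_Lambda2_normable :
  normable (Lambda2 p (prodw u v)) (Lambda2_norm p (prodw u v)) -> Bp p u /\ Bp p v.
Proof.
apply: Bp_of_normable => [f mf hf|q g|q g]; first by split.
- exact: Lambda2_norm_tens1.
- exact: Lambda2_norm_tens2.
Qed.

Lemma Bp_of_mixed_normable :
  normable (mixed_Lambda p u v) (mixed_norm p u v) -> Bp p u /\ Bp p v.
Proof.
apply: Bp_of_normable => [f mf hf|q g|q g]; first by split.
- exact: mixed_norm_tens1.
- exact: mixed_norm_tens2.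
Qed.

End embeddings.

End normability_to_Bp.

Theorem theorem2p4 (R : realType) (p : R) (u v : R -> R)
    (hp : 1 < p) (hu : weight u) (hv : weight v)
    (hu0 : ~ {ae @leb R, forall x : R, 0 < x -> u x = 0})
    (hv0 : ~ {ae @leb R, forall x : R, 0 < x -> v x = 0}) :
  [<-> normable (Lambda2 p (prodw u v)) (Lambda2_norm p (prodw u v));
       Bp p u /\ Bp p v;
       normable (mixed_Lambda p u v) (mixed_norm p u v);
       is_norm_on (Lambda2 p (prodw u v))
         (fun f => Lp_norm p (prodw u v) (maximal_yx f)) /\
       equiv_on (Lambda2 p (prodw u v))
         (fun f => Lp_norm p (prodw u v) (maximal_yx f))
         (Lambda2_norm p (prodw u v));
       bounded_on_cone p (prodw u v) (fun f => S2 (EFin \o f));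
       bounded_on_cone p (prodw u v) (fun f => maximal_yx (extend0 f));
       equiv_on (Lambda2 p (prodw u v))
         (fun f => Lp_norm p (prodw u v) (maximal f))
         (Lambda2_norm p (prodw u v))].
Proof.
tfae.
- exact: Bp_of_Lambda2_normable.
- by move=> [Bu Bv]; exact: mixed_normable.
- move=> h; have [Bu Bv] := Bp_of_mixed_normable hp hu hv hu0 hv0 h.
  exact: maximal_yx_norm.
- move=> [n e]; have [] := @Bp_of_Lambda2_normable R p u v hp hu hv hu0 hv0.
    by exists (fun f => Lp_norm p (prodw u v) (maximal_yx f)).
  exact: S2_bounded.
- by move=> h; have [Bu Bv] := Bp_of_S2 hp hu hv hu0 hv0 h; exact: maximal_yx_bounded.
- by move=> h; have [Bu Bv] := Bp_of_maximal_yx hp hu hv hu0 hv0 h; exact: maximal_equiv.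
- move=> h; have [Bu Bv] := Bp_of_maximal hp hu hv hu0 hv0 h.
  have [n e] := maximal_yx_norm hp hu hv Bu Bv hu0 hv0.
  by exists (fun f => Lp_norm p (prodw u v) (maximal_yx f)).
Qed.
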